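(* Let $k=s+\frac12$ with $s\in\mathbb Z$, and write $s=12a+b$ with $a\in\mathbb Z$ and $b\in\{6,8,9,10,11,12,13,14,15,16,17,19\}$. There are absolute positive constants $A\le 9$ and $B\le 109$ such that the following holds. Let $m$ be an integer with $m\ge A|a|+B$ and $m\equiv 0,(-1)^{s-1}\pmod 4$, and let $\{f_{2-k,i}\}$ be the canonical basis of $M^!_{2-k}$, indexed by the admissible indices $i$ for weight $2-k$ in increasing order. Then for any integer $M>3a+\frac{3m}4+\frac b2-C$, it is impossible that the Fourier coefficients of $q^m$ in each of the first $M$ basis elements $f_{2-k,i}$ with $i\not\equiv m\pmod 4$ simultaneously vanish.
   Context: Let $q=e^{2\pi i\tau}$ and $\vartheta(\tau)=\sum_{n\in\mathbb Z}q^{n^2}$. For a weight $\kappa=t+\frac12$, $t\in\mathbb Z$, $M^!_\kappa$ is the space of holomorphic functions on the upper half plane, possibly with poles at the cusps, transforming like $\vartheta^{2\kappa}$ under $\Gamma_0(4)$ and satisfying Kohnen's plus space condition (Fourier expansion $\sum_{(-1)^tn\equiv0,1\,(4)}a(n)q^n$). Write $t=6\ell+\frac{k'}2$ with $\ell\in\mathbb Z$, $k'\in\{0,4,6,8,10,14\}$; let $N_\kappa=2\ell$ if $\ell$ is even and $N_\kappa=2\ell-(-1)^t$ if $\ell$ is odd. An integer $i$ is an admissible index for weight $\kappa$ if $i\ge -N_\kappa$ and $(-1)^{t-1}i\equiv0,1\pmod4$; for each such $i$ the canonical basis element is $f_{\kappa,i}(\tau)=q^{-i}+\sum_{n>N_\kappa,\,(-1)^tn\equiv0,1\,(4)}a_\kappa(i,n)q^n\in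 M^!_\kappa$, and these form a basis of $M^!_\kappa$. The constant $C$ is: $C=1$ if $m$ and $b$ are even; $C=\frac32$ if $m$ is even and $b$ odd; $C=\frac34$ if $m$ is odd and $b\in\{6,8,9,10,11,13\}$; $C=\frac74$ if $m$ is odd and $b\in\{12,14,15,16,17,19\}$. *)

(* Defs.v *)
From Stdlib Require Import Reals ZArith List.
From Coquelicot Require Export Coquelicot.
Open Scope R_scope.

Definition Cexp (z : C) : C :=
  (exp (Re z) * cos (Im z), exp (Re z) * sin (Im z)).

Definition qpow (tau : C) (n : Z) : C :=
  Cexp (Cmult (Cmult (RtoC (2 * PI * IZR n)) Ci) tau).

(* theta(tau) = sum_{n in Z} q^{n^2} = 1 + 2 sum_{k >= 1} q^{k^2} *)
Definition theta (tau : C) : C :=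
  (1 + 2 * Series (fun k : nat => Re (qpow tau (Z.of_nat (S k) * Z.of_nat (S k)))),
   2 * Series (fun k : nat => Im (qpow tau (Z.of_nat (S k) * Z.of_nat (S k))))).

Definition Czpow (z : C) (n : Z) : C :=
  match n with
  | Z0 => RtoC 1
  | Zpos p => Cpow z (Pos.to_nat p)
  | Zneg p => Cinv (Cpow z (Pos.to_nat p))
  end.

Definition mobius (a b c d : Z) (tau : C) : C :=
  Cdiv (Cplus (Cmult (RtoC (IZR a)) tau) (RtoC (IZR b)))
       (Cplus (Cmult (RtoC (IZR c)) tau) (RtoC (IZR d))).

Definition in_Gamma0_4 (a b c d : Z) : Prop :=
  (a * d - b * c = 1)%Z /\ (4 | c)%Z.

(* Fourier coefficient of q^n of a 1-periodic function, computed on Im tau = 1 *)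
Definition fcoef (f : C -> C) (n : Z) : C :=
  RInt (V := C_R_CompleteNormedModule)
    (fun x : R => Cmult (f (x, 1)) (qpow (x, 1) (- n))) 0 1.

Definition plus_okb (t n : Z) : bool :=
  let r := ((if Z.even t then n else - n) mod 4)%Z in
  (Z.eqb r 0 || Z.eqb r 1)%bool.

(* weight kappa = t + 1/2 *)
Definition holo_on_H (f : C -> C) : Prop :=
  forall tau : C, 0 < Im tau -> ex_derive (K := C_AbsRing) (V := C_NormedModule) f tau.

Definition transforms_like_theta (t : Z) (f : C -> C) : Prop :=
  forall a b c d : Z, in_Gamma0_4 a b c d ->
  forall tau : C, 0 < Im tau ->
    f (mobius a b c d tau) =
    Cmult (Czpow (Cdiv (theta (mobius a b c d tau)) (theta tau)) (2 * t + 1)) (f tau).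

(* meromorphic (at worst poles) at every cusp: for every gamma in SL2(Z),
   |(c tau + d)^{-kappa} f(gamma tau)| = O(exp(N Im tau)) as Im tau -> oo *)
Definition poles_at_cusps (t : Z) (f : C -> C) : Prop :=
  forall a b c d : Z, (a * d - b * c = 1)%Z ->
  exists K N : R, forall tau : C, 1 <= Im tau ->
    Cmod (f (mobius a b c d tau)) <=
    K * exp (N * Im tau) *
    Rpower (Cmod (Cplus (Cmult (RtoC (IZR c)) tau) (RtoC (IZR d)))) (IZR t + / 2).

Definition plus_space (t : Z) (f : C -> C) : Prop :=
  forall n : Z, plus_okb t n = false -> fcoef f n = RtoC 0.

Definition in_Mshriek (t : Z) (f : C -> C) : Prop :=
  holo_on_H f /\ transforms_like_theta t f /\ poles_at_cusps t f /\ plus_space t f.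

(* t = 6 l + k'/2, k'/2 in {0,2,3,4,5,7} *)
Definition kp_half (t : Z) : Z :=
  match (t mod 6)%Z with
  | 1%Z => 7%Z
  | r => r
  end.
Definition ell (t : Z) : Z := ((t - kp_half t) / 6)%Z.
Definition Nk (t : Z) : Z :=
  if Z.even (ell t) then (2 * ell t)%Z
  else (2 * ell t - (if Z.even t then 1 else -1))%Z.

Definition admissibleb (t i : Z) : bool :=
  (Z.leb (- Nk t) i && plus_okb (t - 1) i)%bool.

Definition canonical (t i : Z) (f : C -> C) : Prop :=
  in_Mshriek t f /\ fcoef f (- i) = RtoC 1 /\
  forall n : Z, (n <= Nk t)%Z -> n <> (- i)%Z -> fcoef f n = RtoC 0.

Definition qualb (t m j : Z) : bool :=
  (admissibleb t j && negb (Z.eqb (j mod 4) (m mod 4)))%bool.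

(* number of qualifying indices strictly smaller than i (0-based position) *)
Definition rank (t m i : Z) : nat :=
  length (filter (fun k : nat => qualb t m (- Nk t + Z.of_nat k)%Z)
                 (seq 0 (Z.to_nat (i + Nk t)))).

Definition Cconst (m b : Z) : R :=
  if Z.even m then (if Z.even b then 1 else 3 / 2)
  else (if existsb (Z.eqb b) (6 :: 8 :: 9 :: 10 :: 11 :: 13 :: nil)%Z then 3 / 4 else 7 / 4).

Definition b_range : list Z := (6 :: 8 :: 9 :: 10 :: 11 :: 12 :: 13 :: 14 :: 15 :: 16 :: 17 :: 19 :: nil)%Z.

(* Main.v *)
Require Import Defs.
From Stdlib Require Import Reals ZArith List Lra Lia Classical ClassicalEpsilon.
From Coquelicot Require Import Coquelicot.
Open Scope R_scope.

(** Put [t = 1 - s]. A form [f] of weight [t + 1/2] in the plus space has two parts [h0], [h1],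
    supported on the two admissible residue classes of exponents modulo 4. As functions of [4 tau]
    they are transformed by [z -> z + 1] and [z -> -1/z] like the two parts [x], [y] of
    [theta (z / 4)], up to scalars. Hence the quotient of the Wronskians of [h0, h1] and of [x, y]
    has weight [2 t] for SL2(Z) up to a character, while [D = x y (x^4 - y^4)] has weight 3; neither
    [D] nor the Wronskian of [x, y] has zeros. If the parts have orders [n0 / 4] and [n1 / 4] with
    [3 (n0 + n1) > 2 t + 3], then the twelfth power of the quotient divided by [D^(8 t)] has weight
    0 and vanishes at infinity, so it is zero; comparing leading terms, [f = 0].

    Suppose that the coefficients of [q^m] vanish. Among [N + 1] consecutive basis elements whose
    indices lie in one class different from that of [m], some nontrivial combination kills the first
    [N] coefficients above the gap in the class of [m]; when the next exponent is [m] itself, its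
    coefficient vanishes for free. This one extra zero violates the estimate, so the combination
    is zero, which is impossible. The lower bound on [m] only serves to make the indices
    used fall among the first [M].

    The transformation law of theta rests on a uniqueness statement: the Fourier coefficients of an
    entire function with the quasi-periods of the Jacobi theta function satisfy a recursion, so such
    a function is a multiple of it. *)

(** * Complex numbers *)

Lemma Cmod_triangle_minus (a b : C) : Cmod (a - b) <= Cmod a + Cmod b.
Proof. rewrite <- (Cmod_opp b). apply Cmod_triangle. Qed.

Lemma Cmod_minus_sym (a b : C) : Cmod (a - b) = Cmod (b - a).
Proof. rewrite <- Cmod_opp. f_equal. ring. Qed.

Lemma Cmod_triangle_inv (a b : C) : Cmod a - Cmod b <= Cmod (a - b).
Proof.
  assert (triangle := Cmod_triangle (a - b) b).
  replace (a - b + b)%C with a in triangle by ring. lra.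
Qed.

Lemma Cminus_diag (z : C) : (z - z)%C = RtoC 0.
Proof. ring. Qed.

Lemma Cmod_small_eq_0 (z : C) : (forall eps, 0 < eps -> Cmod z <= eps) -> z = RtoC 0.
Proof.
  intros small. apply Cmod_eq_0, Rle_antisym; [|apply Cmod_ge_0].
  apply Rnot_lt_le. intros pos. specialize (small (Cmod z / 2)). lra.
Qed.

Lemma Ci_sqr : (Ci * Ci)%C = RtoC (-1).
Proof. apply injective_projections; simpl; ring. Qed.

Lemma Ci_pow4 : (Ci ^ 4)%C = RtoC 1.
Proof. apply injective_projections; simpl; ring. Qed.

Lemma im_le_Cmod (z : C) : Rabs (Im z) <= Cmod z.
Proof. eapply Rle_trans; [apply Rmax_r|apply Rmax_Cmod]. Qed.

Lemma im_minus (a b : C) : Im (a - b) = Im a - Im b.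
Proof. reflexivity. Qed.

Lemma Cmod_sqr (z : C) : Cmod z * Cmod z = Re z * Re z + Im z * Im z.
Proof. generalize (Cmod2_alt z). simpl. rewrite !Rmult_1_r. auto. Qed.

Lemma Cmod_le_Re_Im (z : C) : Cmod z <= Rabs (Re z) + Rabs (Im z).
Proof.
  assert (re_nonneg := Rabs_pos (Re z)). assert (im_nonneg := Rabs_pos (Im z)).
  apply Rsqr_incr_0_var; [|lra]. unfold Rsqr. rewrite Cmod_sqr.
  assert (re_sqr := Rsqr_abs (Re z)). assert (im_sqr := Rsqr_abs (Im z)). unfold Rsqr in *. nra.
Qed.

Lemma Cmult_integral (a b : C) : (a * b)%C = RtoC 0 -> a = RtoC 0 \/ b = RtoC 0.
Proof.
  intros ab. destruct (Ceq_dec a (RtoC 0)) as [|na]; [auto|].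
  destruct (Ceq_dec b (RtoC 0)) as [|nb]; [auto|]. destruct (Cmult_neq_0 a b na nb ab).
Qed.

Lemma Cmult_reg_l (c a b : C) : c <> RtoC 0 -> (c * a)%C = (c * b)%C -> a = b.
Proof.
  intros nc ca_cb. apply Ceq_minus. destruct (Cmult_integral c (a - b)) as [|]; [|contradiction|auto].
  transitivity (c * a - c * b)%C; [ring|]. rewrite ca_cb. ring.
Qed.

Lemma Cinv_neq_0 (z : C) : z <> RtoC 0 -> (/ z)%C <> RtoC 0.
Proof. intros nz. apply Cmod_gt_0. rewrite Cmod_inv by exact nz. apply Rinv_0_lt_compat, Cmod_gt_0, nz. Qed.

Lemma exp_le (x y : R) : x <= y -> exp x <= exp y.
Proof. intros [lt| ->]; [left; apply exp_increasing; auto|right; auto]. Qed.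

Lemma exp_mult_INR (x : R) (n : nat) : exp (x * INR n) = exp x ^ n.
Proof.
  induction n as [|n IH]; [simpl; rewrite Rmult_0_r; apply exp_0|].
  rewrite S_INR. simpl. rewrite <- IH, <- exp_plus. f_equal. ring.
Qed.

Lemma pow_half_lt (x eps : R) : 0 < eps -> exists n, x / 2 ^ n < eps.
Proof.
  intros eps_pos. assert (x_pos := Rabs_pos x).
  destruct (pow_lt_1_zero (/ 2) ltac:(rewrite Rabs_pos_eq; lra) (eps / (Rabs x + 1))) as [n small];
    [apply Rdiv_lt_0_compat; lra|].
  exists n. specialize (small n (le_n n)).
  rewrite <- RPow_abs, Rabs_pos_eq, pow_inv in small by lra.
  assert (inv_pos : 0 < / 2 ^ n) by (apply Rinv_0_lt_compat, pow_lt; lra).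
  apply Rmult_lt_compat_r with (r := Rabs x + 1) in small; [|lra].
  unfold Rdiv in small at 1. rewrite Rmult_assoc, Rinv_l, Rmult_1_r in small by lra.
  assert (x_le := Rle_abs x). unfold Rdiv. nra.
Qed.

(** * Limits, continuity and complex derivatives *)

Lemma locally_Cmod (z : C) (P : C -> Prop) :
  locally z P <-> exists d, 0 < d /\ forall w, Cmod (w - z) < d -> P w.
Proof.
  rewrite (locally_C z P). split.
  - intros [d near]. exists d. split; [apply cond_pos|exact near].
  - intros [d [d_pos near]]. exists (mkposreal d d_pos). exact near.
Qed.

Lemma filterlim_subseq {T : Type} (F : (T -> Prop) -> Prop) (u : nat -> T) (phi : nat -> nat) (d : nat) :
  (forall N, N <= phi N + d)%nat -> filterlim u eventually F -> filterlim (fun N => u (phi N)) eventually F.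
Proof.
  intros large lim P near. destruct (lim P near) as [N0 all]. exists (N0 + d)%nat.
  intros N N_ge. apply all. specialize (large N). lia.
Qed.

Lemma filterlim_Cmod {T : Type} (F : (T -> Prop) -> Prop) {FF : Filter F} (f : T -> C) (l : C) :
  filterlim f F (locally l) <-> forall eps, 0 < eps -> F (fun x => Cmod (f x - l) < eps).
Proof.
  split.
  - intros lim eps eps_pos. apply (lim (fun w => Cmod (w - l) < eps)). apply locally_Cmod. eauto.
  - intros small P near. apply locally_Cmod in near. destruct near as [d [d_pos near]].
    apply (filter_imp _ _ (fun x => near (f x))). apply small, d_pos.
Qed.

Lemma filterlim_C_unique {T : Type} (F : (T -> Prop) -> Prop) {FF : ProperFilter F} (f : T -> C) (a b : C) :
  filterlim f F (locally a) -> filterlim f F (locally b) -> a = b.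
Proof. apply (filterlim_locally_unique (V := C_NormedModule)). Qed.

Lemma filterlim_C_plus {T : Type} (F : (T -> Prop) -> Prop) {FF : Filter F} (f g : T -> C) (a b : C) :
  filterlim f F (locally a) -> filterlim g F (locally b) ->
  filterlim (fun x => f x + g x)%C F (locally (a + b)%C).
Proof.
  intros fa gb. eapply filterlim_comp_2; [apply fa|apply gb|].
  apply (filterlim_plus (V := C_NormedModule) a b).
Qed.

Lemma filterlim_C_AbsRing {T : Type} (F : (T -> Prop) -> Prop) (f : T -> C) (l : C) :
  filterlim f F (locally l) <-> filterlim f F (locally (T := AbsRing_UniformSpace C_AbsRing) l).
Proof. split; intros lim P near; apply lim, locally_C, near. Qed.

Lemma filterlim_C_mult {T : Type} (F : (T -> Prop) -> Prop) {FF : Filter F} (f g : T -> C) (a b : C) :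
  filterlim f F (locally a) -> filterlim g F (locally b) ->
  filterlim (fun x => f x * g x)%C F (locally (a * b)%C).
Proof.
  rewrite !filterlim_C_AbsRing. intros fa gb. eapply filterlim_comp_2; [apply fa|apply gb|].
  apply (filterlim_mult (K := C_AbsRing) a b).
Qed.

Lemma filterlim_C_minus {T : Type} (F : (T -> Prop) -> Prop) {FF : Filter F} (f g : T -> C) (a b : C) :
  filterlim f F (locally a) -> filterlim g F (locally b) ->
  filterlim (fun x => f x - g x)%C F (locally (a - b)%C).
Proof.
  intros fa gb. apply filterlim_C_plus; auto. eapply filterlim_comp; [apply gb|].
  apply (filterlim_opp (V := C_NormedModule) b).
Qed.

Lemma filterlim_Cinv (z : C) : z <> RtoC 0 -> filterlim Cinv (locally z) (locally (/ z)%C).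
Proof.
  intros nz. assert (m_pos := proj1 (Cmod_gt_0 z) nz). set (m := Cmod z) in *.
  apply (filterlim_Cmod (locally z)). intros eps eps_pos. apply locally_Cmod.
  exists (Rmin (m / 2) (eps * (m * m / 2))).
  split; [apply Rmin_pos; [lra|apply Rmult_lt_0_compat; nra]|]. intros w near.
  assert (near_half := Rmin_l (m / 2) (eps * (m * m / 2))).
  assert (near_eps := Rmin_r (m / 2) (eps * (m * m / 2))).
  assert (w_large : m / 2 < Cmod w).
  { assert (gap := Cmod_triangle_inv z w). rewrite Cmod_minus_sym in gap. fold m in gap. lra. }
  assert (nw : w <> RtoC 0) by (apply Cmod_gt_0; lra).
  replace (/ w - / z)%C with ((z - w) / (w * z))%C by (field; auto).
  rewrite Cmod_div, Cmod_mult, Cmod_minus_sym by (apply Cmult_neq_0; auto). fold m.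
  apply Rmult_lt_reg_r with (Cmod w * m); [nra|].
  unfold Rdiv. rewrite Rmult_assoc, Rinv_l, Rmult_1_r by nra.
  eapply Rlt_le_trans; [apply near|]. eapply Rle_trans; [apply near_eps|].
  apply Rmult_le_compat_l; nra.
Qed.

Lemma filterlim_C_inv {T : Type} (F : (T -> Prop) -> Prop) {FF : Filter F} (f : T -> C) (a : C) :
  a <> RtoC 0 -> filterlim f F (locally a) -> filterlim (fun x => / f x)%C F (locally (/ a)%C).
Proof. intros na fa. eapply filterlim_comp; [apply fa|]. apply filterlim_Cinv, na. Qed.

Lemma is_derive_C_AbsRing (f : C -> C) (z l : C) :
  is_derive f z l <-> is_derive (V := AbsRing_NormedModule C_AbsRing) f z l.
Proof. split; intros [_ dom]; (split; [apply is_linear_scal_l|exact dom]). Qed.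

Lemma is_derive_Cmod (f : C -> C) (z l : C) :
  is_derive f z l <->
  forall eps, 0 < eps -> exists d, 0 < d /\ forall w, Cmod (w - z) < d ->
    Cmod (f w - f z - l * (w - z)) <= eps * Cmod (w - z).
Proof.
  assert (remainder : forall w, minus (minus (f w) (f z)) (scal (minus w z) l) = (f w - f z - l * (w - z))%C).
  { intros w. change (f w - f z - (w - z) * l = f w - f z - l * (w - z))%C. ring. }
  split.
  - intros [_ dom] eps eps_pos.
    destruct (dom z (fun P near => near) (mkposreal eps eps_pos)) as [d near].
    exists d. split; [apply cond_pos|]. intros w close. rewrite <- remainder. apply (near w close).
  - intros small. split; [apply is_linear_scal_l|]. intros y lim eps.
    apply (is_filter_lim_locally_unique (V := AbsRing_NormedModule C_AbsRing)) in lim. subst y.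
    destruct (small eps (cond_pos eps)) as [d [d_pos near]].
    exists (mkposreal d d_pos). intros w close. rewrite remainder. apply (near w close).
Qed.

Lemma is_derive_C_val (f : C -> C) (z a b : C) : is_derive f z a -> a = b -> is_derive f z b.
Proof. intros fa <-. exact fa. Qed.

Lemma is_derive_C_id (z : C) : is_derive (fun w : C => w) z (RtoC 1).
Proof. apply is_derive_C_AbsRing, (is_derive_id (K := C_AbsRing)). Qed.

Lemma is_derive_C_mult (f g : C -> C) (z a b : C) :
  is_derive f z a -> is_derive g z b -> is_derive (fun w => f w * g w)%C z (a * g z + f z * b)%C.
Proof.
  rewrite !is_derive_C_AbsRing. intros fa gb.
  apply (is_derive_mult (K := C_AbsRing) f g z a b fa gb). apply Cmult_comm.
Qed.

Lemma is_derive_C_comp (f g : C -> C) (z a b : C) :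
  is_derive f (g z) a -> is_derive g z b -> is_derive (fun w => f (g w)) z (b * a)%C.
Proof.
  rewrite (is_derive_C_AbsRing g). apply (is_derive_comp (V := C_NormedModule) f g).
Qed.

Lemma is_derive_C_inv (z : C) : z <> RtoC 0 -> is_derive Cinv z (- / (z * z))%C.
Proof.
  intros nz. apply is_derive_Cmod. intros eps eps_pos.
  assert (lim := proj1 (filterlim_Cmod (locally z) Cinv (/ z)%C) (filterlim_Cinv z nz)).
  assert (m_pos := proj1 (Cmod_gt_0 z) nz).
  destruct (proj1 (locally_Cmod _ _) (lim (eps * Cmod z) ltac:(apply Rmult_lt_0_compat; auto)))
    as [d [d_pos near]].
  exists (Rmin d (Cmod z)). split; [apply Rmin_pos; auto|]. intros w close.
  assert (close_d := Rmin_l d (Cmod z)). assert (close_z := Rmin_r d (Cmod z)).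
  assert (nw : w <> RtoC 0).
  { intros ->. revert close. replace (RtoC 0 - z)%C with (- z)%C by ring. rewrite Cmod_opp. lra. }
  replace (/ w - / z - - / (z * z) * (w - z))%C with ((/ z - / w) * / z * (w - z))%C by (field; auto).
  rewrite !Cmod_mult, Cmod_inv, (Cmod_minus_sym (/ z)) by auto.
  apply Rmult_le_compat_r; [apply Cmod_ge_0|].
  apply Rmult_le_reg_r with (Cmod z); [auto|]. rewrite Rmult_assoc, Rinv_l, Rmult_1_r by lra.
  left. apply near. lra.
Qed.

Lemma is_derive_C_scal (c : C) (f : C -> C) (z a : C) :
  is_derive f z a -> is_derive (fun w => c * f w)%C z (c * a)%C.
Proof.
  intros fa. replace (c * a)%C with (RtoC 0 * f z + c * a)%C by ring.
  apply (is_derive_C_mult (fun _ => c)); [apply (is_derive_const (V := C_NormedModule) c z)|auto].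
Qed.

Lemma is_derive_C_lin (f g : C -> C) (c d z a b : C) :
  is_derive f z a -> is_derive g z b -> is_derive (fun w => c * f w + d * g w)%C z (c * a + d * b)%C.
Proof.
  intros fa gb.
  apply (is_derive_plus (V := C_NormedModule) (fun w => c * f w)%C (fun w => d * g w)%C);
    apply is_derive_C_scal; auto.
Qed.

Lemma is_derive_C_affine (c d z : C) : is_derive (fun w => c * w + d)%C z c.
Proof.
  apply is_derive_C_val with (c * RtoC 1 + RtoC 0)%C; [|ring].
  apply (is_derive_plus (V := C_NormedModule) (fun w => c * w)%C (fun _ => d)).
  - apply is_derive_C_scal, is_derive_C_id.
  - apply (is_derive_const (V := C_NormedModule) d z).
Qed.

Lemma is_derive_C_derive (f : C -> C) (z : C) : ex_derive f z -> is_derive f z (C_derive f z).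
Proof. apply C_derive_correct, z. Qed.

Lemma is_derive_C_ext (f g : C -> C) (z l : C) : (forall w, f w = g w) -> is_derive f z l -> is_derive g z l.
Proof. apply (is_derive_ext (V := C_NormedModule)). Qed.

Lemma is_derive_C_ext_loc (f g : C -> C) (z l : C) :
  locally z (fun w => f w = g w) -> is_derive f z l -> is_derive g z l.
Proof. intros agree. apply is_derive_ext_loc. apply locally_C, agree. Qed.

Lemma C_derive_ext_loc (f g : C -> C) (z : C) :
  locally z (fun w => f w = g w) -> ex_derive f z -> C_derive f z = C_derive g z.
Proof.
  intros agree diff. symmetry. apply is_C_derive_unique.
  apply (is_derive_C_ext_loc f); [auto|]. apply is_derive_C_derive, diff.
Qed.

Lemma ex_derive_C_const (c z : C) : ex_derive (fun _ : C => c) z.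
Proof. apply (ex_derive_const (V := C_NormedModule)). Qed.

Lemma ex_derive_C_affine (c d z : C) : ex_derive (fun w : C => c * w + d)%C z.
Proof. eexists. apply is_derive_C_affine. Qed.

Lemma ex_derive_C_mult (f g : C -> C) (z : C) :
  ex_derive f z -> ex_derive g z -> ex_derive (fun w => f w * g w)%C z.
Proof. intros [a fa] [b gb]. eexists. apply is_derive_C_mult; eauto. Qed.

Lemma ex_derive_C_lin (f g : C -> C) (c d z : C) :
  ex_derive f z -> ex_derive g z -> ex_derive (fun w => c * f w + d * g w)%C z.
Proof. intros [a fa] [b gb]. eexists. apply is_derive_C_lin; eauto. Qed.

Lemma ex_derive_C_comp (f g : C -> C) (z : C) :
  ex_derive f (g z) -> ex_derive g z -> ex_derive (fun w => f (g w)) z.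
Proof. intros [a fa] [b gb]. eexists. apply is_derive_C_comp; eauto. Qed.

Lemma ex_derive_C_inv (f : C -> C) (z : C) :
  ex_derive f z -> f z <> RtoC 0 -> ex_derive (fun w => / f w)%C z.
Proof.
  intros diff nz. apply (ex_derive_C_comp Cinv); auto. eexists. apply is_derive_C_inv, nz.
Qed.

Lemma ex_derive_C_pow (f : C -> C) (z : C) (n : nat) : ex_derive f z -> ex_derive (fun w => f w ^ n)%C z.
Proof.
  intros diff. induction n as [|n IH]; [apply (ex_derive_C_const (RtoC 1))|apply (ex_derive_C_mult f); auto].
Qed.

Lemma ex_derive_C_continuous (f : C -> C) (z : C) : ex_derive f z -> continuous f z.
Proof.
  intros diff P near. apply locally_C. apply (ex_derive_continuous f z diff P near).
Qed.

Lemma continuous_C_mult {T : UniformSpace} (f g : T -> C) (x : T) :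
  continuous f x -> continuous g x -> continuous (fun y => f y * g y)%C x.
Proof. exact (filterlim_C_mult (locally x) f g (f x) (g x)). Qed.

Lemma continuous_C_plus {T : UniformSpace} (f g : T -> C) (x : T) :
  continuous f x -> continuous g x -> continuous (fun y => f y + g y)%C x.
Proof. exact (filterlim_C_plus (locally x) f g (f x) (g x)). Qed.

Lemma continuous_C_minus {T : UniformSpace} (f g : T -> C) (x : T) :
  continuous f x -> continuous g x -> continuous (fun y => f y - g y)%C x.
Proof. exact (filterlim_C_minus (locally x) f g (f x) (g x)). Qed.

Lemma continuous_C_inv {T : UniformSpace} (f : T -> C) (x : T) :
  f x <> RtoC 0 -> continuous f x -> continuous (fun y => / f y)%C x.
Proof. exact (filterlim_C_inv (locally x) f (f x)). Qed.

Lemma continuous_pair {T : UniformSpace} (f g : T -> R) (x : T) :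
  continuous f x -> continuous g x -> continuous (fun y => (f y, g y) : C) x.
Proof.
  intros f_cont g_cont P [d near]. change (locally x (fun y => P (f y, g y))).
  apply (filter_imp (fun y => ball (f x) d (f y) /\ ball (g x) d (g y))).
  - intros y [f_near g_near]. apply near. split; auto.
  - apply filter_and; [apply f_cont|apply g_cont]; exists d; auto.
Qed.

(** * Integrals of complex-valued functions of a real variable *)

Definition CInt (f : R -> C) (a b : R) : C := RInt (V := C_R_CompleteNormedModule) f a b.
Notation ex_CInt := (ex_RInt (V := C_R_CompleteNormedModule)).
Notation is_CInt := (is_RInt (V := C_R_CompleteNormedModule)).

Lemma norm_C_R (z : C) : norm (V := C_R_NormedModule) z = Cmod z.
Proof.
  change (sqrt (Rabs (fst z) ^ 2 + Rabs (snd z) ^ 2) = Cmod z). rewrite !pow2_abs. reflexivity.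
Qed.

Lemma ex_CInt_continuous (f : R -> C) (a b : R) : (forall x, continuous f x) -> ex_CInt f a b.
Proof. intros cont. apply ex_RInt_continuous. intros x _. apply cont. Qed.

Lemma is_CInt_unique (f : R -> C) (a b : R) (l : C) : is_CInt f a b l -> CInt f a b = l.
Proof. apply (is_RInt_unique (V := C_R_CompleteNormedModule)). Qed.

Lemma CInt_correct (f : R -> C) (a b : R) : ex_CInt f a b -> is_CInt f a b (CInt f a b).
Proof. apply (RInt_correct (V := C_R_CompleteNormedModule)). Qed.

Lemma CInt_ext (f g : R -> C) (a b : R) :
  (forall x, Rmin a b < x < Rmax a b -> f x = g x) -> CInt f a b = CInt g a b.
Proof. apply (RInt_ext (V := C_R_CompleteNormedModule)). Qed.

Lemma is_CInt_components (f : R -> C) (a b : R) (l : C) :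
  is_CInt f a b l <->
  is_RInt (fun x => Re (f x)) a b (Re l) /\ is_RInt (fun x => Im (f x)) a b (Im l).
Proof.
  split.
  - intros int. split;
      [apply (is_RInt_fct_extend_fst (U := R_NormedModule) (V := R_NormedModule) f a b l int)
      |apply (is_RInt_fct_extend_snd (U := R_NormedModule) (V := R_NormedModule) f a b l int)].
  - destruct l as [u v]. intros [int_re int_im].
    apply (is_RInt_fct_extend_pair (U := R_NormedModule) (V := R_NormedModule)); auto.
Qed.

Lemma is_CInt_mult_l (c : C) (f : R -> C) (a b : R) (l : C) :
  is_CInt f a b l -> is_CInt (fun x => c * f x)%C a b (c * l)%C.
Proof.
  rewrite !is_CInt_components. intros [int_re int_im]. rewrite re_mult, im_mult. split.
  - apply (is_RInt_ext (fun x => minus (scal (Re c) (Re (f x))) (scal (Im c) (Im (f x))))).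
    { intros x _. rewrite re_mult. reflexivity. }
    apply (is_RInt_minus (V := R_NormedModule)); apply (is_RInt_scal (V := R_NormedModule)); auto.
  - apply (is_RInt_ext (fun x => plus (scal (Re c) (Im (f x))) (scal (Im c) (Re (f x))))).
    { intros x _. rewrite im_mult. reflexivity. }
    apply (is_RInt_plus (V := R_NormedModule)); apply (is_RInt_scal (V := R_NormedModule)); auto.
Qed.

Lemma CInt_mult_l (c : C) (f : R -> C) (a b : R) :
  ex_CInt f a b -> CInt (fun x => c * f x)%C a b = (c * CInt f a b)%C.
Proof. intros int. apply is_CInt_unique, is_CInt_mult_l, CInt_correct, int. Qed.

Lemma ex_CInt_mult_l (c : C) (f : R -> C) (a b : R) :
  ex_CInt f a b -> ex_CInt (fun x => c * f x)%C a b.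
Proof. intros [l int]. eexists. apply is_CInt_mult_l, int. Qed.

Lemma CInt_plus (f g : R -> C) (a b : R) : ex_CInt f a b -> ex_CInt g a b ->
  CInt (fun x => f x + g x)%C a b = (CInt f a b + CInt g a b)%C.
Proof. apply (RInt_plus (V := C_R_CompleteNormedModule)). Qed.

Lemma CInt_minus (f g : R -> C) (a b : R) : ex_CInt f a b -> ex_CInt g a b ->
  CInt (fun x => f x - g x)%C a b = (CInt f a b - CInt g a b)%C.
Proof. apply (RInt_minus (V := C_R_CompleteNormedModule)). Qed.

Lemma CInt_Chasles (f : R -> C) (a b c : R) : ex_CInt f a b -> ex_CInt f b c ->
  (CInt f a b + CInt f b c)%C = CInt f a c.
Proof. apply (RInt_Chasles (V := C_R_CompleteNormedModule)). Qed.

Lemma CInt_const (c : C) (a b : R) : CInt (fun _ => c) a b = (RtoC (b - a) * c)%C.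
Proof.
  unfold CInt. rewrite (RInt_const (V := C_R_CompleteNormedModule)). apply scal_R_Cmult.
Qed.

Lemma CInt_shift (f : R -> C) (h a b : R) : ex_CInt f (a + h) (b + h) ->
  CInt (fun x => f (x + h)) a b = CInt f (a + h) (b + h).
Proof.
  intros int.
  assert (affine := RInt_comp_lin (V := C_R_CompleteNormedModule) f 1 h a b).
  rewrite !Rmult_1_l in affine. unfold CInt. rewrite <- affine by auto.
  apply (CInt_ext (fun x => f (x + h))). intros x _. rewrite Rmult_1_l. symmetry.
  apply (scal_one (V := C_R_NormedModule)).
Qed.

Lemma Cmod_CInt_le (f : R -> C) (a b M : R) : a <= b -> ex_CInt f a b ->
  (forall x, a <= x <= b -> Cmod (f x) <= M) -> Cmod (CInt f a b) <= (b - a) * M.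
Proof.
  intros ab int bound. rewrite <- norm_C_R.
  apply (norm_RInt_le_const (V := C_R_NormedModule) f a b); auto.
  - intros x x_in. rewrite norm_C_R. auto.
  - apply CInt_correct, int.
Qed.

Lemma CInt_periodic (f : R -> C) (h : R) :
  (forall x, continuous f x) -> (forall x, f (x + 1) = f x) -> CInt f h (h + 1) = CInt f 0 1.
Proof.
  intros cont per. assert (int : forall a b, ex_CInt f a b) by (intros; apply ex_CInt_continuous; auto).
  assert (moved : CInt f 1 (1 + h) = CInt f 0 h).
  { rewrite (Rplus_comm 1 h). replace 1 with (0 + 1) at 1 by ring.
    rewrite <- CInt_shift by auto. apply CInt_ext. auto. }
  rewrite <- (CInt_Chasles f h 0), <- (CInt_Chasles f 0 1), (Rplus_comm h 1), moved by auto.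
  rewrite Cplus_comm, <- Cplus_assoc, CInt_Chasles by auto.
  unfold CInt at 2. rewrite (RInt_point (V := C_R_CompleteNormedModule)). apply Cplus_0_r.
Qed.

(** * The complex exponential *)

Lemma Cexp_plus (a b : C) : Cexp (a + b) = (Cexp a * Cexp b)%C.
Proof.
  destruct a as [a1 a2], b as [b1 b2]. unfold Cexp; simpl.
  rewrite exp_plus, cos_plus, sin_plus. apply injective_projections; simpl; ring.
Qed.

Lemma Cexp_0 : Cexp (RtoC 0) = RtoC 1.
Proof.
  unfold Cexp; simpl. rewrite exp_0, cos_0, sin_0. apply injective_projections; simpl; ring.
Qed.

Lemma Cmod_Cexp (z : C) : Cmod (Cexp z) = exp (Re z).
Proof.
  apply Rsqr_inj; [apply Cmod_ge_0|left; apply exp_pos|]. unfold Rsqr. rewrite Cmod_sqr. simpl.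
  assert (pythagoras := sin2_cos2 (Im z)). unfold Rsqr in pythagoras. nra.
Qed.

Lemma is_CInt_Cexp_segment (w : C) : is_CInt (fun x => w * Cexp (RtoC x * w))%C 0 1 (Cexp w - RtoC 1)%C.
Proof.
  destruct w as [a b]. apply is_CInt_components.
  set (re := fun x => exp (x * a) * cos (x * b)). set (im := fun x => exp (x * a) * sin (x * b)).
  replace (Re (Cexp (a, b) - RtoC 1)) with (minus (re 1) (re 0)).
  2: { unfold re, minus, plus, opp; simpl. rewrite !Rmult_1_l, !Rmult_0_l, exp_0, cos_0. ring. }
  replace (Im (Cexp (a, b) - RtoC 1)) with (minus (im 1) (im 0)).
  2: { unfold im, minus, plus, opp; simpl. rewrite !Rmult_1_l, !Rmult_0_l, exp_0, sin_0. ring. }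
  assert (coords : forall x, Re (RtoC x * (a, b)) = x * a /\ Im (RtoC x * (a, b)) = x * b)
    by (intros x; simpl; split; ring).
  split; apply (is_RInt_derive (V := R_CompleteNormedModule)); intros x _.
  - unfold re. auto_derive; auto. unfold Cexp. destruct (coords x) as [-> ->]. simpl. ring.
  - apply (continuous_ext (fun x => a * (exp (x * a) * cos (x * b)) - b * (exp (x * a) * sin (x * b)))).
    { intros y. unfold Cexp. destruct (coords y) as [-> ->]. reflexivity. }
    apply (ex_derive_continuous (V := R_NormedModule)). auto_derive. auto.
  - unfold im. auto_derive; auto. unfold Cexp. destruct (coords x) as [-> ->]. simpl. ring.
  - apply (continuous_ext (fun x => a * (exp (x * a) * sin (x * b)) + b * (exp (x * a) * cos (x * b)))).
    { intros y. unfold Cexp. destruct (coords y) as [-> ->]. reflexivity. }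
    apply (ex_derive_continuous (V := R_NormedModule)). auto_derive. auto.
Qed.

Lemma Cmod_Cexp_le (w : C) : Cmod (Cexp w) <= exp (Cmod w).
Proof. rewrite Cmod_Cexp. apply exp_le. eapply Rle_trans; [apply Rle_abs|apply re_le_Cmod]. Qed.

Lemma Cmod_segment_le (w : C) (x : R) : 0 <= x <= 1 -> Cmod (RtoC x * w) <= Cmod w.
Proof.
  intros x_in. rewrite Cmod_mult, Cmod_R, Rabs_pos_eq by lra. assert (nonneg := Cmod_ge_0 w). nra.
Qed.

Lemma Cmod_Cexp_minus_1_le (w : C) : Cmod (Cexp w - RtoC 1) <= Cmod w * exp (Cmod w).
Proof.
  rewrite <- (is_CInt_unique _ _ _ _ (is_CInt_Cexp_segment w)).
  replace (Cmod w * exp (Cmod w)) with ((1 - 0) * (Cmod w * exp (Cmod w))) by ring.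
  apply Cmod_CInt_le; [lra|eexists; apply is_CInt_Cexp_segment|]. intros x x_in.
  rewrite Cmod_mult. apply Rmult_le_compat_l; [apply Cmod_ge_0|].
  eapply Rle_trans; [apply Cmod_Cexp_le|]. apply exp_le, Cmod_segment_le, x_in.
Qed.

Lemma Cmod_Cexp_taylor_le (w : C) : Cmod (Cexp w - RtoC 1 - w) <= Cmod w * Cmod w * exp (Cmod w).
Proof.
  assert (remainder : is_CInt (fun x => w * Cexp (RtoC x * w) - w)%C 0 1 (Cexp w - RtoC 1 - w)%C).
  { apply (is_RInt_minus (V := C_R_NormedModule)); [apply is_CInt_Cexp_segment|].
    assert (const := is_RInt_const (V := C_R_NormedModule) 0 1 w).
    rewrite scal_R_Cmult, Rminus_0_r, Cmult_1_l in const. exact const. }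
  rewrite <- (is_CInt_unique _ _ _ _ remainder).
  replace (Cmod w * Cmod w * exp (Cmod w)) with ((1 - 0) * (Cmod w * Cmod w * exp (Cmod w))) by ring.
  apply Cmod_CInt_le; [lra|eexists; apply remainder|]. intros x x_in.
  replace (w * Cexp (RtoC x * w) - w)%C with (w * (Cexp (RtoC x * w) - RtoC 1))%C by ring.
  rewrite Cmod_mult, Rmult_assoc. apply Rmult_le_compat_l; [apply Cmod_ge_0|].
  eapply Rle_trans; [apply Cmod_Cexp_minus_1_le|]. assert (shorter := Cmod_segment_le w x x_in).
  apply Rmult_le_compat; [apply Cmod_ge_0|left; apply exp_pos|auto|apply exp_le, shorter].
Qed.

Lemma is_derive_Cexp (z : C) : is_derive Cexp z (Cexp z).
Proof.
  apply is_derive_Cmod. intros eps eps_pos.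
  set (K := Cmod (Cexp z) * exp 1). assert (e_pos := exp_pos 1).
  assert (K_pos : 0 < K) by (unfold K; rewrite Cmod_Cexp; apply Rmult_lt_0_compat; apply exp_pos).
  exists (Rmin 1 (eps / K)). split; [apply Rmin_pos; [lra|apply Rdiv_lt_0_compat; auto]|].
  intros w close. set (h := (w - z)%C) in *.
  assert (close_1 := Rmin_l 1 (eps / K)). assert (close_eps := Rmin_r 1 (eps / K)).
  replace (Cexp w - Cexp z - Cexp z * h)%C with (Cexp z * (Cexp h - RtoC 1 - h))%C
    by (replace w with (z + h)%C by (unfold h; ring); rewrite Cexp_plus; ring).
  assert (h_nonneg := Cmod_ge_0 h). assert (z_nonneg := Cmod_ge_0 (Cexp z)). rewrite Cmod_mult.
  assert (exp_h : exp (Cmod h) <= exp 1) by (apply exp_le; lra).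
  apply Rle_trans with (Cmod (Cexp z) * (Cmod h * Cmod h * exp 1)).
  - apply Rmult_le_compat_l; [auto|]. eapply Rle_trans; [apply Cmod_Cexp_taylor_le|].
    apply Rmult_le_compat_l; nra.
  - replace (Cmod (Cexp z) * (Cmod h * Cmod h * exp 1)) with (K * Cmod h * Cmod h) by (unfold K; ring).
    apply Rmult_le_compat_r; auto.
    apply Rle_trans with (K * (eps / K)); [apply Rmult_le_compat_l; lra|right; field; lra].
Qed.

Definition Ce (w : C) : C := Cexp (RtoC (2 * PI) * Ci * w)%C.

Lemma Ce_plus (a b : C) : Ce (a + b) = (Ce a * Ce b)%C.
Proof. unfold Ce. rewrite <- Cexp_plus. f_equal. ring. Qed.

Lemma Ce_0 : Ce (RtoC 0) = RtoC 1.
Proof. unfold Ce. rewrite Cmult_0_r. apply Cexp_0. Qed.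

Lemma Cmod_Ce (w : C) : Cmod (Ce w) = exp (- (2 * PI * Im w)).
Proof. unfold Ce. rewrite Cmod_Cexp. f_equal. destruct w. simpl. ring. Qed.

Lemma Cmod_Ce_R (r : R) : Cmod (Ce (RtoC r)) = 1.
Proof. rewrite Cmod_Ce. simpl. rewrite Rmult_0_r, Ropp_0. apply exp_0. Qed.

Lemma Ce_neq_0 (w : C) : Ce w <> RtoC 0.
Proof. apply Cmod_gt_0. rewrite Cmod_Ce. apply exp_pos. Qed.

Lemma Ce_opp_r (w : C) : (Ce w * Ce (- w))%C = RtoC 1.
Proof. rewrite <- Ce_plus, Cplus_opp_r. apply Ce_0. Qed.

Lemma Ce_R (r : R) : Ce (RtoC r) = (cos (2 * PI * r), sin (2 * PI * r)).
Proof.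
  unfold Ce, Cexp. simpl.
  replace ((2 * PI * 0 - 0 * 1) * r - (2 * PI * 1 + 0 * 0) * 0) with 0 by ring.
  replace ((2 * PI * 0 - 0 * 1) * 0 + (2 * PI * 1 + 0 * 0) * r) with (2 * PI * r) by ring.
  rewrite exp_0, !Rmult_1_l. reflexivity.
Qed.

Lemma Ce_half : Ce (RtoC (/ 2)) = RtoC (-1).
Proof.
  rewrite Ce_R. replace (2 * PI * / 2) with PI by field. rewrite cos_PI, sin_PI. reflexivity.
Qed.

Lemma Ce_quarter : Ce (RtoC (/ 4)) = Ci.
Proof.
  rewrite Ce_R. replace (2 * PI * / 4) with (PI / 2) by field. rewrite cos_PI2, sin_PI2. reflexivity.
Qed.

Lemma Ce_1 : Ce (RtoC 1) = RtoC 1.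
Proof.
  replace 1 with (/ 2 + / 2) at 1 by lra. rewrite RtoC_plus, Ce_plus, Ce_half.
  apply injective_projections; simpl; ring.
Qed.

Lemma Ce_Z (n : Z) : Ce (RtoC (IZR n)) = RtoC 1.
Proof.
  revert n. apply Z.bi_induction; [intros n n' ->; reflexivity|apply Ce_0|]. intros n.
  unfold Z.succ. rewrite plus_IZR, RtoC_plus, Ce_plus, Ce_1, Cmult_1_r. reflexivity.
Qed.

Lemma Ce_R_eq_1 (r : R) : Ce (RtoC r) = RtoC 1 -> exists k : Z, r = IZR k.
Proof.
  intros trivial. assert (pi_pos := PI_RGT_0).
  assert (sin_0 := f_equal snd trivial). rewrite Ce_R in sin_0. simpl in sin_0.
  destruct (sin_eq_0_0 _ sin_0) as [k half_turns].
  assert (r_half : r = IZR k / 2).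
  { apply Rmult_eq_reg_l with (2 * PI); [|lra]. rewrite half_turns. field. }
  destruct (Z.Even_or_Odd k) as [[j ->]|[j ->]].
  - exists j. rewrite r_half, mult_IZR. field.
  - exfalso. revert trivial. rewrite r_half, plus_IZR, mult_IZR.
    replace ((2 * IZR j + 1) / 2) with (IZR j + / 2) by field.
    rewrite RtoC_plus, Ce_plus, Ce_Z, Ce_half, Cmult_1_l. intros absurd. apply RtoC_inj in absurd. lra.
Qed.

Lemma is_derive_Ce (z : C) : is_derive Ce z (RtoC (2 * PI) * Ci * Ce z)%C.
Proof.
  apply (is_derive_C_comp Cexp (fun w => RtoC (2 * PI) * Ci * w)%C); [apply is_derive_Cexp|].
  apply is_derive_C_val with (RtoC (2 * PI) * Ci * RtoC 1)%C; [|ring].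
  apply is_derive_C_scal, is_derive_C_id.
Qed.

Lemma is_derive_Ce_scal (c z : C) : is_derive (fun w => Ce (c * w)) z (RtoC (2 * PI) * Ci * c * Ce (c * z))%C.
Proof.
  apply is_derive_C_val with (c * RtoC 1 * (RtoC (2 * PI) * Ci * Ce (c * z)))%C; [|ring].
  apply (is_derive_C_comp Ce); [apply is_derive_Ce|]. apply is_derive_C_scal, is_derive_C_id.
Qed.

Lemma qpow_Ce (tau : C) (n : Z) : qpow tau n = Ce (RtoC (IZR n) * tau).
Proof. unfold qpow, Ce. f_equal. rewrite RtoC_mult. ring. Qed.

(** * Goursat's theorem on rectangles *)

Lemma continuous_horizontal (f : C -> C) (x y : R) : continuous f (x, y) -> continuous (fun u => f (u, y)) x.
Proof.
  intros cont. apply (continuous_comp (fun u => (u, y) : C) f); [|exact cont].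
  apply (continuous_pair (fun u => u)); [apply continuous_id|apply continuous_const].
Qed.

Lemma continuous_vertical (f : C -> C) (x y : R) : continuous f (x, y) -> continuous (fun v => f (x, v)) y.
Proof.
  intros cont. apply (continuous_comp (fun v => (x, v) : C) f); [|exact cont].
  apply (continuous_pair _ (fun v => v)); [apply continuous_const|apply continuous_id].
Qed.

Definition in_rect (x y w h : R) (z : C) : Prop := x <= Re z <= x + w /\ y <= Im z <= y + h.

Definition rect_int (f : C -> C) (x y w h : R) : C :=
  (CInt (fun u => f (u, y)) x (x + w) + Ci * CInt (fun v => f (x + w, v)%R) y (y + h)
   - CInt (fun u => f (u, y + h)%R) x (x + w) - Ci * CInt (fun v => f (x, v)) y (y + h))%C.

Section ContinuousOnRectangle.

Variables (f : C -> C) (X Y W H : R).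
Hypothesis f_cont : forall z, in_rect X Y W H z -> continuous f z.

Lemma ex_CInt_horizontal (y a b : R) :
  X <= a <= X + W -> X <= b <= X + W -> Y <= y <= Y + H -> ex_CInt (fun u => f (u, y)) a b.
Proof.
  intros a_in b_in y_in. apply ex_RInt_continuous. intros x x_in.
  apply continuous_horizontal, f_cont. split; simpl; [|lra].
  revert x_in. unfold Rmin, Rmax. destruct (Rle_dec a b); lra.
Qed.

Lemma ex_CInt_vertical (x a b : R) :
  Y <= a <= Y + H -> Y <= b <= Y + H -> X <= x <= X + W -> ex_CInt (fun v => f (x, v)) a b.
Proof.
  intros a_in b_in x_in. apply ex_RInt_continuous. intros y y_in.
  apply continuous_vertical, f_cont. split; simpl; [lra|].
  revert y_in. unfold Rmin, Rmax. destruct (Rle_dec a b); lra.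
Qed.

Lemma rect_int_split (x y w h : R) : 0 <= w -> 0 <= h ->
  X <= x -> x + w <= X + W -> Y <= y -> y + h <= Y + H ->
  rect_int f x y w h =
  (rect_int f x y (w / 2) (h / 2) + rect_int f (x + w / 2) y (w / 2) (h / 2)
   + rect_int f x (y + h / 2) (w / 2) (h / 2) + rect_int f (x + w / 2) (y + h / 2) (w / 2) (h / 2))%C.
Proof.
  intros w_nonneg h_nonneg left right bottom top. unfold rect_int.
  replace (x + w / 2 + w / 2) with (x + w) by lra. replace (y + h / 2 + h / 2) with (y + h) by lra.
  rewrite <- (CInt_Chasles (fun u => f (u, y)) x (x + w / 2) (x + w)) by (apply ex_CInt_horizontal; lra).
  rewrite <- (CInt_Chasles (fun u => f (u, y + h)) x (x + w / 2) (x + w)) by (apply ex_CInt_horizontal; lra).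
  rewrite <- (CInt_Chasles (fun v => f (x, v)) y (y + h / 2) (y + h)) by (apply ex_CInt_vertical; lra).
  rewrite <- (CInt_Chasles (fun v => f (x + w, v)) y (y + h / 2) (y + h)) by (apply ex_CInt_vertical; lra).
  ring.
Qed.

Lemma rect_int_quarter (x y w h e : R) : 0 <= w -> 0 <= h ->
  X <= x -> x + w <= X + W -> Y <= y -> y + h <= Y + H -> 4 * e <= Cmod (rect_int f x y w h) ->
  exists x' y', (x' = x \/ x' = x + w / 2) /\ (y' = y \/ y' = y + h / 2) /\
    e <= Cmod (rect_int f x' y' (w / 2) (h / 2)).
Proof.
  intros w_nonneg h_nonneg left right bottom top large. rewrite rect_int_split in large by auto.
  set (sw := rect_int f x y (w / 2) (h / 2)) in *.
  set (se := rect_int f (x + w / 2) y (w / 2) (h / 2)) in *.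
  set (nw := rect_int f x (y + h / 2) (w / 2) (h / 2)) in *.
  set (ne := rect_int f (x + w / 2) (y + h / 2) (w / 2) (h / 2)) in *.
  assert (triangle4 := Cmod_triangle (sw + se + nw) ne). assert (triangle3 := Cmod_triangle (sw + se) nw).
  assert (triangle2 := Cmod_triangle sw se).
  destruct (Rle_lt_dec e (Cmod sw)); [exists x, y; auto|].
  destruct (Rle_lt_dec e (Cmod se)); [exists (x + w / 2), y; auto|].
  destruct (Rle_lt_dec e (Cmod nw)); [exists x, (y + h / 2); auto|].
  exists (x + w / 2), (y + h / 2). repeat split; auto. fold ne. lra.
Qed.

End ContinuousOnRectangle.

Lemma rect_int_minus (f g : C -> C) (x y w h : R) : 0 <= w -> 0 <= h ->
  (forall z, in_rect x y w h z -> continuous f z) -> (forall z, in_rect x y w h z -> continuous g z) ->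
  rect_int (fun z => f z - g z)%C x y w h = (rect_int f x y w h - rect_int g x y w h)%C.
Proof.
  intros w_nonneg h_nonneg f_cont g_cont.
  assert (horizontal : forall v, y <= v <= y + h ->
    CInt (fun u => f (u, v) - g (u, v))%C x (x + w) =
    (CInt (fun u => f (u, v)) x (x + w) - CInt (fun u => g (u, v)) x (x + w))%C).
  { intros v v_in. apply CInt_minus; apply (ex_CInt_horizontal _ x y w h); auto; lra. }
  assert (vertical : forall u, x <= u <= x + w ->
    CInt (fun v => f (u, v) - g (u, v))%C y (y + h) =
    (CInt (fun v => f (u, v)) y (y + h) - CInt (fun v => g (u, v)) y (y + h))%C).
  { intros u u_in. apply CInt_minus; apply (ex_CInt_vertical _ x y w h); auto; lra. }
  unfold rect_int. rewrite !horizontal, !vertical by lra. ring.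
Qed.

Lemma Cmod_rect_int_le (f : C -> C) (x y w h M : R) : 0 <= w -> 0 <= h ->
  (forall z, in_rect x y w h z -> continuous f z) -> (forall z, in_rect x y w h z -> Cmod (f z) <= M) ->
  Cmod (rect_int f x y w h) <= 2 * (w + h) * M.
Proof.
  intros w_nonneg h_nonneg cont bound.
  assert (horizontal : forall v, y <= v <= y + h -> Cmod (CInt (fun u => f (u, v)) x (x + w)) <= w * M).
  { intros v v_in. replace w with (x + w - x) at 2 by ring. apply Cmod_CInt_le; [lra| |].
    - apply (ex_CInt_horizontal f x y w h); auto; lra.
    - intros u u_in. apply bound. split; simpl; lra. }
  assert (vertical : forall u, x <= u <= x + w -> Cmod (CInt (fun v => f (u, v)) y (y + h)) <= h * M).
  { intros u u_in. replace h with (y + h - y) at 2 by ring. apply Cmod_CInt_le; [lra| |].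
    - apply (ex_CInt_vertical f x y w h); auto; lra.
    - intros v v_in. apply bound. split; simpl; lra. }
  assert (bottom := horizontal y ltac:(lra)). assert (top := horizontal (y + h) ltac:(lra)).
  assert (left := vertical x ltac:(lra)). assert (right := vertical (x + w) ltac:(lra)).
  unfold rect_int.
  eapply Rle_trans; [apply Cmod_triangle_minus|]. rewrite Cmod_mult, Cmod_Ci.
  eapply Rle_trans; [apply Rplus_le_compat_r, Cmod_triangle_minus|].
  eapply Rle_trans; [apply Rplus_le_compat_r, Rplus_le_compat_r, Cmod_triangle|].
  rewrite Cmod_mult, Cmod_Ci. lra.
Qed.

Lemma CInt_affine (p q : C) (a b : R) :
  CInt (fun u => p + q * RtoC u)%C a b = (p * RtoC (b - a) + q * RtoC ((b * b - a * a) / 2))%C.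
Proof.
  assert (primitive : is_RInt (fun x => x) a b ((b * b - a * a) / 2)).
  { replace ((b * b - a * a) / 2) with (minus (b * b / 2) (a * a / 2))
      by (unfold minus, plus, opp; simpl; lra).
    apply (is_RInt_derive (V := R_CompleteNormedModule) (fun x => x * x / 2)); intros x _.
    - auto_derive; auto. lra.
    - apply continuous_id. }
  assert (identity : is_CInt RtoC a b (RtoC ((b * b - a * a) / 2))).
  { apply is_CInt_components. split; [exact primitive|].
    assert (zero := is_RInt_const (V := R_NormedModule) a b 0).
    unfold scal in zero; simpl in zero. unfold mult in zero; simpl in zero.
    rewrite Rmult_0_r in zero. exact zero. }
  assert (int : ex_CInt RtoC a b) by (eexists; apply identity).
  rewrite CInt_plus, CInt_const, CInt_mult_l, (is_CInt_unique _ _ _ _ identity); auto.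
  - ring.
  - apply ex_RInt_const.
  - apply ex_CInt_mult_l, int.
Qed.

Lemma rect_int_affine (p q : C) (x y w h : R) : rect_int (fun z => q * z + p)%C x y w h = RtoC 0.
Proof.
  assert (pair : forall a b : R, ((a, b) : C) = (RtoC a + RtoC b * Ci)%C)
    by (intros; apply injective_projections; simpl; ring).
  assert (horizontal : forall v a b, CInt (fun u => q * (u, v) + p)%C a b =
     ((p + q * (RtoC v * Ci)) * RtoC (b - a) + q * RtoC ((b * b - a * a) / 2))%C).
  { intros. rewrite <- CInt_affine. apply CInt_ext. intros u _. rewrite pair. ring. }
  assert (vertical : forall u a b, CInt (fun v => q * (u, v) + p)%C a b =
     ((p + q * RtoC u) * RtoC (b - a) + (q * Ci) * RtoC ((b * b - a * a) / 2))%C).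
  { intros. rewrite <- CInt_affine. apply CInt_ext. intros v _. rewrite pair. ring. }
  unfold rect_int. rewrite !horizontal, !vertical.
  destruct p as [p1 p2], q as [q1 q2]. apply injective_projections; simpl; field.
Qed.

Lemma halving_intervals_meet (x : nat -> R) (w : R) : 0 <= w ->
  (forall n, x (S n) = x n \/ x (S n) = x n + w / 2 ^ n / 2) ->
  exists u, forall n, x n <= u <= x n + w / 2 ^ n.
Proof.
  intros w_nonneg halves.
  assert (width_nonneg : forall n, 0 <= w / 2 ^ n)
    by (intros n; apply Rdiv_le_0_compat; [auto|apply pow_lt; lra]).
  assert (width_S : forall n, w / 2 ^ (S n) = w / 2 ^ n / 2)
    by (intros n; simpl; field; apply pow_nonzero; lra).
  assert (nested : forall n k, x n <= x (n + k)%nat /\ x (n + k)%nat + w / 2 ^ (n + k) <= x n + w / 2 ^ n).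
  { intros n. induction k as [|k IH]; [rewrite Nat.add_0_r; lra|].
    rewrite Nat.add_succ_r, width_S. specialize (width_nonneg (n + k)%nat).
    destruct (halves (n + k)%nat) as [-> | ->]; lra. }
  destruct (completeness (fun r => exists n, r = x n)) as [u [upper least]].
  - exists (x O + w / 2 ^ 0). intros r [n ->]. destruct (nested O n) as [_ le]. simpl in *.
    specialize (width_nonneg n). lra.
  - exists (x O), O. auto.
  - exists u. intros n. split; [apply upper; eauto|].
    apply least. intros r [k ->]. destruct (Nat.le_gt_cases n k) as [le|gt].
    + replace k with (n + (k - n))%nat by lia. destruct (nested n (k - n)%nat) as [_ le'].
      specialize (width_nonneg (n + (k - n))%nat). lra.
    + replace n with (k + (n - k))%nat by lia. destruct (nested k (n - k)%nat) as [le' _].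
      specialize (width_nonneg (k + (n - k))%nat). lra.
Qed.

Lemma bisection_principle (P : R -> R -> R -> R -> Prop) (x y w h : R) : 0 <= w -> 0 <= h ->
  (forall x y w h, P x y w h -> exists x' y',
     (x' = x \/ x' = x + w / 2) /\ (y' = y \/ y' = y + h / 2) /\ P x' y' (w / 2) (h / 2)) ->
  P x y w h ->
  exists z, forall n, exists x' y', in_rect x' y' (w / 2 ^ n) (h / 2 ^ n) z /\ P x' y' (w / 2 ^ n) (h / 2 ^ n).
Proof.
  intros w_nonneg h_nonneg quarter start.
  set (Pn := fun n (p : R * R) => P (fst p) (snd p) (w / 2 ^ n) (h / 2 ^ n)).
  assert (half_S : forall r n, r / 2 ^ (S n) = r / 2 ^ n / 2)
    by (intros r n; simpl; field; apply pow_nonzero; lra).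
  assert (choice : forall n p, {p' | Pn n p -> Pn (S n) p' /\
     (fst p' = fst p \/ fst p' = fst p + w / 2 ^ n / 2) /\ (snd p' = snd p \/ snd p' = snd p + h / 2 ^ n / 2)}).
  { intros n p. apply constructive_indefinite_description.
    destruct (classic (Pn n p)) as [good|bad]; [|exists p; intros; contradiction].
    destruct (quarter _ _ _ _ good) as [x' [y' [x'_in [y'_in good']]]].
    exists (x', y'). intros _. unfold Pn. rewrite !half_S. auto. }
  set (corner := fix corner n :=
    match n with O => (x, y) | S n => proj1_sig (choice n (corner n)) end).
  assert (corner_good : forall n, Pn n (corner n)).
  { induction n as [|n IH]; [unfold Pn; simpl; rewrite !Rdiv_1_r; exact start|].
    exact (proj1 (proj2_sig (choice n (corner n)) IH)). }
  assert (corner_S := fun n => proj2 (proj2_sig (choice n (corner n)) (corner_good n))).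
  destruct (halving_intervals_meet (fun n => fst (corner n)) w w_nonneg (fun n => proj1 (corner_S n)))
    as [u u_in].
  destruct (halving_intervals_meet (fun n => snd (corner n)) h h_nonneg (fun n => proj2 (corner_S n)))
    as [v v_in].
  exists (u, v). intros n. exists (fst (corner n)), (snd (corner n)).
  split; [split; [apply u_in|apply v_in]|apply corner_good].
Qed.

(* Near a point of differentiability [f] differs from an affine function, whose integral vanishes,
   by at most [eps] times the distance. *)
Lemma Cmod_rect_int_le_of_derive (f : C -> C) (z l : C) (eps d x y w h : R) :
  0 <= w -> 0 <= h -> 0 <= eps -> w + h < d ->
  (forall u, Cmod (u - z) < d -> Cmod (f u - f z - l * (u - z)) <= eps * Cmod (u - z)) ->
  (forall u, in_rect x y w h u -> continuous f u) -> in_rect x y w h z ->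
  Cmod (rect_int f x y w h) <= 2 * eps * ((w + h) * (w + h)).
Proof.
  intros w_nonneg h_nonneg eps_nonneg small near cont z_in.
  set (affine := fun u : C => (l * u + (f z - l * z))%C).
  assert (affine_cont : forall u, continuous affine u).
  { intros u. apply ex_derive_C_continuous, ex_derive_C_affine. }
  assert (same : rect_int f x y w h = rect_int (fun u => f u - affine u)%C x y w h).
  { rewrite rect_int_minus by auto. unfold affine. rewrite rect_int_affine. ring. }
  rewrite same. replace (2 * eps * ((w + h) * (w + h))) with (2 * (w + h) * (eps * (w + h))) by ring.
  apply Cmod_rect_int_le; auto.
  - intros u u_in. apply continuous_C_minus; auto.
  - intros u u_in.
    assert (dist : Cmod (u - z) <= w + h).
    { eapply Rle_trans; [apply Cmod_le_Re_Im|]. destruct u_in as [re_u im_u], z_in as [re_z im_z].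
      destruct u as [a b], z as [a' b']. simpl in *. apply Rplus_le_compat; apply Rabs_le; lra. }
    replace (f u - affine u)%C with (f u - f z - l * (u - z))%C by (unfold affine; ring).
    eapply Rle_trans; [apply near; lra|]. apply Rmult_le_compat_l; lra.
Qed.

Theorem Goursat (f : C -> C) (X Y W H : R) : 0 <= W -> 0 <= H ->
  (forall z, in_rect X Y W H z -> ex_derive f z) -> rect_int f X Y W H = RtoC 0.
Proof.
  intros W_nonneg H_nonneg diff. set (I := Cmod (rect_int f X Y W H)). set (T := W + H).
  assert (cont : forall z, in_rect X Y W H z -> continuous f z)
    by (intros; apply ex_derive_C_continuous; auto).
  apply NNPP. intros nz. apply Cmod_gt_0 in nz. fold I in nz.
  assert (T_pos : 0 < T).
  { apply Rnot_le_lt. intros T_le. unfold T in T_le.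
    assert (bound := Cmod_rect_int_le f X Y W H (Cmod (f (X, Y))) W_nonneg H_nonneg cont). fold I in bound.
    replace (W + H) with 0 in bound by lra. rewrite Rmult_0_r, Rmult_0_l in bound.
    apply (Rlt_irrefl 0), (Rlt_le_trans _ _ _ nz), bound. intros [a b] [a_in b_in]. simpl in *.
    replace a with X by lra. replace b with Y by lra. apply Rle_refl. }
  set (c := I / (T * T)). assert (c_pos : 0 < c) by (apply Rdiv_lt_0_compat; nra).
  destruct (bisection_principle (fun x y w h =>
      (0 <= w /\ 0 <= h /\ X <= x /\ x + w <= X + W /\ Y <= y /\ y + h <= Y + H) /\
      c * ((w + h) * (w + h)) <= Cmod (rect_int f x y w h)) X Y W H) as [z point]; auto.
  - intros x y w h [inside large].
    destruct (rect_int_quarter f X Y W H cont x y w h (c * ((w / 2 + h / 2) * (w / 2 + h / 2))))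
      as [x' [y' [x'_in [y'_in large']]]]; try tauto.
    { eapply Rle_trans; [right|apply large]. field. }
    exists x', y'. repeat split; auto; try (destruct x'_in, y'_in; subst; lra).
  - fold I T. repeat split; try lra. right. unfold c. field. lra.
  - assert (z_in : in_rect X Y W H z).
    { destruct (point O) as [x [y [z_in [inside _]]]]. unfold in_rect in *. lra. }
    destruct (diff z z_in) as [l derivative]. rewrite is_derive_Cmod in derivative.
    destruct (derivative (c / 4) ltac:(lra)) as [d [d_pos near]].
    destruct (pow_half_lt T d d_pos) as [n small].
    destruct (point n) as [x [y [z_n [[w_n [h_n [left [right [bottom top]]]]] large]]]].
    assert (size : W / 2 ^ n + H / 2 ^ n = T / 2 ^ n) by (unfold T; field; apply pow_nonzero; lra).
    assert (size_pos : 0 < T / 2 ^ n) by (apply Rdiv_lt_0_compat; [auto|apply pow_lt; lra]).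
    assert (upper : Cmod (rect_int f x y (W / 2 ^ n) (H / 2 ^ n)) <= 2 * (c / 4) * ((T / 2 ^ n) * (T / 2 ^ n))).
    { rewrite <- size. apply (Cmod_rect_int_le_of_derive f z l (c / 4) d); auto; try lra.
      intros u [u_x u_y]. apply cont. split; lra. }
    rewrite size in large. assert (c_size_pos := Rmult_lt_0_compat _ _ c_pos (Rmult_lt_0_compat _ _ size_pos size_pos)).
    lra.
Qed.

(** * Pointwise Fourier inversion *)

Lemma continuous_Ce {T : UniformSpace} (f : T -> C) (x : T) :
  continuous f x -> continuous (fun y => Ce (f y)) x.
Proof.
  intros cont. apply (continuous_comp f Ce); [exact cont|].
  apply ex_derive_C_continuous. eexists. apply is_derive_Ce.
Qed.

Lemma continuous_Ce_linear (a x : R) : continuous (fun y => Ce (RtoC (a * y))) x.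
Proof.
  apply continuous_Ce. apply (continuous_pair (fun y => a * y) (fun _ => 0)); [|apply continuous_const].
  apply (continuous_scal_r (V := R_NormedModule)), continuous_id.
Qed.

Lemma continuous_translate (f : R -> C) (h x : R) : continuous f (x + h) -> continuous (fun y => f (y + h)) x.
Proof.
  intros cont. apply (continuous_comp (fun y => y + h) f); [|exact cont].
  apply (continuous_plus (V := R_NormedModule)); [apply continuous_id|apply continuous_const].
Qed.

Definition fourier (u : R -> C) (n : Z) : C := CInt (fun x => u x * Ce (RtoC (- IZR n * x)))%C 0 1.

Section FourierCoefficients.

Variable u : R -> C.
Hypothesis u_cont : forall x, continuous u x.

Lemma continuous_fourier_integrand (n : Z) (x : R) : continuous (fun x => u x * Ce (RtoC (- IZR n * x)))%C x.
Proof. apply continuous_C_mult; [auto|apply continuous_Ce_linear]. Qed.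

Lemma ex_CInt_fourier (n : Z) (a b : R) : ex_CInt (fun x => u x * Ce (RtoC (- IZR n * x)))%C a b.
Proof. apply ex_CInt_continuous, continuous_fourier_integrand. Qed.

Lemma Cmod_fourier_le (n : Z) (M : R) : (forall x, 0 <= x <= 1 -> Cmod (u x) <= M) -> Cmod (fourier u n) <= M.
Proof.
  intros bound. unfold fourier. replace M with ((1 - 0) * M) by ring. apply Cmod_CInt_le; [lra|apply ex_CInt_fourier|].
  intros x x_in. rewrite Cmod_mult, Cmod_Ce_R, Rmult_1_r. auto.
Qed.

Lemma fourier_mult_l (c : C) (n : Z) : fourier (fun x => c * u x)%C n = (c * fourier u n)%C.
Proof.
  unfold fourier. rewrite <- CInt_mult_l by apply ex_CInt_fourier. apply CInt_ext. intros x _. ring.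
Qed.

Lemma fourier_mult_Ce (n : Z) : fourier (fun x => Ce (RtoC x) * u x)%C n = fourier u (n - 1).
Proof.
  unfold fourier. apply CInt_ext. intros x _.
  replace (- IZR (n - 1) * x) with (x + - IZR n * x) by (rewrite minus_IZR; ring).
  rewrite RtoC_plus, Ce_plus. ring.
Qed.

Lemma fourier_translate (h : R) (n : Z) : (forall x, u (x + 1) = u x) ->
  fourier (fun x => u (x + h)) n = (Ce (RtoC (IZR n * h)) * fourier u n)%C.
Proof.
  intros per. set (g := fun x => (u x * Ce (RtoC (- IZR n * x)))%C).
  assert (g_cont : forall x, continuous g x) by apply continuous_fourier_integrand.
  assert (g_per : forall x, g (x + 1) = g x).
  { intros x. unfold g. rewrite per. f_equal.
    replace (- IZR n * (x + 1)) with (- IZR n * x + IZR (- n)) by (rewrite opp_IZR; ring).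
    rewrite RtoC_plus, Ce_plus, Ce_Z. ring. }
  assert (moved : CInt (fun x => g (x + h)) 0 1 = fourier u n).
  { unfold fourier. fold g. rewrite <- (CInt_periodic g h), CInt_shift by (auto; apply ex_CInt_fourier).
    f_equal; ring. }
  rewrite <- moved, <- CInt_mult_l.
  - unfold fourier. apply CInt_ext. intros x _. unfold g.
    replace (- IZR n * (x + h)) with (- IZR n * x + - (IZR n * h)) by ring.
    rewrite RtoC_plus, Ce_plus, RtoC_opp.
    transitivity (u (x + h)%R * Ce (RtoC (- IZR n * x)) * (Ce (RtoC (IZR n * h)) * Ce (- RtoC (IZR n * h))))%C;
      [rewrite Ce_opp_r|]; ring.
  - apply ex_CInt_continuous. intros x. apply continuous_translate, g_cont.
Qed.

End FourierCoefficients.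

Lemma fourier_plus (u v : R -> C) (n : Z) : (forall x, continuous u x) -> (forall x, continuous v x) ->
  fourier (fun x => u x + v x)%C n = (fourier u n + fourier v n)%C.
Proof.
  intros u_cont v_cont. unfold fourier. rewrite <- CInt_plus by (apply ex_CInt_fourier; auto).
  apply CInt_ext. intros x _. ring.
Qed.

Lemma fourier_half_wave (u : R -> C) (n : Z) : n <> 0%Z ->
  (forall x, continuous u x) -> (forall x, u (x + 1) = u x) ->
  fourier (fun x => u (x + / 2 * / IZR n)) n = (RtoC (-1) * fourier u n)%C.
Proof.
  intros nz cont per. rewrite fourier_translate by auto.
  replace (IZR n * (/ 2 * / IZR n)) with (/ 2) by (field; apply not_0_IZR; auto).
  rewrite Ce_half. reflexivity.
Qed.

Lemma fourier_one (n : Z) : fourier (fun _ => RtoC 1) n = if Z.eq_dec n 0 then RtoC 1 else RtoC 0.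
Proof.
  destruct (Z.eq_dec n 0) as [->|nz].
  - unfold fourier. rewrite (CInt_ext _ (fun _ => RtoC 1)).
    + rewrite CInt_const. apply injective_projections; simpl; ring.
    + intros x _. rewrite Ropp_0, Rmult_0_l, Ce_0. ring.
  - assert (opposite := fourier_half_wave (fun _ => RtoC 1) n nz (fun x => continuous_const _ x) (fun _ => eq_refl)).
    cbv beta in opposite. apply (Cmult_reg_l (RtoC 2)); [intros absurd; apply RtoC_inj in absurd; lra|].
    transitivity (fourier (fun _ => RtoC 1) n - RtoC (-1) * fourier (fun _ => RtoC 1) n)%C; [ring|].
    rewrite <- opposite. ring.
Qed.

Lemma uniformly_continuous_segment (v : R -> C) (a b eps : R) : (forall x, continuous v x) -> 0 < eps ->
  exists d, 0 < d /\ forall x y, a <= x <= b -> a <= y <= b -> Rabs (y - x) < d -> Cmod (v y - v x) < eps.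
Proof.
  intros cont eps_pos.
  destruct (unifcont_normed_1d (V := C_R_NormedModule) v a b (fun x _ => cont x) (mkposreal eps eps_pos))
    as [d unif].
  exists d. split; [apply cond_pos|]. intros x y x_in y_in close.
  rewrite <- norm_C_R. apply (unif x y x_in y_in close).
Qed.

Lemma riemann_lebesgue (v : R -> C) (eps : R) :
  (forall x, continuous v x) -> (forall x, v (x + 1) = v x) -> 0 < eps ->
  exists N, (0 < N)%Z /\ forall n, (N <= Z.abs n)%Z -> Cmod (fourier v n) < eps.
Proof.
  intros cont per eps_pos.
  destruct (uniformly_continuous_segment v (-1) 2 eps cont eps_pos) as [d [d_pos unif]].
  assert (d_inv_pos := Rinv_0_lt_compat d d_pos). destruct (archimed (/ d)) as [up_gt _].
  exists (up (/ d)). assert (up_pos : (0 < up (/ d))%Z) by (apply lt_IZR; lra). split; [auto|].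
  intros n large. set (h := / 2 * / IZR n).
  assert (n_ge : / d < Rabs (IZR n)) by (rewrite <- abs_IZR; apply IZR_le in large; lra).
  assert (n_ge_1 : 1 <= Rabs (IZR n)) by (rewrite <- abs_IZR; apply IZR_le; lia).
  assert (h_abs : Rabs h = / 2 * / Rabs (IZR n))
    by (unfold h; rewrite Rabs_mult, (Rabs_pos_eq (/ 2)), Rabs_inv by lra; auto).
  assert (inv_lt_d : / Rabs (IZR n) < d).
  { rewrite <- (Rinv_inv d). apply Rinv_lt_contravar; auto. apply Rmult_lt_0_compat; lra. }
  assert (inv_le_1 : / Rabs (IZR n) <= 1) by (rewrite <- Rinv_1; apply Rinv_le_contravar; lra).
  assert (inv_pos : 0 < / Rabs (IZR n)) by (apply Rinv_0_lt_compat; lra).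
  assert (h_small : Rabs h <= / 2) by lra. apply Rabs_le_between in h_small.
  assert (opposite := fourier_half_wave v n ltac:(lia) cont per). fold h in opposite.
  assert (double : fourier (fun x => v x + RtoC (-1) * v (x + h)%R)%C n = (RtoC 2 * fourier v n)%C).
  { rewrite fourier_plus, fourier_mult_l, opposite; auto; [ring| |];
      intros x; [|apply continuous_C_mult; [apply continuous_const|]]; apply continuous_translate; auto. }
  assert (bound : Cmod (RtoC 2 * fourier v n) <= eps).
  { rewrite <- double. apply Cmod_fourier_le.
    - intros x. apply continuous_C_plus; [auto|]. apply continuous_C_mult; [apply continuous_const|].
      apply continuous_translate. auto.
    - intros x x_in. replace (v x + RtoC (-1) * v (x + h)%R)%C with (v x - v (x + h)%R)%C by ring.
      left. apply unif; try lra. replace (x - (x + h)) with (- h) by ring. rewrite Rabs_Ropp. lra. }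
  rewrite Cmod_mult, Cmod_R, Rabs_pos_eq in bound by lra. lra.
Qed.

Fixpoint sym_sum (a : Z -> C) (N : nat) : C :=
  match N with
  | O => a 0%Z
  | S N' => (sym_sum a N' + (a (Z.of_nat N) + a (- Z.of_nat N)%Z))%C
  end.

Lemma sym_sum_S (a : Z -> C) (N : nat) :
  sym_sum a (S N) = (sym_sum a N + (a (Z.of_nat (S N)) + a (- Z.of_nat (S N))%Z))%C.
Proof. reflexivity. Qed.

Definition is_sym_series (a : Z -> C) (l : C) : Prop := filterlim (sym_sum a) eventually (locally l).

Lemma sym_sum_ext (a b : Z -> C) (N : nat) : (forall n, a n = b n) -> sym_sum a N = sym_sum b N.
Proof. intros ext. induction N as [|N IH]; simpl; rewrite ?IH, ?ext; auto. Qed.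

Lemma is_sym_series_ext (a b : Z -> C) (l : C) :
  (forall n, a n = b n) -> is_sym_series a l -> is_sym_series b l.
Proof. intros ext. apply filterlim_ext. intros N. apply sym_sum_ext, ext. Qed.

Lemma is_sym_series_unique (a : Z -> C) (l m : C) : is_sym_series a l -> is_sym_series a m -> l = m.
Proof. apply filterlim_C_unique. apply eventually_filter. Qed.

Lemma sym_sum_mult_l (c : C) (a : Z -> C) (N : nat) : sym_sum (fun n => c * a n)%C N = (c * sym_sum a N)%C.
Proof. induction N as [|N IH]; simpl; [reflexivity|rewrite IH; ring]. Qed.

Lemma is_sym_series_mult_l (c : C) (a : Z -> C) (l : C) :
  is_sym_series a l -> is_sym_series (fun n => c * a n)%C (c * l)%C.
Proof.
  intros lim. apply (filterlim_ext (fun N => c * sym_sum a N)%C); [intros; symmetry; apply sym_sum_mult_l|].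
  apply (filterlim_C_mult eventually); [apply filterlim_const|exact lim].
Qed.

Lemma sym_sum_telescope (b : Z -> C) (c : C) (N : nat) :
  sym_sum (fun n => (if Z.eq_dec n 0 then c else RtoC 0) + (b (n - 1)%Z - b n))%C N =
  (c + (b (- Z.of_nat (S N))%Z - b (Z.of_nat N)))%C.
Proof.
  induction N as [|N IH]; [reflexivity|]. rewrite sym_sum_S, IH.
  destruct (Z.eq_dec (Z.of_nat (S N)) 0); [lia|]. destruct (Z.eq_dec (- Z.of_nat (S N)) 0); [lia|].
  replace (Z.of_nat (S N) - 1)%Z with (Z.of_nat N) by lia.
  replace (- Z.of_nat (S N) - 1)%Z with (- Z.of_nat (S (S N)))%Z by lia. ring.
Qed.

(* Chernoff's argument: the hypothesis makes the Fourier series of [u] at [0] telescope into Fourier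
   coefficients of [v]. *)
Lemma fourier_inversion_of_quotient (u v : R -> C) :
  (forall x, continuous v x) -> (forall x, v (x + 1) = v x) ->
  (forall x, u x = (u 0 + (Ce (RtoC x) - RtoC 1) * v x)%C) -> is_sym_series (fourier u) (u 0).
Proof.
  intros cont per quotient.
  assert (coef : forall n, fourier u n =
    ((if Z.eq_dec n 0 then u 0 else RtoC 0) + (fourier v (n - 1) - fourier v n))%C).
  { intros n.
    assert (expand : fourier u n = fourier (fun x => u 0 * RtoC 1 + (Ce (RtoC x) * v x + RtoC (-1) * v x))%C n)
      by (unfold fourier; apply CInt_ext; intros x _; rewrite (quotient x); ring).
    assert (const_cont : forall x : R, continuous (fun _ : R => u 0 * RtoC 1)%C x)
      by (intros; apply continuous_const).
    assert (Ce_cont : forall x : R, continuous (fun x : R => Ce (RtoC x) * v x)%C x).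
    { intros x. apply continuous_C_mult; auto.
      apply continuous_Ce, (continuous_pair (fun y => y)); [apply continuous_id|apply continuous_const]. }
    assert (opp_cont : forall x : R, continuous (fun x : R => RtoC (-1) * v x)%C x)
      by (intros x; apply continuous_C_mult; [apply continuous_const|auto]).
    assert (sum_cont : forall x : R, continuous (fun x : R => Ce (RtoC x) * v x + RtoC (-1) * v x)%C x)
      by (intros x; apply continuous_C_plus; auto).
    rewrite expand, (fourier_plus _ _ n const_cont sum_cont), (fourier_plus _ _ n Ce_cont opp_cont).
    rewrite fourier_mult_Ce, !fourier_mult_l, fourier_one by (auto; intros; apply continuous_const).
    destruct (Z.eq_dec n 0); ring. }
  apply (is_sym_series_ext _ _ _ (fun n => eq_sym (coef n))).
  apply (filterlim_Cmod eventually). intros eps eps_pos.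
  destruct (riemann_lebesgue v (eps / 2) cont per) as [N0 [N0_pos small]]; [lra|].
  exists (Z.to_nat N0). intros N N_ge. rewrite sym_sum_telescope.
  replace (u 0 + (fourier v (- Z.of_nat (S N)) - fourier v (Z.of_nat N)) - u 0)%C
    with (fourier v (- Z.of_nat (S N)) - fourier v (Z.of_nat N))%C by ring.
  eapply Rle_lt_trans; [apply Cmod_triangle_minus|].
  assert (left := small (- Z.of_nat (S N))%Z ltac:(lia)). assert (right := small (Z.of_nat N) ltac:(lia)). lra.
Qed.

Definition slope (f : R -> C) (l : C) (x : R) : C :=
  if Req_dec_T x 0 then l else ((f x - f 0) / RtoC x)%C.

Lemma continuous_slope (f : R -> C) (l : C) :
  is_derive (V := C_R_NormedModule) f 0 l -> continuous (slope f l) 0.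
Proof.
  intros [_ dom]. specialize (dom 0 (fun P near => near)).
  apply (filterlim_Cmod (locally 0)). intros eps eps_pos.
  apply (filter_imp _ _) with (2 := dom (mkposreal (eps / 2) ltac:(lra))).
  intros x near. rewrite norm_C_R in near. simpl in near.
  unfold slope. destruct (Req_dec_T 0 0) as [_|]; [|lra].
  destruct (Req_dec_T x 0) as [->|nz]; [rewrite Cminus_diag, Cmod_0; lra|].
  assert (nx : RtoC x <> RtoC 0) by (intros absurd; apply RtoC_inj in absurd; auto).
  change (minus (minus (f x) (f 0)) (scal (minus x 0) l)) with (f x - f 0 - scal (x - 0)%R l)%C in near.
  rewrite scal_R_Cmult, Rminus_0_r in near.
  change (norm (minus x 0)) with (Rabs (x - 0)) in near. rewrite Rminus_0_r in near.
  replace ((f x - f 0) / RtoC x - l)%C with ((f x - f 0 - RtoC x * l) / RtoC x)%C by (field; auto).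
  assert (x_pos := proj1 (Cmod_gt_0 _) nx). rewrite Cmod_div by auto. rewrite Cmod_R in *.
  apply Rmult_lt_reg_r with (Rabs x); [auto|]. unfold Rdiv at 1. rewrite Rmult_assoc, Rinv_l by lra. nra.
Qed.

Lemma is_derive_horizontal (f : C -> C) (x y : R) (l : C) :
  is_derive f (x, y) l -> is_derive (V := C_R_NormedModule) (fun u : R => f (u, y)) x l.
Proof.
  rewrite is_derive_Cmod. intros small. split; [apply is_linear_scal_l|]. intros x' lim eps.
  apply (is_filter_lim_locally_unique (V := R_NormedModule)) in lim. subst x'.
  destruct (small eps (cond_pos eps)) as [d [d_pos near]].
  exists (mkposreal d d_pos). intros u close. specialize (near (u, y)).
  replace ((u, y) - (x, y))%C with (RtoC (u - x)) in near by (apply injective_projections; simpl; ring).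
  rewrite Cmod_R in near. rewrite norm_C_R.
  change (minus (minus (f (u, y)) (f (x, y))) (scal (minus u x) l))
    with (f (u, y) - f (x, y) - scal (u - x)%R l)%C.
  rewrite scal_R_Cmult, Cmult_comm. apply (near close).
Qed.

Lemma periodic_Z (f : R -> C) : (forall x, f (x + 1) = f x) -> forall (k : Z) (x : R), f (x + IZR k) = f x.
Proof.
  intros per k. revert k. apply (Z.bi_induction (fun k => forall x, f (x + IZR k) = f x)).
  - intros k k' ->. reflexivity.
  - intros x. rewrite Rplus_0_r. reflexivity.
  - intros k. unfold Z.succ. split; intros IH x; [|specialize (IH (x + 0))];
      rewrite plus_IZR, <- Rplus_assoc, per in *; rewrite ?Rplus_0_r in *; apply IH.
Qed.

Lemma locally_neq_0 {T : UniformSpace} (f : T -> C) (x : T) :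
  continuous f x -> f x <> RtoC 0 -> locally x (fun y => f y <> RtoC 0).
Proof.
  intros cont nz. assert (pos := proj1 (Cmod_gt_0 _) nz).
  apply (filter_imp _ _) with (2 := proj1 (filterlim_Cmod (locally x) f (f x)) cont _ pos).
  intros y near vanish. revert near. rewrite vanish.
  replace (RtoC 0 - f x)%C with (- f x)%C by ring. rewrite Cmod_opp. lra.
Qed.

Section ChernoffQuotient.

Variables (f : R -> C) (l : C).
Hypotheses (f_cont : forall x, continuous f x) (f_per : forall x, f (x + 1) = f x)
  (f_derivative : is_derive (V := C_R_NormedModule) f 0 l).

Let e (x : R) : C := Ce (RtoC x).
Let c : C := (RtoC (2 * PI) * Ci)%C.

Definition chernoff_quotient (x : R) : C :=
  if Ceq_dec (e x) (RtoC 1) then (l / c)%C else ((f x - f 0) / (e x - RtoC 1))%C.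

Lemma chernoff_quotient_eq (x : R) : f x = (f 0 + (Ce (RtoC x) - RtoC 1) * chernoff_quotient x)%C.
Proof.
  unfold chernoff_quotient. fold (e x). destruct (Ceq_dec (e x) (RtoC 1)) as [integer|ne].
  - rewrite integer. destruct (Ce_R_eq_1 x integer) as [k ->].
    rewrite <- (Rplus_0_l (IZR k)), periodic_Z by auto. ring.
  - field. apply Cminus_eq_contra, ne.
Qed.

Lemma chernoff_quotient_periodic (x : R) : chernoff_quotient (x + 1) = chernoff_quotient x.
Proof.
  unfold chernoff_quotient, e. rewrite f_per, RtoC_plus, Ce_plus, Ce_1, Cmult_1_r. reflexivity.
Qed.

Lemma chernoff_quotient_slopes (x : R) : Rabs x < 1 -> chernoff_quotient x = (slope f l x * / slope e c x)%C.
Proof.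
  intros close. assert (e_0 : e 0 = RtoC 1) by apply Ce_0.
  unfold chernoff_quotient, slope. rewrite e_0. destruct (Req_dec_T x 0) as [->|nx].
  - rewrite e_0. destruct (Ceq_dec (RtoC 1) (RtoC 1)); [reflexivity|congruence].
  - assert (nx' : RtoC x <> RtoC 0) by (intros absurd; apply RtoC_inj in absurd; auto).
    destruct (Ceq_dec (e x) (RtoC 1)) as [integer|ne].
    + exfalso. destruct (Ce_R_eq_1 x integer) as [k ->]. rewrite <- abs_IZR in close.
      apply lt_IZR in close. apply nx. replace k with 0%Z by lia. reflexivity.
    + assert (ne' := Cminus_eq_contra _ _ ne). field. split; auto.
Qed.

Lemma continuous_chernoff_quotient_0 : continuous chernoff_quotient 0.
Proof.
  assert (e_derivative : is_derive (V := C_R_NormedModule) e 0 c).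
  { apply (is_derive_horizontal Ce 0 0). apply is_derive_C_val with (1 := is_derive_Ce _).
    rewrite (Ce_0 : Ce (0, 0) = RtoC 1). apply Cmult_1_r. }
  assert (c_nz : c <> RtoC 0).
  { apply Cmult_neq_0; [|apply Ci_nz].
    intros absurd. apply RtoC_inj in absurd. assert (pi_pos := PI_RGT_0). lra. }
  apply (continuous_ext_loc _ (fun x => slope f l x * / slope e c x)%C).
  - exists (mkposreal 1 Rlt_0_1). intros x close. symmetry. apply chernoff_quotient_slopes.
    rewrite <- (Rminus_0_r x). exact close.
  - apply continuous_C_mult; [apply continuous_slope; auto|].
    apply continuous_C_inv; [|apply continuous_slope; auto].
    unfold slope. destruct (Req_dec_T 0 0); [auto|lra].
Qed.

Lemma continuous_chernoff_quotient (x : R) : continuous chernoff_quotient x.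
Proof.
  destruct (Ceq_dec (e x) (RtoC 1)) as [integer|ne].
  - destruct (Ce_R_eq_1 x integer) as [k ->].
    apply (continuous_ext (fun y => chernoff_quotient (y + - IZR k))).
    { intros y. rewrite <- opp_IZR. apply periodic_Z, chernoff_quotient_periodic. }
    apply continuous_translate. rewrite Rplus_opp_r. exact continuous_chernoff_quotient_0.
  - assert (ne' := Cminus_eq_contra _ _ ne).
    assert (e_cont : continuous (fun y : R => e y - RtoC 1)%C x).
    { apply continuous_C_minus; [|apply continuous_const].
      apply continuous_Ce, (continuous_pair (fun y => y)); [apply continuous_id|apply continuous_const]. }
    apply (continuous_ext_loc _ (fun y => (f y - f 0) * / (e y - RtoC 1))%C).
    + apply (filter_imp _ _) with (2 := locally_neq_0 _ x e_cont ne').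
      intros y ny. unfold chernoff_quotient. destruct (Ceq_dec (e y) (RtoC 1)) as [eq|]; [|reflexivity].
      destruct ny. rewrite eq. ring.
    + apply continuous_C_mult; [apply continuous_C_minus; [auto|apply continuous_const]|].
      apply continuous_C_inv; auto.
Qed.

End ChernoffQuotient.

Theorem fourier_inversion (f : R -> C) (x0 : R) :
  (forall x, continuous f x) -> (forall x, f (x + 1) = f x) -> ex_derive (V := C_R_NormedModule) f x0 ->
  is_sym_series (fun n => Ce (RtoC (IZR n * x0)) * fourier f n)%C (f x0).
Proof.
  intros cont per [l derivative]. set (g := fun x => f (x + x0)).
  assert (g_cont : forall x, continuous g x) by (intros x; apply continuous_translate, cont).
  assert (g_per : forall x, g (x + 1) = g x)
    by (intros x; unfold g; replace (x + 1 + x0) with (x + x0 + 1) by ring; apply per).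
  assert (g_derivative : is_derive (V := C_R_NormedModule) g 0 (scal 1 l)).
  { apply (is_derive_comp (V := C_R_NormedModule) f (fun x => x + x0)).
    - rewrite Rplus_0_l. exact derivative.
    - auto_derive; auto. }
  apply (is_sym_series_ext (fourier g)); [intros n; apply fourier_translate; auto|].
  replace (f x0) with (g 0) by (unfold g; rewrite Rplus_0_l; reflexivity).
  apply (fourier_inversion_of_quotient g (chernoff_quotient g (scal 1 l))).
  - apply continuous_chernoff_quotient; auto.
  - apply chernoff_quotient_periodic; auto.
  - apply chernoff_quotient_eq; auto.
Qed.

(** * Series of exponentials *)

Lemma ex_series_R_le (a b : nat -> R) : (forall n, 0 <= a n <= b n) -> ex_series b -> ex_series a.
Proof.
  intros le. apply (ex_series_le (V := R_CompleteNormedModule)). intros n.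
  change (norm (a n)) with (Rabs (a n)). rewrite Rabs_pos_eq; apply le.
Qed.

Lemma ex_series_R_scal (c : R) (a : nat -> R) : ex_series a -> ex_series (fun n => c * a n).
Proof. apply (ex_series_scal (V := R_NormedModule)). Qed.

Lemma Series_nonneg (a : nat -> R) : (forall n, 0 <= a n) -> ex_series a -> 0 <= Series a.
Proof.
  intros nonneg conv. rewrite <- (Rmult_0_l (Series a)), <- Series_scal_l.
  apply Series_le; auto. intros n. specialize (nonneg n). lra.
Qed.

Lemma ex_series_C_abs (u : nat -> C) : ex_series (fun n => Cmod (u n)) -> exists l : C, is_series u l.
Proof.
  apply (ex_series_le (V := C_CompleteNormedModule)). intros n. apply Rle_refl.
Qed.

Lemma is_series_Re_Im (u : nat -> C) (l : C) :
  is_series u l -> is_series (fun n => Re (u n)) (Re l) /\ is_series (fun n => Im (u n)) (Im l).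
Proof.
  intros lim. assert (lim' := proj1 (filterlim_Cmod eventually _ _) lim).
  assert (sums : forall N, sum_n (fun n => Re (u n)) N = Re (sum_n u N) /\
                           sum_n (fun n => Im (u n)) N = Im (sum_n u N)).
  { induction N as [|N [re im]]; [rewrite !sum_O; auto|rewrite !sum_Sn, re, im; auto]. }
  split; apply filterlim_locally; intros eps; destruct (lim' eps (cond_pos eps)) as [N0 near];
    exists N0; intros N N_ge; specialize (near N N_ge); destruct (sums N) as [re im].
  - change (Rabs (sum_n (fun n => Re (u n)) N - Re l) < eps). rewrite re.
    eapply Rle_lt_trans; [apply (re_le_Cmod (sum_n u N - l))|exact near].
  - change (Rabs (sum_n (fun n => Im (u n)) N - Im l) < eps). rewrite im.
    eapply Rle_lt_trans; [apply (im_le_Cmod (sum_n u N - l))|exact near].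
Qed.

Lemma is_series_C_mult_l (c : C) (u : nat -> C) (l : C) :
  is_series u l -> is_series (fun n => c * u n)%C (c * l)%C.
Proof. apply (is_series_scal (V := C_NormedModule)). Qed.

Lemma is_series_C_minus (u v : nat -> C) (l m : C) :
  is_series u l -> is_series v m -> is_series (fun n => u n - v n)%C (l - m)%C.
Proof. apply (is_series_minus (V := C_NormedModule)). Qed.

Lemma is_series_C_unique (u : nat -> C) (l m : C) : is_series u l -> is_series u m -> l = m.
Proof. apply (filterlim_C_unique eventually). Qed.

Lemma is_series_C_incr_1 (u : nat -> C) (l : C) :
  is_series u l -> is_series (fun k => u (S k)) (l - u O)%C.
Proof.
  intros lim. apply (is_series_incr_1 (V := C_NormedModule) u (l - u O)%C).
  change (is_series u (l - u O + u O)%C). replace (l - u O + u O)%C with l by ring. exact lim.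
Qed.

Lemma Cmod_is_series_le (u : nat -> C) (l : C) (b : nat -> R) :
  is_series u l -> (forall n, Cmod (u n) <= b n) -> ex_series b -> Cmod l <= Series b.
Proof.
  intros lim bound conv.
  apply (is_lim_seq_le (fun N => Cmod (sum_n u N)) (sum_n b) (Cmod l) (Series b)).
  - induction n as [|N IH]; [rewrite !sum_O; apply bound|].
    rewrite !sum_Sn. eapply Rle_trans; [apply Cmod_triangle|]. apply Rplus_le_compat; auto.
  - apply (filterlim_comp _ _ _ _ (norm (V := C_NormedModule)) eventually (locally l)); [exact lim|].
    apply (filterlim_norm (V := C_NormedModule)).
  - apply (Series_correct _ conv).
Qed.

Lemma is_series_C_even_odd (u : nat -> C) (l even odd : C) : is_series u l ->
  is_series (fun k => u (2 * k)%nat) even -> is_series (fun k => u (2 * k + 1)%nat) odd -> l = (even + odd)%C.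
Proof.
  intros lim lim_even lim_odd.
  assert (sums : forall N, (sum_n (fun k => u (2 * k)%nat) N + sum_n (fun k => u (2 * k + 1)%nat) N)%C
                           = sum_n u (2 * N + 1)).
  { induction N as [|N IH]; [simpl; rewrite !sum_Sn, !sum_O; reflexivity|].
    replace (2 * S N + 1)%nat with (S (S (2 * N + 1))) by lia.
    rewrite !sum_Sn, <- IH. replace (S (2 * N + 1)) with (2 * S N)%nat by lia.
    replace (S (2 * S N)) with (2 * S N + 1)%nat by lia.
    set (even_sum := sum_n _ N). set (odd_sum := sum_n _ N).
    change (even_sum + u (2 * S N)%nat + (odd_sum + u (2 * S N + 1)%nat)
            = even_sum + odd_sum + u (2 * S N)%nat + u (2 * S N + 1)%nat)%C. ring. }
  apply (filterlim_C_unique eventually (fun N => sum_n u (2 * N + 1))).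
  - apply filterlim_subseq with (2 := lim) (d := O). lia.
  - apply (filterlim_ext _ _ sums). apply (filterlim_C_plus eventually); auto.
Qed.

Definition Cseries (u : nat -> C) : C := (Series (fun n => Re (u n)), Series (fun n => Im (u n))).

Lemma Cseries_unique (u : nat -> C) (l : C) : is_series u l -> Cseries u = l.
Proof.
  intros lim. destruct (is_series_Re_Im u l lim) as [re im].
  apply injective_projections; apply is_series_unique; auto.
Qed.

Definition eseries (c : nat -> C) (lam : nat -> R) (z : C) : C :=
  Cseries (fun k => c k * Ce (RtoC (lam k) * z))%C.

Definition eseries_cv (c : nat -> C) (lam : nat -> R) (y : R) : Prop :=
  ex_series (fun k => Cmod (c k) * exp (- (2 * PI * lam k * y))).

Lemma Cmod_Ce_mult (r : R) (z : C) : Cmod (Ce (RtoC r * z)) = exp (- (2 * PI * r * Im z)).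
Proof. rewrite Cmod_Ce, im_scal_l. f_equal. ring. Qed.

Lemma is_series_eseries (c : nat -> C) (lam : nat -> R) (z : C) :
  eseries_cv c lam (Im z) -> is_series (fun k => c k * Ce (RtoC (lam k) * z))%C (eseries c lam z).
Proof.
  intros conv. destruct (ex_series_C_abs (fun k => c k * Ce (RtoC (lam k) * z))%C) as [l lim].
  - eapply ex_series_ext; [|exact conv]. intros k. simpl. rewrite Cmod_mult, Cmod_Ce_mult. reflexivity.
  - unfold eseries. rewrite (Cseries_unique _ l lim). exact lim.
Qed.

Lemma eseries_cv_two_lines (c : nat -> C) (lam : nat -> R) (y1 y2 : R) :
  eseries_cv c lam y1 -> eseries_cv c lam y2 ->
  ex_series (fun k => Cmod (c k) * (exp (- (2 * PI * lam k * y1)) + exp (- (2 * PI * lam k * y2)))).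
Proof.
  intros conv1 conv2. eapply ex_series_ext; [|apply (ex_series_plus (V := R_NormedModule) _ _ conv1 conv2)].
  intros k. symmetry. apply Rmult_plus_distr_l.
Qed.

Lemma exp_Rabs_le (r y d : R) : 0 <= d ->
  exp (2 * PI * Rabs r * d) * exp (- (2 * PI * r * y)) <=
  exp (- (2 * PI * r * (y - d))) + exp (- (2 * PI * r * (y + d))).
Proof.
  intros d_nonneg. rewrite <- exp_plus.
  assert (below_pos := exp_pos (- (2 * PI * r * (y - d)))). assert (above_pos := exp_pos (- (2 * PI * r * (y + d)))).
  unfold Rabs. destruct (Rcase_abs r).
  - replace (2 * PI * - r * d + - (2 * PI * r * y)) with (- (2 * PI * r * (y + d))) by ring. lra.
  - replace (2 * PI * r * d + - (2 * PI * r * y)) with (- (2 * PI * r * (y - d))) by ring. lra.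
Qed.

Lemma eseries_cv_between (c : nat -> C) (lam : nat -> R) (y1 y2 y : R) :
  eseries_cv c lam y1 -> eseries_cv c lam y2 -> y1 <= y <= y2 -> eseries_cv c lam y.
Proof.
  intros conv1 conv2 y_in. apply ex_series_R_le with (2 := eseries_cv_two_lines c lam y1 y2 conv1 conv2).
  intros k. assert (c_nonneg := Cmod_ge_0 (c k)). assert (e_pos := exp_pos (- (2 * PI * lam k * y))).
  split; [nra|]. apply Rmult_le_compat_l; [auto|].
  assert (e1_pos := exp_pos (- (2 * PI * lam k * y1))). assert (e2_pos := exp_pos (- (2 * PI * lam k * y2))).
  assert (pi_pos := PI_RGT_0). destruct (Rle_lt_dec 0 (lam k)) as [nonneg|neg].
  - apply Rle_trans with (exp (- (2 * PI * lam k * y1))); [|lra].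
    apply exp_le, Ropp_le_contravar, Rmult_le_compat_l; nra.
  - apply Rle_trans with (exp (- (2 * PI * lam k * y2))); [|lra].
    apply exp_le, Ropp_le_contravar, Rmult_le_compat_neg_l; nra.
Qed.

Definition eseries_derive_coef (c : nat -> C) (lam : nat -> R) (k : nat) : C :=
  (RtoC (2 * PI) * Ci * RtoC (lam k) * c k)%C.

Lemma Cmod_derive_factor (r : R) : Cmod (RtoC (2 * PI) * Ci * RtoC r) = 2 * PI * Rabs r.
Proof.
  assert (pi_pos := PI_RGT_0). rewrite !Cmod_mult, Cmod_Ci, !Cmod_R, (Rabs_pos_eq (2 * PI)) by lra. ring.
Qed.

Lemma eseries_cv_derive (c : nat -> C) (lam : nat -> R) (y d : R) : 0 < d ->
  eseries_cv c lam (y - d) -> eseries_cv c lam (y + d) -> eseries_cv (eseries_derive_coef c lam) lam y.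
Proof.
  intros d_pos below above. apply ex_series_R_le with (fun k => / d *
    (Cmod (c k) * (exp (- (2 * PI * lam k * (y - d))) + exp (- (2 * PI * lam k * (y + d)))))).
  - intros k. split; [apply Rmult_le_pos; [apply Cmod_ge_0|left; apply exp_pos]|].
    unfold eseries_derive_coef. rewrite Cmod_mult, Cmod_derive_factor.
    set (x := 2 * PI * Rabs (lam k)). assert (c_nonneg := Cmod_ge_0 (c k)).
    assert (dominated := exp_Rabs_le (lam k) y d ltac:(lra)). fold x in dominated.
    assert (linear := exp_ineq1_le (x * d)). assert (e_pos := exp_pos (- (2 * PI * lam k * y))).
    apply Rmult_le_reg_l with d; [auto|]. rewrite <- (Rmult_assoc d (/ d)), Rinv_r, Rmult_1_l by lra.
    replace (d * (x * Cmod (c k) * exp (- (2 * PI * lam k * y))))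
      with (Cmod (c k) * (x * d * exp (- (2 * PI * lam k * y)))) by ring.
    apply Rmult_le_compat_l; nra.
  - apply ex_series_R_scal, eseries_cv_two_lines; auto.
Qed.

Lemma sqr_le_4_exp (x : R) : 0 <= x -> x * x <= 4 * exp x.
Proof.
  intros nonneg. replace (exp x) with (exp (x / 2) * exp (x / 2)).
  - assert (linear := exp_ineq1_le (x / 2)). nra.
  - rewrite <- exp_plus. f_equal. lra.
Qed.

Lemma Cmod_Ce_remainder_le (r d : R) (z w : C) : 0 < d -> Cmod (w - z) <= d / 2 ->
  Cmod (Ce (RtoC r * w) - Ce (RtoC r * z) - (w - z) * (RtoC (2 * PI) * Ci * RtoC r * Ce (RtoC r * z))) <=
  16 / (d * d) * (Cmod (w - z) * Cmod (w - z)) *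
  (exp (- (2 * PI * r * (Im z - d))) + exp (- (2 * PI * r * (Im z + d)))).
Proof.
  intros d_pos close. set (h := (w - z)%C) in *. set (u := (RtoC (2 * PI) * Ci * RtoC r * h)%C).
  replace (Ce (RtoC r * w)) with (Ce (RtoC r * z) * Cexp u)%C.
  2: { unfold u, Ce, h. rewrite <- Cexp_plus. f_equal. ring. }
  replace (Ce (RtoC r * z) * Cexp u - Ce (RtoC r * z) - h * (RtoC (2 * PI) * Ci * RtoC r * Ce (RtoC r * z)))%C
    with (Ce (RtoC r * z) * (Cexp u - RtoC 1 - u))%C by (unfold u; ring).
  rewrite Cmod_mult, Cmod_Ce_mult. set (x := 2 * PI * Rabs r).
  assert (u_mod : Cmod u = x * Cmod h) by (unfold u; rewrite Cmod_mult, Cmod_derive_factor; reflexivity).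
  assert (taylor := Cmod_Cexp_taylor_le u). rewrite u_mod in taylor.
  assert (x_nonneg : 0 <= x).
  { assert (pi_pos := PI_RGT_0). apply Rmult_le_pos; [lra|apply Rabs_pos]. }
  assert (h_nonneg := Cmod_ge_0 h). assert (e_pos := exp_pos (- (2 * PI * r * Im z))).
  assert (quadratic : x * x <= 16 / (d * d) * exp (x * (d / 2))).
  { assert (sqr := sqr_le_4_exp (x * (d / 2)) ltac:(nra)).
    apply Rmult_le_reg_l with (d * d / 4); [nra|].
    replace (d * d / 4 * (16 / (d * d) * exp (x * (d / 2)))) with (4 * exp (x * (d / 2))) by (field; lra).
    replace (d * d / 4 * (x * x)) with (x * (d / 2) * (x * (d / 2))) by field. exact sqr. }
  assert (exp_h : exp (x * Cmod h) <= exp (x * (d / 2))) by (apply exp_le, Rmult_le_compat_l; auto).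
  assert (dominated := exp_Rabs_le r (Im z) d ltac:(lra)). fold x in dominated.
  replace (exp (x * d)) with (exp (x * (d / 2)) * exp (x * (d / 2))) in dominated
    by (rewrite <- exp_plus; f_equal; field).
  set (E := exp (x * (d / 2))) in *. assert (E_pos : 0 < E) by apply exp_pos.
  set (h2 := Cmod h * Cmod h). assert (h2_nonneg : 0 <= h2) by (unfold h2; nra).
  assert (K_pos : 0 < 16 / (d * d)) by (apply Rdiv_lt_0_compat; nra). set (K := 16 / (d * d)) in *.
  assert (taylor_E : Cmod (Cexp u - RtoC 1 - u) <= K * h2 * (E * E)).
  { eapply Rle_trans; [apply taylor|].
    replace (x * Cmod h * (x * Cmod h) * exp (x * Cmod h)) with (h2 * (x * x * exp (x * Cmod h)))
      by (unfold h2; ring).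
    replace (K * h2 * (E * E)) with (h2 * (K * E * E)) by ring.
    apply Rmult_le_compat_l; [auto|]. assert (p := exp_pos (x * Cmod h)). apply Rmult_le_compat; nra. }
  eapply Rle_trans; [apply Rmult_le_compat_l; [lra|apply taylor_E]|].
  replace (exp (- (2 * PI * r * Im z)) * (K * h2 * (E * E)))
    with (K * h2 * (E * E * exp (- (2 * PI * r * Im z)))) by ring.
  apply Rmult_le_compat_l; [nra|exact dominated].
Qed.

Theorem is_derive_eseries (c : nat -> C) (lam : nat -> R) (z : C) (d : R) : 0 < d ->
  eseries_cv c lam (Im z - d) -> eseries_cv c lam (Im z + d) ->
  is_derive (eseries c lam) z (eseries (eseries_derive_coef c lam) lam z).
Proof.
  intros d_pos below above.
  set (b := fun k => Cmod (c k) * (exp (- (2 * PI * lam k * (Im z - d))) + exp (- (2 * PI * lam k * (Im z + d))))).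
  assert (b_conv : ex_series b) by (apply eseries_cv_two_lines; auto).
  assert (near_conv : forall w, Cmod (w - z) <= d -> eseries_cv c lam (Im w)).
  { intros w close. apply (eseries_cv_between c lam (Im z - d) (Im z + d)); auto.
    apply Rabs_le_between'. rewrite <- im_minus. eapply Rle_trans; [apply im_le_Cmod|exact close]. }
  assert (derive_conv := is_series_eseries _ _ z (eseries_cv_derive c lam (Im z) d d_pos below above)).
  assert (z_conv := is_series_eseries _ _ z (near_conv z ltac:(rewrite Cminus_diag, Cmod_0; lra))).
  set (K := 16 / (d * d) * (Series b + 1)).
  assert (B_nonneg : 0 <= Series b).
  { apply Series_nonneg; auto. intros k. apply Rmult_le_pos; [apply Cmod_ge_0|].
    left. apply Rplus_lt_0_compat; apply exp_pos. }
  assert (K_pos : 0 < K) by (apply Rmult_lt_0_compat; [apply Rdiv_lt_0_compat; nra|lra]).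
  apply is_derive_Cmod. intros eps eps_pos.
  exists (Rmin (d / 2) (eps / K)). split; [apply Rmin_pos; [lra|apply Rdiv_lt_0_compat; auto]|].
  intros w close. assert (close_d := Rmin_l (d / 2) (eps / K)). assert (close_eps := Rmin_r (d / 2) (eps / K)).
  assert (w_conv := is_series_eseries _ _ w (near_conv w ltac:(lra))).
  assert (remainder := is_series_C_minus _ _ _ _ (is_series_C_minus _ _ _ _ w_conv z_conv)
                         (is_series_C_mult_l (w - z) _ _ derive_conv)).
  rewrite (Cmult_comm (eseries _ _ z)). set (h := Cmod (w - z)) in *. assert (h_nonneg : 0 <= h) by apply Cmod_ge_0.
  eapply Rle_trans.
  { apply (Cmod_is_series_le _ _ (fun k => 16 / (d * d) * (h * h) * b k) remainder).
    - intros k. unfold eseries_derive_coef.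
      replace (c k * Ce (RtoC (lam k) * w) - c k * Ce (RtoC (lam k) * z) -
               (w - z) * (RtoC (2 * PI) * Ci * RtoC (lam k) * c k * Ce (RtoC (lam k) * z)))%C
        with (c k * (Ce (RtoC (lam k) * w) - Ce (RtoC (lam k) * z) -
               (w - z) * (RtoC (2 * PI) * Ci * RtoC (lam k) * Ce (RtoC (lam k) * z))))%C by ring.
      rewrite Cmod_mult. unfold b. rewrite <- Rmult_assoc, (Rmult_comm _ (Cmod (c k))), Rmult_assoc.
      apply Rmult_le_compat_l; [apply Cmod_ge_0|]. apply Cmod_Ce_remainder_le; auto. fold h. lra.
    - apply ex_series_R_scal, b_conv. }
  rewrite Series_scal_l.
  apply Rle_trans with (K * (h * h)).
  { unfold K. assert (factor_pos : 0 < 16 / (d * d)) by (apply Rdiv_lt_0_compat; nra). nra. }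
  rewrite <- Rmult_assoc. apply Rmult_le_compat_r; auto.
  apply Rle_trans with (K * (eps / K)); [apply Rmult_le_compat_l; lra|right; field; lra].
Qed.

Lemma eseries_sub_lead (c : nat -> C) (lam : nat -> R) (z : C) : eseries_cv c lam (Im z) ->
  is_series (fun k => c (S k) * Ce (RtoC (lam (S k)) * z))%C (eseries c lam z - c O * Ce (RtoC (lam O) * z))%C.
Proof.
  intros conv. apply (is_series_C_incr_1 (fun k => c k * Ce (RtoC (lam k) * z))%C), is_series_eseries, conv.
Qed.

Section GeometricDomination.

Variables (c : nat -> C) (lam : nat -> R) (y B x : R).
Hypotheses (x_in : 0 <= x < 1)
  (dominated : forall k, Cmod (c (S k)) * exp (- (2 * PI * (lam (S k) - lam O) * y)) <= B * x ^ k).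

Let lead : R := exp (- (2 * PI * lam O * y)).

Lemma geometric_term_le (k : nat) :
  Cmod (c (S k)) * exp (- (2 * PI * lam (S k) * y)) <= lead * B * x ^ k.
Proof.
  replace (exp (- (2 * PI * lam (S k) * y))) with (lead * exp (- (2 * PI * (lam (S k) - lam O) * y)))
    by (unfold lead; rewrite <- exp_plus; f_equal; ring).
  assert (lead_pos := exp_pos (- (2 * PI * lam O * y))). fold lead in lead_pos. specialize (dominated k).
  set (gap_exp := exp _) in *. replace (lead * B * x ^ k) with (lead * (B * x ^ k)) by ring.
  replace (Cmod (c (S k)) * (lead * gap_exp)) with (lead * (Cmod (c (S k)) * gap_exp)) by ring.
  apply Rmult_le_compat_l; lra.
Qed.

Lemma ex_series_geometric_bound : ex_series (fun k => lead * B * x ^ k).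
Proof. apply ex_series_R_scal, ex_series_geom. rewrite Rabs_pos_eq; lra. Qed.

Lemma eseries_cv_geometric : eseries_cv c lam y.
Proof.
  apply (ex_series_incr_1 (V := R_NormedModule)). apply ex_series_R_le with (2 := ex_series_geometric_bound).
  intros k. split; [apply Rmult_le_pos; [apply Cmod_ge_0|left; apply exp_pos]|apply geometric_term_le].
Qed.

Lemma Cmod_eseries_sub_lead_le (z : C) : Im z = y ->
  Cmod (eseries c lam z - c O * Ce (RtoC (lam O) * z)) <= B / (1 - x) * lead.
Proof.
  intros height. assert (conv := eseries_cv_geometric). rewrite <- height in conv.
  eapply Rle_trans.
  - apply (Cmod_is_series_le _ _ _ (eseries_sub_lead c lam z conv)) with (2 := ex_series_geometric_bound).
    intros k. rewrite Cmod_mult, Cmod_Ce_mult, height. apply geometric_term_le.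
  - rewrite Series_scal_l, Series_geom by (rewrite Rabs_pos_eq; lra). right. unfold Rdiv. ring.
Qed.

End GeometricDomination.

Lemma eseries_sub_lead_decay (c : nat -> C) (lam : nat -> R) (gap y0 : R) : eseries_cv c lam y0 ->
  (forall k, lam O + gap <= lam (S k)) ->
  exists K, 0 <= K /\ forall z, y0 <= Im z -> eseries_cv c lam (Im z) ->
    Cmod (eseries c lam z - c O * Ce (RtoC (lam O) * z)) <= K * exp (- (2 * PI * (lam O + gap) * Im z)).
Proof.
  intros conv lam_gap. apply (ex_series_incr_1 (V := R_NormedModule)) in conv.
  set (b := fun k => Cmod (c (S k)) * exp (- (2 * PI * lam (S k) * y0))) in conv.
  set (L := exp (2 * PI * (lam O + gap) * y0)).
  exists (L * Series b). split.
  { apply Rmult_le_pos; [left; apply exp_pos|]. apply Series_nonneg; [|exact conv].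
    intros k. apply Rmult_le_pos; [apply Cmod_ge_0|left; apply exp_pos]. }
  intros z high conv_z. set (E := exp (- (2 * PI * (lam O + gap) * Im z))).
  replace (L * Series b * E) with (Series (fun k => L * E * b k)) by (rewrite Series_scal_l; ring).
  apply (Cmod_is_series_le _ _ _ (eseries_sub_lead c lam z conv_z)); [|apply ex_series_R_scal, conv].
  intros k. rewrite Cmod_mult, Cmod_Ce_mult. unfold b.
  replace (L * E * (Cmod (c (S k)) * exp (- (2 * PI * lam (S k) * y0))))
    with (Cmod (c (S k)) * (L * E * exp (- (2 * PI * lam (S k) * y0)))) by ring.
  apply Rmult_le_compat_l; [apply Cmod_ge_0|].
  unfold L, E. rewrite <- !exp_plus. apply exp_le. assert (pi_pos := PI_RGT_0).
  assert (nonneg : 0 <= 2 * PI * ((lam (S k) - (lam O + gap)) * (Im z - y0))); [|lra].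
  specialize (lam_gap k). apply Rmult_le_pos; [lra|]. apply Rmult_le_pos; lra.
Qed.

(** * Functions on the upper half plane *)

Lemma locally_H (z : C) : 0 < Im z -> locally z (fun w => 0 < Im w).
Proof.
  intros z_in. apply locally_Cmod. exists (Im z). split; auto. intros w close.
  assert (im_close := Rle_lt_trans _ _ _ (im_le_Cmod (w - z)) close).
  rewrite im_minus in im_close. apply Rabs_lt_between in im_close. lra.
Qed.

Lemma C_derive_ext_H (f g : C -> C) (z : C) : 0 < Im z ->
  (forall w, 0 < Im w -> f w = g w) -> ex_derive f z -> C_derive f z = C_derive g z.
Proof. intros z_in agree. apply C_derive_ext_loc. apply (filter_imp _ _ agree), locally_H, z_in. Qed.

Lemma holo_on_H_ext (f g : C -> C) : (forall z, 0 < Im z -> f z = g z) -> holo_on_H f -> holo_on_H g.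
Proof.
  intros agree holo z z_in. destruct (holo z z_in) as [l derivative]. exists l.
  apply (is_derive_C_ext_loc f); [|exact derivative]. apply (filter_imp _ _ agree), locally_H, z_in.
Qed.

Lemma holo_on_H_lin (f g : C -> C) (c d : C) :
  holo_on_H f -> holo_on_H g -> holo_on_H (fun z => c * f z + d * g z)%C.
Proof. intros f_holo g_holo z z_in. apply ex_derive_C_lin; auto. Qed.

Lemma holo_on_H_mult (f g : C -> C) : holo_on_H f -> holo_on_H g -> holo_on_H (fun z => f z * g z)%C.
Proof. intros f_holo g_holo z z_in. apply ex_derive_C_mult; auto. Qed.

Lemma holo_on_H_comp (f g : C -> C) : (forall z, 0 < Im z -> 0 < Im (g z)) ->
  holo_on_H f -> holo_on_H g -> holo_on_H (fun z => f (g z)).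
Proof. intros stable f_holo g_holo z z_in. apply ex_derive_C_comp; auto. Qed.

Lemma Im_translate (z : C) (r : R) : Im (z + RtoC r) = Im z.
Proof. rewrite im_plus, im_RtoC. ring. Qed.

Lemma holo_on_H_translate (f : C -> C) (r : R) : holo_on_H f -> holo_on_H (fun z => f (z + RtoC r)%C).
Proof.
  intros holo z z_in.
  assert (shift : ex_derive (fun w => w + RtoC r)%C z).
  { eexists. apply (is_derive_plus (V := C_NormedModule) (fun w => w) (fun _ => RtoC r)).
    - apply is_derive_C_id.
    - apply (is_derive_const (V := C_NormedModule) (RtoC r)). }
  apply (ex_derive_C_comp f); [apply holo; rewrite Im_translate; exact z_in|exact shift].
Qed.

Definition periodic_on_H (f : C -> C) : Prop := forall z, 0 < Im z -> f (z + RtoC 1)%C = f z.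

Lemma periodic_on_H_lin (f g : C -> C) (c d : C) :
  periodic_on_H f -> periodic_on_H g -> periodic_on_H (fun z => c * f z + d * g z)%C.
Proof. intros f_per g_per z z_in. rewrite f_per, g_per; auto. Qed.

Lemma periodic_on_H_translate (f : C -> C) (r : R) :
  periodic_on_H f -> periodic_on_H (fun z => f (z + RtoC r)%C).
Proof.
  intros per z z_in. replace (z + RtoC 1 + RtoC r)%C with (z + RtoC r + RtoC 1)%C by ring.
  apply per. rewrite Im_translate. exact z_in.
Qed.

Definition is_eseries_on_H (F : C -> C) (c : nat -> C) (lam : nat -> R) : Prop :=
  (forall y, 0 < y -> eseries_cv c lam y) /\ forall z, 0 < Im z -> F z = eseries c lam z.

Lemma is_derive_eseries_on_H (F : C -> C) (c : nat -> C) (lam : nat -> R) (z : C) :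
  is_eseries_on_H F c lam -> 0 < Im z -> is_derive F z (eseries (eseries_derive_coef c lam) lam z).
Proof.
  intros [conv agree] z_in. apply (is_derive_C_ext_loc (eseries c lam)).
  - apply (filter_imp _ _) with (2 := locally_H z z_in). intros w w_in. symmetry. apply agree, w_in.
  - apply is_derive_eseries with (Im z / 2); [lra| |]; apply conv; lra.
Qed.

Lemma holo_eseries_on_H (F : C -> C) (c : nat -> C) (lam : nat -> R) : is_eseries_on_H F c lam -> holo_on_H F.
Proof. intros series z z_in. eexists. apply (is_derive_eseries_on_H F c lam z series z_in). Qed.

Lemma eseries_on_H_derive (F : C -> C) (c : nat -> C) (lam : nat -> R) :
  is_eseries_on_H F c lam -> is_eseries_on_H (C_derive F) (eseries_derive_coef c lam) lam.
Proof.
  intros series. split.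
  - intros y y_pos. apply eseries_cv_derive with (y / 2); [lra| |]; apply series; lra.
  - intros z z_in. apply is_C_derive_unique, is_derive_eseries_on_H; auto.
Qed.

(** * Fourier expansions of periodic holomorphic functions *)

Lemma Ce_mult_pair (r x y : R) : Ce (RtoC r * (x, y)) = (RtoC (exp (- (2 * PI * r * y))) * Ce (RtoC (r * x)))%C.
Proof.
  replace (RtoC r * (x, y))%C with (RtoC (r * x) + (0, r * y)%R)%C by (apply injective_projections; simpl; ring).
  rewrite Ce_plus, Cmult_comm. f_equal. unfold Ce, Cexp. simpl.
  replace ((2 * PI * 0 - 0 * 1) * 0 - (2 * PI * 1 + 0 * 0) * (r * y)) with (- (2 * PI * r * y)) by ring.
  replace ((2 * PI * 0 - 0 * 1) * (r * y) + (2 * PI * 1 + 0 * 0) * 0) with 0 by ring.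
  rewrite cos_0, sin_0. apply injective_projections; simpl; ring.
Qed.

Definition fcoef_at (f : C -> C) (y : R) (n : Z) : C := CInt (fun x => f (x, y) * qpow (x, y) (- n))%C 0 1.

Lemma fcoef_at_fourier (f : C -> C) (y : R) (n : Z) : (forall x, continuous f (x, y)) ->
  fcoef_at f y n = (RtoC (exp (2 * PI * IZR n * y)) * fourier (fun x => f (x, y)) n)%C.
Proof.
  intros cont. unfold fcoef_at, fourier. rewrite <- CInt_mult_l.
  - apply CInt_ext. intros x _. rewrite qpow_Ce, Ce_mult_pair, opp_IZR.
    replace (- (2 * PI * - IZR n * y)) with (2 * PI * IZR n * y) by ring. ring.
  - apply ex_CInt_fourier. intros x. apply continuous_horizontal, cont.
Qed.

Lemma fcoef_at_height (f : C -> C) (n : Z) (y y' : R) : y <= y' ->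
  (forall z, y <= Im z <= y' -> ex_derive f z) -> (forall z, y <= Im z <= y' -> f (z + RtoC 1)%C = f z) ->
  fcoef_at f y n = fcoef_at f y' n.
Proof.
  intros y_le diff per. set (g := fun z => (f z * qpow z (- n))%C).
  assert (closed : rect_int g 0 y 1 (y' - y) = RtoC 0).
  { apply Goursat; [lra|lra|]. intros z [_ z_in]. apply ex_derive_C_mult; [apply diff; lra|].
    apply (ex_derive_ext (fun w => Ce (RtoC (IZR (- n)) * w))); [intros w; symmetry; apply qpow_Ce|].
    eexists. apply is_derive_Ce_scal. }
  assert (sides : CInt (fun v => g (1, v)) y y' = CInt (fun v => g (0, v)) y y').
  { apply CInt_ext. intros v v_in. rewrite Rmin_left, Rmax_right in v_in by auto. unfold g.
    replace ((1, v) : C) with ((0, v) + RtoC 1)%C by (apply injective_projections; simpl; ring).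
    rewrite per by (simpl; lra). f_equal.
    rewrite !qpow_Ce, Cmult_plus_distr_l, Ce_plus, Cmult_1_r, Ce_Z. apply Cmult_1_r. }
  unfold rect_int in closed. replace (y + (y' - y)) with y' in closed by ring.
  rewrite Rplus_0_l, sides in closed. apply Ceq_minus. rewrite <- closed. unfold fcoef_at, g. ring.
Qed.

Section PeriodicHolomorphic.

Variable f : C -> C.
Hypotheses (f_holo : holo_on_H f) (f_per : periodic_on_H f).

Lemma continuous_on_line (x y : R) : 0 < y -> continuous f (x, y).
Proof. intros y_pos. apply ex_derive_C_continuous, f_holo. exact y_pos. Qed.

Lemma fcoef_at_eq (n : Z) (y : R) : 0 < y -> fcoef_at f y n = fcoef f n.
Proof.
  intros y_pos. change (fcoef f n) with (fcoef_at f 1 n). destruct (Rle_lt_dec y 1).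
  - apply fcoef_at_height; auto; intros z z_in; [apply f_holo|apply f_per]; lra.
  - symmetry. apply fcoef_at_height; [lra| |]; intros z z_in; [apply f_holo|apply f_per]; lra.
Qed.

Lemma fourier_line (y : R) (n : Z) : 0 < y ->
  fourier (fun x => f (x, y)) n = (RtoC (exp (- (2 * PI * IZR n * y))) * fcoef f n)%C.
Proof.
  intros y_pos. rewrite <- (fcoef_at_eq n y), fcoef_at_fourier by (auto; intros; apply continuous_on_line; auto).
  rewrite Cmult_assoc, <- RtoC_mult, <- exp_plus, Rplus_opp_l, exp_0. ring.
Qed.

Lemma Cmod_fcoef_le (n : Z) (y M : R) : 0 < y -> (forall x, 0 <= x <= 1 -> Cmod (f (x, y)) <= M) ->
  Cmod (fcoef f n) <= M * exp (2 * PI * IZR n * y).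
Proof.
  intros y_pos bound. rewrite <- (fcoef_at_eq n y), fcoef_at_fourier by (auto; intros; apply continuous_on_line; auto).
  rewrite Cmod_mult, Cmod_R, Rabs_pos_eq, Rmult_comm by (left; apply exp_pos).
  apply Rmult_le_compat_r; [left; apply exp_pos|]. apply Cmod_fourier_le; auto.
  intros x. apply continuous_horizontal, continuous_on_line, y_pos.
Qed.

Lemma bounded_on_line (y : R) : 0 < y -> exists M, forall x, 0 <= x <= 1 -> Cmod (f (x, y)) <= M.
Proof.
  intros y_pos. destruct (ex_RInt_ub (V := C_R_NormedModule) (fun x => f (x, y)) 0 1) as [M bound].
  - apply ex_CInt_continuous. intros x. apply continuous_horizontal, continuous_on_line, y_pos.
  - exists M. intros x x_in. rewrite <- norm_C_R. apply bound. rewrite Rmin_left, Rmax_right by lra. exact x_in.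
Qed.

Lemma is_sym_series_fcoef (z : C) : 0 < Im z -> is_sym_series (fun n => fcoef f n * qpow z n)%C (f z).
Proof.
  destruct z as [x y]. intros y_pos. simpl in y_pos.
  apply (is_sym_series_ext (fun n => Ce (RtoC (IZR n * x)) * fourier (fun x => f (x, y)) n)%C).
  { intros n. rewrite fourier_line, qpow_Ce, Ce_mult_pair by auto. ring. }
  apply (fourier_inversion (fun x => f (x, y))).
  - intros u. apply continuous_horizontal, continuous_on_line, y_pos.
  - intros u. rewrite <- (f_per (u, y)) by auto. f_equal. apply injective_projections; simpl; ring.
  - destruct (f_holo (x, y) y_pos) as [l derivative]. exists l. apply (is_derive_horizontal f), derivative.
Qed.

Lemma fcoef_all_0 : (forall n, fcoef f n = RtoC 0) -> forall z, 0 < Im z -> f z = RtoC 0.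
Proof.
  intros vanish z z_in. apply (is_sym_series_unique (fun n => fcoef f n * qpow z n)%C).
  - apply is_sym_series_fcoef, z_in.
  - replace (RtoC 0) with (RtoC 0 * f z)%C by ring.
    apply (is_sym_series_ext (fun n => RtoC 0 * (fcoef f n * qpow z n))%C).
    + intros n. rewrite vanish. ring.
    + apply is_sym_series_mult_l, is_sym_series_fcoef, z_in.
Qed.

Lemma fcoef_0_of_growth (K N : R) (n : Z) : (forall z, 1 <= Im z -> Cmod (f z) <= K * exp (N * Im z)) ->
  N + 2 * PI * IZR n < 0 -> fcoef f n = RtoC 0.
Proof.
  intros growth neg. apply Cmod_small_eq_0. intros eps eps_pos.
  set (a := - (N + 2 * PI * IZR n)). assert (a_pos : 0 < a) by (unfold a; lra).
  set (y := Rmax 1 ((Rabs K + 1) / (eps * a))).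
  assert (y_ge_1 : 1 <= y) by apply Rmax_l. assert (y_large : (Rabs K + 1) / (eps * a) <= y) by apply Rmax_r.
  eapply Rle_trans; [apply (Cmod_fcoef_le n y (K * exp (N * y))); [lra|]|].
  { intros x _. apply (growth (x, y)). exact y_ge_1. }
  rewrite Rmult_assoc, <- exp_plus. replace (N * y + 2 * PI * IZR n * y) with (- (a * y)) by (unfold a; ring).
  rewrite exp_Ropp. assert (linear := exp_ineq1_le (a * y)).
  assert (K_le := Rle_abs K). assert (K_nonneg := Rabs_pos K).
  assert (large : Rabs K + 1 <= eps * (a * y)).
  { apply Rmult_le_compat_l with (r := eps * a) in y_large; [|nra].
    replace (eps * a * ((Rabs K + 1) / (eps * a))) with (Rabs K + 1) in y_large by (field; split; lra). lra. }
  apply Rmult_le_reg_r with (exp (a * y)); [apply exp_pos|].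
  rewrite Rmult_assoc, Rinv_l by (apply Rgt_not_eq, exp_pos). nra.
Qed.

End PeriodicHolomorphic.

Lemma fcoef_lin (f g : C -> C) (c d : C) (n : Z) : holo_on_H f -> holo_on_H g ->
  fcoef (fun z => c * f z + d * g z)%C n = (c * fcoef f n + d * fcoef g n)%C.
Proof.
  intros f_holo g_holo.
  assert (cont : forall h, holo_on_H h -> forall x, continuous h (x, 1))
    by (intros; apply continuous_on_line; auto; lra).
  assert (line_cont : forall h, holo_on_H h -> forall x : R, continuous (fun x : R => h (x, 1)) x)
    by (intros; apply continuous_horizontal; auto).
  assert (scaled_cont : forall h e, holo_on_H h -> forall x : R, continuous (fun x : R => e * h (x, 1))%C x)
    by (intros; apply continuous_C_mult; [apply continuous_const|auto]).
  change (fcoef_at (fun z => c * f z + d * g z)%C 1 n = c * fcoef_at f 1 n + d * fcoef_at g 1 n)%C.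
  rewrite !fcoef_at_fourier by (auto; apply cont, holo_on_H_lin; auto).
  rewrite (fourier_plus (fun x => c * f (x, 1)) (fun x => d * g (x, 1)))%C by auto.
  rewrite (fourier_mult_l (fun x => f (x, 1))), (fourier_mult_l (fun x => g (x, 1))) by auto. ring.
Qed.

Lemma fcoef_translate (f : C -> C) (r : R) (n : Z) : holo_on_H f -> periodic_on_H f ->
  fcoef (fun z => f (z + RtoC r)%C) n = (Ce (RtoC (IZR n * r)) * fcoef f n)%C.
Proof.
  intros holo per. set (line := fun x => f (x, 1)).
  assert (line_cont : forall x, continuous f (x, 1)) by (intros; apply continuous_on_line; auto; lra).
  assert (shift : forall x y : R, ((x, y) + RtoC r)%C = (x + r, y)%R)
    by (intros; apply injective_projections; simpl; ring).
  assert (shifted_cont : forall x, continuous (fun z => f (z + RtoC r)%C) (x, 1)).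
  { intros x. apply (continuous_on_line (fun z => f (z + RtoC r)%C)); [apply holo_on_H_translate, holo|lra]. }
  change (fcoef_at (fun z => f (z + RtoC r)%C) 1 n = Ce (RtoC (IZR n * r)) * fcoef_at f 1 n)%C.
  rewrite !fcoef_at_fourier by auto.
  replace (fourier (fun x => f ((x, 1) + RtoC r)%C) n) with (fourier (fun x => line (x + r)) n)
    by (unfold fourier; apply CInt_ext; intros x _; rewrite shift; reflexivity).
  rewrite fourier_translate; [unfold line; ring|intros x; apply continuous_horizontal, line_cont|].
  intros x. unfold line. rewrite <- (per (x, 1)) by (simpl; lra). f_equal.
  apply injective_projections; simpl; ring.
Qed.

Lemma fcoef_0_of_eq_0 (f : C -> C) (n : Z) : (forall z, 0 < Im z -> f z = RtoC 0) -> fcoef f n = RtoC 0.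
Proof.
  intros vanish. change (fcoef_at f 1 n = RtoC 0). unfold fcoef_at.
  rewrite (CInt_ext _ (fun _ => RtoC 0)); [rewrite CInt_const; ring|].
  intros x _. rewrite vanish by (simpl; lra). ring.
Qed.

Lemma sum_n_head (u : nat -> C) (N : nat) : sum_n u (S N) = (u O + sum_n (fun k => u (S k)) N)%C.
Proof.
  unfold sum_n. rewrite sum_Sn_m by lia. rewrite <- sum_n_m_S. reflexivity.
Qed.

Lemma sum_n_drop (u : nat -> C) (d N : nat) : (forall k, (k < d)%nat -> u k = RtoC 0) ->
  sum_n u (d + N) = sum_n (fun k => u (d + k)%nat) N.
Proof.
  revert u. induction d as [|d IH]; intros u vanish; [reflexivity|].
  simpl. rewrite sum_n_head, vanish, Cplus_0_l by lia. apply (IH (fun k => u (S k))).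
  intros k k_lt. apply vanish. lia.
Qed.

Lemma sym_sum_window (a : Z -> C) (N : nat) :
  sym_sum a N = sum_n (fun k => a (Z.of_nat k - Z.of_nat N)%Z) (2 * N).
Proof.
  induction N as [|N IH]; [rewrite sum_O; reflexivity|].
  replace (2 * S N)%nat with (S (S (2 * N))) by lia. rewrite sum_n_head, sum_Sn, sym_sum_S, IH.
  rewrite (sum_n_ext (fun k => a (Z.of_nat (S k) - Z.of_nat (S N))%Z) (fun k => a (Z.of_nat k - Z.of_nat N)%Z))
    by (intros k; f_equal; lia).
  replace (Z.of_nat (S (S (2 * N))) - Z.of_nat (S N))%Z with (Z.of_nat (S N)) by lia.
  replace (Z.of_nat 0 - Z.of_nat (S N))%Z with (- Z.of_nat (S N))%Z by lia.
  set (s := sum_n _ _). set (up := a (Z.of_nat (S N))). set (down := a (- Z.of_nat (S N))%Z).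
  change (s + (up + down) = down + (s + up))%C. ring.
Qed.

Lemma is_series_of_is_sym_series (a : Z -> C) (l : C) (n1 : Z) : (forall n, (n < n1)%Z -> a n = RtoC 0) ->
  is_sym_series a l -> is_series (fun k => a (n1 + Z.of_nat k)%Z) l.
Proof.
  intros vanish lim.
  apply (filterlim_ext_loc (fun M => sym_sum a (Z.to_nat (Z.of_nat M + n1)))).
  - exists (2 * Z.abs_nat n1)%nat. intros M M_ge. set (N := Z.to_nat (Z.of_nat M + n1)).
    rewrite sym_sum_window. replace (2 * N)%nat with (Z.to_nat (Z.of_nat N + n1) + M)%nat by (unfold N; lia).
    rewrite sum_n_drop by (intros k k_lt; apply vanish; lia).
    apply sum_n_ext. intros k. f_equal. unfold N. lia.
  - apply filterlim_subseq with (2 := lim) (d := Z.abs_nat n1). lia.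
Qed.

Definition vanishes_below (f : C -> C) (n1 : Z) : Prop := forall n, (n < n1)%Z -> fcoef f n = RtoC 0.

Lemma eseries_cv_fcoef (f : C -> C) (n1 : Z) (y : R) : holo_on_H f -> periodic_on_H f -> 0 < y ->
  eseries_cv (fun k => fcoef f (n1 + Z.of_nat k)) (fun k => IZR (n1 + Z.of_nat k)) y.
Proof.
  intros holo per y_pos. destruct (bounded_on_line f holo (y / 2) ltac:(lra)) as [M bound].
  assert (pi_pos := PI_RGT_0).
  apply ex_series_R_le with (fun k => M * exp (- (PI * y * IZR n1)) * exp (- (PI * y)) ^ k).
  - intros k. set (n := (n1 + Z.of_nat k)%Z). split; [apply Rmult_le_pos; [apply Cmod_ge_0|left; apply exp_pos]|].
    assert (coef_le := Cmod_fcoef_le f holo per n (y / 2) M ltac:(lra) bound).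
    rewrite <- exp_mult_INR, (Rmult_assoc M), <- exp_plus.
    replace (exp (- (PI * y * IZR n1) + - (PI * y) * INR k))
      with (exp (2 * PI * IZR n * (y / 2)) * exp (- (2 * PI * IZR n * y))).
    2: { rewrite <- exp_plus. f_equal. unfold n. rewrite plus_IZR, <- INR_IZR_INZ. field. }
    rewrite <- Rmult_assoc. apply Rmult_le_compat_r; [left; apply exp_pos|exact coef_le].
  - apply ex_series_R_scal, ex_series_geom. rewrite Rabs_pos_eq by (left; apply exp_pos).
    rewrite <- exp_0. apply exp_increasing. nra.
Qed.

Lemma is_eseries_on_H_fcoef (f : C -> C) (n1 : Z) : holo_on_H f -> periodic_on_H f -> vanishes_below f n1 ->
  is_eseries_on_H f (fun k => fcoef f (n1 + Z.of_nat k)) (fun k => IZR (n1 + Z.of_nat k)).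
Proof.
  intros holo per vanish. split; [intros y; apply eseries_cv_fcoef; auto|].
  intros z z_in. symmetry. apply Cseries_unique.
  apply (is_series_ext (fun k => fcoef f (n1 + Z.of_nat k) * qpow z (n1 + Z.of_nat k))%C).
  { intros k. rewrite qpow_Ce. reflexivity. }
  apply (is_series_of_is_sym_series (fun n => fcoef f n * qpow z n)%C); [|apply is_sym_series_fcoef; auto].
  intros n n_lt. rewrite vanish by exact n_lt. ring.
Qed.

Lemma is_eseries_on_H_scale (F : C -> C) (c : nat -> C) (lam : nat -> R) (r : R) : 0 < r ->
  is_eseries_on_H F c lam -> is_eseries_on_H (fun z => F (RtoC r * z)%C) c (fun k => r * lam k).
Proof.
  intros r_pos [conv agree]. split.
  - intros y y_pos. specialize (conv (r * y) ltac:(apply Rmult_lt_0_compat; lra)).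
    apply (ex_series_ext (V := R_NormedModule)) with (2 := conv).
    intros k. f_equal. f_equal. ring.
  - intros z z_in. rewrite agree by (rewrite im_scal_l; apply Rmult_lt_0_compat; lra).
    unfold eseries, Cseries. f_equal; apply Series_ext; intros k; do 3 f_equal; rewrite RtoC_mult; ring.
Qed.

Section LeadingTerm.

Variables (F : C -> C) (c : nat -> C) (lam : nat -> R) (gap : R).
Hypotheses (series : is_eseries_on_H F c lam) (gap_pos : 0 < gap).
Hypothesis lam_gap : forall k, lam O + gap <= lam (S k).

Lemma Cmod_sub_lead_decay (y0 : R) : 0 < y0 -> exists K, 0 <= K /\ forall z, y0 <= Im z ->
  Cmod (F z - c O * Ce (RtoC (lam O) * z)) <= K * exp (- (2 * PI * (lam O + gap) * Im z)).
Proof.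
  intros y0_pos. destruct series as [conv agree].
  destruct (eseries_sub_lead_decay c lam gap y0 (conv y0 y0_pos) lam_gap) as [K [K_nonneg bound]].
  exists K. split; [exact K_nonneg|]. intros z high. assert (z_in : 0 < Im z) by lra.
  rewrite agree by exact z_in. auto.
Qed.

Lemma Cmod_eseries_decay (y0 : R) : 0 < y0 ->
  exists K, forall z, y0 <= Im z -> Cmod (F z) <= K * exp (- (2 * PI * lam O * Im z)).
Proof.
  intros y0_pos. destruct (Cmod_sub_lead_decay y0 y0_pos) as [K [K_nonneg bound]].
  exists (Cmod (c O) + K). intros z high.
  replace (F z) with (c O * Ce (RtoC (lam O) * z) + (F z - c O * Ce (RtoC (lam O) * z)))%C by ring.
  eapply Rle_trans; [apply Cmod_triangle|]. rewrite Cmod_mult, Cmod_Ce_mult, Rmult_plus_distr_r.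
  apply Rplus_le_compat_l. eapply Rle_trans; [apply bound, high|]. apply Rmult_le_compat_l; auto.
  apply exp_le. assert (pi_pos := PI_RGT_0).
  assert (nonneg : 0 <= 2 * PI * gap * Im z) by (apply Rmult_le_pos; [apply Rmult_le_pos|]; lra). lra.
Qed.

Lemma leading_coefficient_lim :
  filterlim (fun y : R => F (0, y) * RtoC (exp (2 * PI * lam O * y)))%C (Rbar_locally p_infty) (locally (c O)).
Proof.
  destruct (Cmod_sub_lead_decay 1 Rlt_0_1) as [K [K_nonneg bound]].
  apply (filterlim_Cmod (Rbar_locally p_infty)). intros eps eps_pos.
  assert (pi_pos := PI_RGT_0).
  exists (Rmax 1 (K / (eps * (2 * PI * gap)))). intros y y_gt.
  assert (y_gt_1 : 1 < y) by (eapply Rle_lt_trans; [apply Rmax_l|exact y_gt]).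
  assert (y_large : K / (eps * (2 * PI * gap)) < y) by (eapply Rle_lt_trans; [apply Rmax_r|exact y_gt]).
  specialize (bound (0, y) ltac:(simpl; lra)). simpl in bound.
  set (E := exp (2 * PI * lam O * y)). assert (E_pos : 0 < E) by apply exp_pos.
  replace (F (0, y) * RtoC E - c O)%C with ((F (0, y) - c O * Ce (RtoC (lam O) * (0, y))) * RtoC E)%C.
  2: { rewrite Ce_mult_pair, Rmult_0_r, Ce_0, exp_Ropp. fold E. rewrite RtoC_inv by lra. field.
       intros absurd. apply RtoC_inj in absurd. lra. }
  rewrite Cmod_mult, Cmod_R, (Rabs_pos_eq E) by lra.
  apply Rle_lt_trans with (K * exp (- (2 * PI * gap * y))).
  { replace (exp (- (2 * PI * gap * y))) with (exp (- (2 * PI * (lam O + gap) * y)) * E)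
      by (unfold E; rewrite <- exp_plus; f_equal; ring).
    rewrite <- Rmult_assoc. apply Rmult_le_compat_r; lra. }
  set (x := 2 * PI * gap * y). assert (linear := exp_ineq1_le x).
  assert (factor_pos : 0 < 2 * PI * gap) by (apply Rmult_lt_0_compat; lra).
  assert (x_large : K < eps * x).
  { apply Rmult_lt_compat_l with (r := eps * (2 * PI * gap)) in y_large; [|nra].
    replace (eps * (2 * PI * gap) * (K / (eps * (2 * PI * gap)))) with K in y_large by (field; lra).
    unfold x. lra. }
  rewrite exp_Ropp. apply Rmult_lt_reg_r with (exp x); [apply exp_pos|].
  rewrite Rmult_assoc, Rinv_l by (apply Rgt_not_eq, exp_pos). nra.
Qed.

End LeadingTerm.

(** * The Jacobi theta function *)

(* The enumeration 0, 1, -1, 2, -2, ... of the integers. *)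
Definition enum_Z (k : nat) : Z := if Nat.even k then (- Z.of_nat (Nat.div2 k))%Z else Z.of_nat (S (Nat.div2 k)).

Lemma enum_Z_even (j : nat) : enum_Z (2 * j) = (- Z.of_nat j)%Z.
Proof. unfold enum_Z. rewrite Nat.even_mul, Nat.div2_double. reflexivity. Qed.

Lemma enum_Z_odd (j : nat) : enum_Z (2 * j + 1) = Z.of_nat (S j).
Proof.
  unfold enum_Z. rewrite Nat.even_odd. replace (2 * j + 1)%nat with (S (2 * j)) by lia.
  rewrite Nat.div2_succ_double. reflexivity.
Qed.

Lemma abs_enum_Z_ge (k : nat) : (Z.of_nat k <= 2 * Z.abs (enum_Z k))%Z.
Proof.
  destruct (Nat.Even_or_Odd k) as [[j ->]|[j ->]]; [rewrite enum_Z_even|rewrite enum_Z_odd]; lia.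
Qed.

Lemma sum_n_enum_Z (a : Z -> C) (N : nat) : sum_n (fun k => a (enum_Z k)) (2 * N) = sym_sum a N.
Proof.
  induction N as [|N IH]; [apply (sum_O (fun k => a (enum_Z k)))|]. replace (2 * S N)%nat with (S (2 * N + 1)) by lia.
  rewrite sum_Sn. replace (2 * N + 1)%nat with (S (2 * N)) at 1 by lia. rewrite sum_Sn, IH, sym_sum_S.
  replace (S (2 * N)) with (2 * N + 1)%nat by lia. replace (S (2 * N + 1)) with (2 * S N)%nat by lia.
  rewrite enum_Z_odd, enum_Z_even. symmetry. apply Cplus_assoc.
Qed.

Lemma is_sym_series_enum_Z (a : Z -> C) (l : C) : is_series (fun k => a (enum_Z k)) l -> is_sym_series a l.
Proof.
  intros lim. apply (filterlim_ext _ _ (sum_n_enum_Z a)).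
  apply filterlim_subseq with (2 := lim) (d := O). lia.
Qed.

Lemma is_series_C_term_lim (u : nat -> C) (l : C) : is_series u l -> filterlim u eventually (locally (RtoC 0)).
Proof.
  intros lim. apply (filterlim_ext_loc (fun k => sum_n u k - sum_n u (pred k))%C).
  - exists 1%nat. intros k k_pos. destruct k as [|k]; [lia|]. simpl. rewrite sum_Sn.
    change (sum_n u k + u (S k) - sum_n u k = u (S k))%C. ring.
  - rewrite <- (Cminus_diag l). apply (filterlim_C_minus eventually); [exact lim|].
    apply filterlim_subseq with (2 := lim) (d := 1%nat). lia.
Qed.

Lemma sym_sum_succ (a : Z -> C) (N : nat) :
  sym_sum (fun n => a (n + 1)%Z) N = (sym_sum a N + (a (Z.of_nat (S N)) - a (- Z.of_nat N)%Z))%C.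
Proof.
  induction N as [|N IH]; [simpl; ring|]. rewrite !sym_sum_S, IH.
  replace (Z.of_nat (S N) + 1)%Z with (Z.of_nat (S (S N))) by lia.
  replace (- Z.of_nat (S N) + 1)%Z with (- Z.of_nat N)%Z by lia. ring.
Qed.

Lemma is_sym_series_succ (a : Z -> C) (l : C) : is_series (fun k => a (enum_Z k)) l ->
  is_sym_series (fun n => a (n + 1)%Z) l.
Proof.
  intros lim. apply (filterlim_ext (fun N => sym_sum a N + (a (Z.of_nat (S N)) - a (- Z.of_nat N)%Z))%C).
  { intros N. symmetry. apply sym_sum_succ. }
  replace l with (l + (RtoC 0 - RtoC 0))%C by ring.
  apply (filterlim_C_plus eventually); [apply is_sym_series_enum_Z, lim|].
  assert (term_lim := is_series_C_term_lim _ _ lim). apply (filterlim_C_minus eventually).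
  - apply (filterlim_ext (fun N => a (enum_Z (2 * N + 1)))); [intros N; rewrite enum_Z_odd; reflexivity|].
    apply filterlim_subseq with (2 := term_lim) (d := O). lia.
  - apply (filterlim_ext (fun N => a (enum_Z (2 * N)))); [intros N; rewrite enum_Z_even; reflexivity|].
    apply filterlim_subseq with (2 := term_lim) (d := O). lia.
Qed.

Definition jacobi_term (tau z : C) (n : Z) : C := Ce (RtoC (IZR (n * n)) * tau + RtoC (IZR n) * z).

Definition jacobi_coef (tau : C) (k : nat) : C := Ce (RtoC (IZR (enum_Z k * enum_Z k)) * tau).

Definition jacobi (tau z : C) : C := eseries (jacobi_coef tau) (fun k => IZR (enum_Z k)) z.

Section Jacobi.

Variable tau : C.
Hypothesis tau_in : 0 < Im tau.

Lemma eseries_cv_jacobi (y : R) : eseries_cv (jacobi_coef tau) (fun k => IZR (enum_Z k)) y.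
Proof.
  set (v := Im tau). assert (v_pos : 0 < v) by exact tau_in. assert (pi_pos := PI_RGT_0).
  set (K := (Rabs y + 1) * (Rabs y + 1) / (4 * v)).
  apply ex_series_R_le with (fun k => exp (2 * PI * K) * exp (- PI) ^ k).
  - intros k. split; [apply Rmult_le_pos; [apply Cmod_ge_0|left; apply exp_pos]|].
    unfold jacobi_coef. rewrite Cmod_Ce_mult. fold v. rewrite <- exp_mult_INR, <- !exp_plus. apply exp_le.
    set (n := enum_Z k). rewrite mult_IZR. assert (size : INR k <= 2 * Rabs (IZR n)).
    { rewrite INR_IZR_INZ, <- abs_IZR, <- mult_IZR. apply IZR_le, abs_enum_Z_ge. }
    assert (square : IZR n * IZR n = Rabs (IZR n) * Rabs (IZR n))
      by (symmetry; rewrite <- Rabs_mult; apply Rabs_pos_eq, Rle_0_sqr).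
    assert (cross : - (IZR n * y) <= Rabs (IZR n) * Rabs y) by (rewrite <- Rabs_mult, <- Rabs_Ropp; apply Rle_abs).
    set (x := Rabs (IZR n)) in *. set (b := Rabs y + 1) in *.
    (* The exponent is completed to a square: v n^2 - (|y| + 1) |n| >= - (|y| + 1)^2 / (4 v). *)
    assert (complete : b * x <= v * (x * x) + K).
    { assert (square_nonneg : 0 <= (v * x - b / 2) * (v * x - b / 2) / v).
      { apply Rmult_le_pos; [apply Rle_0_sqr|]. left. apply Rinv_0_lt_compat, v_pos. }
      replace ((v * x - b / 2) * (v * x - b / 2) / v) with (v * (x * x) + K - b * x) in square_nonneg
        by (unfold K; field; lra). lra. }
    rewrite square. unfold b in complete. nra.
  - apply ex_series_R_scal, ex_series_geom. rewrite Rabs_pos_eq by (left; apply exp_pos).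
    rewrite <- exp_0. apply exp_increasing. lra.
Qed.

Lemma is_series_jacobi (z : C) : is_series (fun k => jacobi_term tau z (enum_Z k)) (jacobi tau z).
Proof.
  apply (is_series_ext (fun k => jacobi_coef tau k * Ce (RtoC (IZR (enum_Z k)) * z))%C).
  - intros k. symmetry. apply Ce_plus.
  - apply is_series_eseries, eseries_cv_jacobi.
Qed.

Lemma is_sym_series_jacobi (z : C) : is_sym_series (jacobi_term tau z) (jacobi tau z).
Proof. apply is_sym_series_enum_Z, is_series_jacobi. Qed.

Lemma jacobi_unique (z l : C) : is_sym_series (jacobi_term tau z) l -> jacobi tau z = l.
Proof. apply is_sym_series_unique, is_sym_series_jacobi. Qed.

Lemma ex_derive_jacobi (z : C) : ex_derive (jacobi tau) z.
Proof. eexists. apply (is_derive_eseries _ _ z 1 Rlt_0_1); apply eseries_cv_jacobi. Qed.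

Lemma jacobi_add_Z (z : C) (k : Z) : jacobi tau (z + RtoC (IZR k)) = jacobi tau z.
Proof.
  apply jacobi_unique. apply (is_sym_series_ext (jacobi_term tau z)); [|apply is_sym_series_jacobi].
  intros n. unfold jacobi_term.
  replace (RtoC (IZR (n * n)) * tau + RtoC (IZR n) * (z + RtoC (IZR k)))%C
    with (RtoC (IZR (n * n)) * tau + RtoC (IZR n) * z + RtoC (IZR (n * k)))%C
    by (rewrite (mult_IZR n k), RtoC_mult; ring).
  rewrite (Ce_plus _ (RtoC (IZR (n * k)))), Ce_Z. ring.
Qed.

Lemma jacobi_add_2_tau (z : C) : jacobi tau (z + RtoC 2 * tau) = (Ce (- z - tau) * jacobi tau z)%C.
Proof.
  apply jacobi_unique.
  apply (is_sym_series_ext (fun n => Ce (- z - tau) * jacobi_term tau z (n + 1))%C).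
  - intros n. unfold jacobi_term. rewrite <- Ce_plus. f_equal.
    rewrite !mult_IZR, !RtoC_mult, plus_IZR, RtoC_plus. ring.
  - apply is_sym_series_mult_l. apply is_sym_series_succ with (1 := is_series_jacobi z).
Qed.

Section Uniqueness.

Variable F : C -> C.
Hypothesis F_entire : forall z, ex_derive F z.
Hypothesis F_period : forall z, F (z + RtoC 1)%C = F z.
Hypothesis F_quasi_period : forall z, F (z + RtoC 2 * tau)%C = (Ce (- z - tau) * F z)%C.

Let coef (n : Z) : C := fourier (fun x => F (RtoC x)) n.

Lemma continuous_horizontal_line (y x : R) : continuous (fun x : R => F (x, y)) x.
Proof. apply continuous_horizontal, ex_derive_C_continuous, F_entire. Qed.

Lemma periodic_horizontal_line (y x : R) : F (x + 1, y) = F (x, y).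
Proof. rewrite <- (F_period (x, y)). f_equal. apply injective_projections; simpl; ring. Qed.

(* The two ends of the strip [0 <= Im z <= 2 Im tau] have the same Fourier coefficients up to the
   factor of the quasi-period. *)
Lemma theta_like_coef_succ (n : Z) : coef (n + 1) = (Ce (RtoC (IZR (2 * n + 1)) * tau) * coef n)%C.
Proof.
  set (u := Re tau). set (v := Im tau). set (top := fun x : R => F (x, 2 * v)).
  assert (bottom_top : coef n = (RtoC (exp (2 * PI * IZR n * (2 * v))) * fourier top n)%C).
  { unfold top. rewrite <- (fcoef_at_fourier F (2 * v) n) by (intros; apply ex_derive_C_continuous, F_entire).
    rewrite <- (fcoef_at_height F n 0 (2 * v)); [|unfold v; lra|intros; apply F_entire|intros; apply F_period].
    rewrite fcoef_at_fourier by (intros; apply ex_derive_C_continuous, F_entire).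
    rewrite Rmult_0_r, exp_0. unfold coef. symmetry. apply Cmult_1_l. }
  assert (top_eq : fourier top n = (Ce (RtoC (2 * u) - tau) * (Ce (RtoC (IZR (n + 1) * - (2 * u))) * coef (n + 1)))%C).
  { replace n with (n + 1 - 1)%Z at 1 by lia. rewrite <- fourier_mult_Ce. unfold coef.
    rewrite <- fourier_translate;
      [|intros; apply (continuous_horizontal_line 0)|intros; apply (periodic_horizontal_line 0)].
    rewrite <- fourier_mult_l
      by (intros; apply (continuous_translate (fun x => F (RtoC x))), (continuous_horizontal_line 0)).
    unfold fourier. apply CInt_ext. intros x _. f_equal.
    assert (quasi := F_quasi_period (RtoC (x + - (2 * u)))).
    replace (RtoC (x + - (2 * u)) + RtoC 2 * tau)%C with ((x, 2 * v)%R : C) in quasi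
      by (apply injective_projections; unfold u, v, Re, Im; simpl; ring).
    unfold top. rewrite quasi, Cmult_assoc, <- Ce_plus. f_equal. f_equal.
    rewrite RtoC_plus, RtoC_opp. ring. }
  rewrite bottom_top, top_eq.
  assert (phase : (Ce (RtoC (IZR (2 * n + 1)) * tau) * RtoC (exp (2 * PI * IZR n * (2 * v))) *
                   Ce (RtoC (2 * u) - tau) * Ce (RtoC (IZR (n + 1) * - (2 * u))))%C = RtoC 1).
  { assert (pair := Ce_mult_pair (- IZR n) (2 * u) (2 * v)).
    replace (- (2 * PI * - IZR n * (2 * v))) with (2 * PI * IZR n * (2 * v)) in pair by ring.
    replace (Ce (RtoC (IZR (n + 1) * - (2 * u)))) with (Ce (RtoC (- IZR n * (2 * u))) * Ce (- RtoC (2 * u)))%C.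
    2: { rewrite <- Ce_plus, plus_IZR. f_equal. apply injective_projections; simpl; ring. }
    transitivity (Ce (RtoC (IZR (2 * n + 1)) * tau) * Ce (RtoC (- IZR n) * (2 * u, 2 * v)%R) *
                  Ce (RtoC (2 * u) - tau) * Ce (- RtoC (2 * u)))%C; [rewrite pair; ring|].
    rewrite <- !Ce_plus, <- Ce_0. f_equal. rewrite plus_IZR, mult_IZR.
    apply injective_projections; unfold u, v, Re, Im; simpl; ring. }
  transitivity (RtoC 1 * coef (n + 1))%C; [ring|]. rewrite <- phase. ring.
Qed.

Lemma theta_like_coef (n : Z) : coef n = (Ce (RtoC (IZR (n * n)) * tau) * coef 0)%C.
Proof.
  assert (step : forall k : Z, ((k + 1) * (k + 1) = 2 * k + 1 + k * k)%Z) by (intros; ring).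
  revert n. apply Z.bi_induction.
  - intros n n' ->. reflexivity.
  - rewrite Cmult_0_l, Ce_0. ring.
  - intros n. unfold Z.succ.
    rewrite theta_like_coef_succ, step, (plus_IZR (2 * n + 1)), RtoC_plus, Cmult_plus_distr_r, Ce_plus.
    rewrite <- Cmult_assoc. split; [intros ->; reflexivity|]. apply Cmult_reg_l, Ce_neq_0.
Qed.

Theorem theta_like_unique (x : R) : F (RtoC x) = (coef 0 * jacobi tau (RtoC x))%C.
Proof.
  apply (is_sym_series_unique (fun n => Ce (RtoC (IZR n * x)) * coef n)%C).
  - apply (fourier_inversion (fun x => F (RtoC x))).
    + apply (continuous_horizontal_line 0).
    + apply (periodic_horizontal_line 0).
    + destruct (F_entire (RtoC x)) as [l derivative]. exists l. apply (is_derive_horizontal F x 0), derivative.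
  - apply (is_sym_series_ext (fun n => coef 0 * jacobi_term tau (RtoC x) n)%C).
    + intros n. rewrite (theta_like_coef n). unfold jacobi_term. rewrite Ce_plus, RtoC_mult. ring.
    + apply is_sym_series_mult_l, is_sym_series_jacobi.
Qed.

End Uniqueness.

End Jacobi.

(** * The theta constants *)

Definition theta_coef (k : nat) : C := if k then RtoC 1 else RtoC 2.

Lemma is_sym_series_even (a : Z -> C) (l : C) : (forall n, a (- n)%Z = a n) ->
  is_series (fun k => theta_coef k * a (Z.of_nat k))%C l -> is_sym_series a l.
Proof.
  intros even. apply filterlim_ext. induction x as [|N IH]; [rewrite sum_O; simpl; ring|].
  rewrite sum_Sn, IH, sym_sum_S, even.
  change (sym_sum a N + RtoC 2 * a (Z.of_nat (S N)) = sym_sum a N + (a (Z.of_nat (S N)) + a (Z.of_nat (S N))))%C.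
  ring.
Qed.

Lemma is_sym_series_half_even (a : Z -> C) (l : C) : (forall n, a (- n - 1)%Z = a n) ->
  is_series (fun k => RtoC 2 * a (Z.of_nat k))%C l -> is_sym_series a l.
Proof.
  intros even lim.
  assert (term_lim := is_series_C_term_lim _ _ (is_series_C_mult_l (/ RtoC 2) _ _ lim)).
  apply (filterlim_ext (fun N => sum_n (fun k => RtoC 2 * a (Z.of_nat k)) N
                                 - / RtoC 2 * (RtoC 2 * a (Z.of_nat N)))%C).
  - assert (two_nz : RtoC 2 <> RtoC 0) by (intros absurd; apply RtoC_inj in absurd; lra).
    intros N. replace (/ RtoC 2 * (RtoC 2 * a (Z.of_nat N)))%C with (a (Z.of_nat N)) by (field; exact two_nz).
    induction N as [|N IH]; [rewrite sum_O; simpl; ring|].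
    rewrite sum_Sn, sym_sum_S, <- IH, <- (even (- Z.of_nat (S N))%Z).
    replace (- - Z.of_nat (S N) - 1)%Z with (Z.of_nat N) by lia.
    set (s := sum_n _ N). set (next := a (Z.of_nat (S N))). set (last := a (Z.of_nat N)).
    change (s + RtoC 2 * next - next = s - last + (next + last))%C. ring.
  - replace l with (l - RtoC 0)%C by ring. apply (filterlim_C_minus eventually); [exact lim|exact term_lim].
Qed.

(* q^(1/4) times the sum of q^(n(n+1)) over the integers n: the odd-square part of [theta (z / 4)]. *)
Definition theta_half (z : C) : C := eseries (fun _ => RtoC 2) (fun k => (INR k + / 2) * (INR k + / 2)) z.

Lemma exp_le_pow (r y : R) (n : nat) : 0 <= y -> INR n <= r -> exp (- (2 * PI * r * y)) <= exp (- (2 * PI * y)) ^ n.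
Proof.
  intros y_nonneg n_le. rewrite <- exp_mult_INR. apply exp_le. assert (pi_pos := PI_RGT_0).
  assert (nonneg : 0 <= 2 * PI * y) by (apply Rmult_le_pos; lra). nra.
Qed.

Lemma nome_lt_1 (y : R) : 0 < y -> 0 <= exp (- (2 * PI * y)) < 1.
Proof.
  intros y_pos. split; [left; apply exp_pos|]. assert (pi_pos := PI_RGT_0).
  rewrite <- exp_0. apply exp_increasing. nra.
Qed.

Lemma theta_dominated (y : R) (k : nat) : 0 <= y ->
  Cmod (theta_coef (S k)) * exp (- (2 * PI * (INR (S k) * INR (S k) - INR 0 * INR 0) * y)) <=
  2 * exp (- (2 * PI * y)) * exp (- (2 * PI * y)) ^ k.
Proof.
  intros y_nonneg. simpl theta_coef. rewrite Cmod_R, Rabs_pos_eq, (Rmult_assoc 2 (exp _)) by lra.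
  apply Rmult_le_compat_l; [lra|]. apply (exp_le_pow _ y (S k) y_nonneg).
  assert (k_nonneg := pos_INR k). rewrite !S_INR. simpl. nra.
Qed.

Lemma theta_half_dominated (y : R) (k : nat) : 0 <= y ->
  Cmod (RtoC 2) * exp (- (2 * PI * ((INR (S k) + / 2) * (INR (S k) + / 2) - (INR 0 + / 2) * (INR 0 + / 2)) * y)) <=
  2 * exp (- (2 * PI * y)) ^ 2 * exp (- (2 * PI * y)) ^ k.
Proof.
  intros y_nonneg. rewrite Cmod_R, Rabs_pos_eq, (Rmult_assoc 2 (exp _ ^ 2)), <- pow_add by lra.
  apply Rmult_le_compat_l; [lra|]. apply exp_le_pow; [exact y_nonneg|].
  assert (k_nonneg := pos_INR k). rewrite plus_INR, !S_INR. simpl. nra.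
Qed.

Lemma theta_series : is_eseries_on_H theta theta_coef (fun k => INR k * INR k).
Proof.
  assert (conv : forall y, 0 < y -> eseries_cv theta_coef (fun k => INR k * INR k) y).
  { intros y y_pos. apply eseries_cv_geometric with (2 := fun k => theta_dominated y k (Rlt_le _ _ y_pos)).
    apply nome_lt_1, y_pos. }
  split; [exact conv|]. intros z z_in.
  assert (lim := is_series_eseries _ _ z (conv (Im z) z_in)). set (l := eseries _ _ z) in *.
  assert (tail := is_series_C_mult_l (/ RtoC 2) _ _ (is_series_C_incr_1 _ _ lim)).
  assert (tail_sum : Cseries (fun k => qpow z (Z.of_nat (S k) * Z.of_nat (S k))) = (/ RtoC 2 * (l - RtoC 1))%C).
  { apply Cseries_unique. replace (RtoC 1) with (theta_coef 0 * Ce (RtoC (INR 0 * INR 0) * z))%C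
      by (simpl; rewrite Rmult_0_l, Cmult_0_l, Ce_0; ring).
    apply is_series_ext with (2 := tail). intros k.
    assert (two_nz : RtoC 2 <> RtoC 0) by (intros absurd; apply RtoC_inj in absurd; lra).
    rewrite qpow_Ce, mult_IZR, <- !INR_IZR_INZ. simpl theta_coef. rewrite Cmult_assoc, Cinv_l by exact two_nz.
    apply Cmult_1_l. }
  assert (theta_eq : theta z = (RtoC 1 + RtoC 2 * (/ RtoC 2 * (l - RtoC 1)))%C).
  { rewrite <- tail_sum. apply injective_projections; simpl; ring. }
  rewrite theta_eq. field.
Qed.

Lemma theta_half_series : is_eseries_on_H theta_half (fun _ => RtoC 2) (fun k => (INR k + / 2) * (INR k + / 2)).
Proof.
  split; [|reflexivity]. intros y y_pos.
  apply eseries_cv_geometric with (2 := fun k => theta_half_dominated y k (Rlt_le _ _ y_pos)).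
  apply nome_lt_1, y_pos.
Qed.

Lemma is_series_theta (z : C) : 0 < Im z ->
  is_series (fun k => theta_coef k * Ce (RtoC (INR k * INR k) * z))%C (theta z).
Proof.
  intros z_in. destruct theta_series as [conv agree]. rewrite agree by exact z_in.
  apply is_series_eseries, conv, z_in.
Qed.

Lemma is_series_theta_half (z : C) : 0 < Im z ->
  is_series (fun k => RtoC 2 * Ce (RtoC ((INR k + / 2) * (INR k + / 2)) * z))%C (theta_half z).
Proof. intros z_in. apply is_series_eseries, theta_half_series, z_in. Qed.

Lemma holo_theta : holo_on_H theta.
Proof. exact (holo_eseries_on_H _ _ _ theta_series). Qed.

Lemma holo_theta_half : holo_on_H theta_half.
Proof. exact (holo_eseries_on_H _ _ _ theta_half_series). Qed.

Lemma theta_translate (z : C) : 0 < Im z -> theta (z + RtoC 1) = theta z.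
Proof.
  intros z_in. apply is_series_C_unique with (2 := is_series_theta z z_in).
  apply is_series_ext with (2 := is_series_theta (z + RtoC 1) ltac:(rewrite Im_translate; exact z_in)).
  intros k. f_equal. rewrite Cmult_plus_distr_l, Ce_plus, Cmult_1_r, !INR_IZR_INZ, <- mult_IZR, Ce_Z. ring.
Qed.

Lemma theta_half_translate (z : C) : 0 < Im z -> theta_half (z + RtoC 1) = (Ci * theta_half z)%C.
Proof.
  intros z_in. apply is_series_C_unique with (2 := is_series_C_mult_l Ci _ _ (is_series_theta_half z z_in)).
  apply is_series_ext with (2 := is_series_theta_half (z + RtoC 1) ltac:(rewrite Im_translate; exact z_in)).
  assert (term : forall k, (RtoC 2 * Ce (RtoC ((INR k + / 2) * (INR k + / 2)) * (z + RtoC 1))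
                            = Ci * (RtoC 2 * Ce (RtoC ((INR k + / 2) * (INR k + / 2)) * z)))%C); [|exact term].
  intros k. rewrite Cmult_plus_distr_l, Ce_plus, Cmult_1_r, Cmult_assoc, (Cmult_comm Ci). f_equal.
  replace ((INR k + / 2) * (INR k + / 2)) with (IZR (Z.of_nat k * Z.of_nat k + Z.of_nat k) + / 4)
    by (rewrite plus_IZR, mult_IZR, <- !INR_IZR_INZ; field).
  rewrite (RtoC_plus _ (/ 4)), (Ce_plus (RtoC (IZR _))), Ce_Z, Ce_quarter. ring.
Qed.

(* Splitting the summation index of [theta (z / 4)] according to its parity; the twist by the
   character [exp (2 pi i x n)], with 2x an integer, gives the odd part a sign. *)
Lemma jacobi_quarter (z : C) (x : R) : 0 < Im z -> Ce (RtoC (2 * x)) = RtoC 1 ->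
  jacobi (RtoC (/ 4) * z) (RtoC x) = (theta z + Ce (RtoC x) * theta_half z)%C.
Proof.
  intros z_in trivial. assert (quarter_in : 0 < Im (RtoC (/ 4) * z)) by (rewrite im_scal_l; lra).
  assert (trivial_Z : forall n, Ce (RtoC (IZR n * (2 * x))) = RtoC 1).
  { intros n. destruct (Ce_R_eq_1 _ trivial) as [m ->]. rewrite <- mult_IZR. apply Ce_Z. }
  set (a := jacobi_term (RtoC (/ 4) * z) (RtoC x)).
  assert (a_even : forall n, a (- n)%Z = a n).
  { intros n. unfold a, jacobi_term. rewrite Z.mul_opp_opp, !Ce_plus. f_equal.
    rewrite <- (Cmult_1_r (Ce (RtoC (IZR (- n)) * RtoC x))), <- (trivial_Z n), <- Ce_plus. f_equal.
    rewrite opp_IZR. apply injective_projections; simpl; ring. }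
  destruct (ex_series_C_abs (fun k => theta_coef k * a (Z.of_nat k))%C) as [l lim].
  { destruct theta_series as [conv _]. apply (ex_series_ext (V := R_NormedModule)) with (2 := conv _ quarter_in).
    intros k. unfold a, jacobi_term. rewrite Ce_plus, !Cmod_mult, Cmod_Ce_mult, <- RtoC_mult, Cmod_Ce_R, Rmult_1_r.
    rewrite mult_IZR, <- INR_IZR_INZ. reflexivity. }
  rewrite (jacobi_unique _ quarter_in _ l) by (apply is_sym_series_even; auto).
  apply (is_series_C_even_odd _ _ _ _ lim).
  - apply is_series_ext with (2 := is_series_theta z z_in). intros k. f_equal; [destruct k; reflexivity|].
    unfold a, jacobi_term. rewrite Ce_plus, mult_IZR, <- INR_IZR_INZ, mult_INR.
    transitivity (Ce (RtoC (INR k * INR k) * z) * Ce (RtoC (IZR (Z.of_nat k) * (2 * x))))%C;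
      [rewrite trivial_Z; ring|]. rewrite <- INR_IZR_INZ. f_equal; f_equal; apply injective_projections; simpl; field.
  - apply is_series_ext with (2 := is_series_C_mult_l (Ce (RtoC x)) _ _ (is_series_theta_half z z_in)).
    intros k. apply (@eq_sym C). replace (2 * k + 1)%nat with (S (2 * k)) by lia. simpl theta_coef.
    unfold a, jacobi_term. rewrite Ce_plus, mult_IZR, <- INR_IZR_INZ, S_INR, mult_INR.
    transitivity (RtoC 2 * Ce (RtoC ((INR k + / 2) * (INR k + / 2)) * z)
                  * (Ce (RtoC (IZR (Z.of_nat k) * (2 * x))) * Ce (RtoC x)))%C; [|rewrite trivial_Z; ring].
    rewrite <- !Ce_plus, <- Cmult_assoc, <- Ce_plus, <- INR_IZR_INZ.
    f_equal; f_equal; apply injective_projections; simpl; field.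
Qed.

Lemma jacobi_0 (z : C) : 0 < Im z -> jacobi z (RtoC 0) = theta z.
Proof.
  intros z_in. apply jacobi_unique; [exact z_in|]. apply is_sym_series_even.
  - intros n. unfold jacobi_term. rewrite Z.mul_opp_opp. f_equal. ring.
  - apply is_series_ext with (2 := is_series_theta z z_in). intros k. unfold jacobi_term.
    rewrite mult_IZR, <- INR_IZR_INZ, Cmult_0_r, Cplus_0_r. reflexivity.
Qed.

Lemma jacobi_diag (z : C) : 0 < Im z -> (Ce (RtoC (/ 4) * z) * jacobi z z)%C = theta_half z.
Proof.
  intros z_in. apply (is_sym_series_unique (fun n => Ce (RtoC (/ 4) * z) * jacobi_term z z n)%C).
  - apply is_sym_series_mult_l, is_sym_series_jacobi, z_in.
  - assert (square : forall n, (Ce (RtoC (/ 4) * z) * jacobi_term z z n)%C =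
                               Ce (RtoC ((IZR n + / 2) * (IZR n + / 2)) * z)).
    { intros n. unfold jacobi_term. rewrite <- Ce_plus, mult_IZR. f_equal. apply injective_projections; simpl; field. }
    apply is_sym_series_half_even.
    + intros n. rewrite !square. do 3 f_equal. rewrite minus_IZR, opp_IZR. field.
    + apply is_series_ext with (2 := is_series_theta_half z z_in). intros k.
      rewrite square, <- INR_IZR_INZ. reflexivity.
Qed.

(** * The inversion of the upper half plane *)

Lemma H_neq_0 (z : C) : 0 < Im z -> z <> RtoC 0.
Proof. intros z_in ->. simpl in z_in. lra. Qed.

Lemma Im_opp_inv (z : C) : z <> RtoC 0 -> Im (- / z) = Im z / Cmod z ^ 2.
Proof.
  intros nz. assert (pos := proj1 (Cmod_gt_0 z) nz). replace (Cmod z ^ 2) with (Cmod z * Cmod z) by ring.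
  assert (sqr := Cmod_sqr z). rewrite sqr. destruct z as [x y]. simpl in *. field. nra.
Qed.

Lemma Im_opp_inv_pos (z : C) : 0 < Im z -> 0 < Im (- / z).
Proof.
  intros z_in. assert (nz := H_neq_0 z z_in). rewrite Im_opp_inv by exact nz.
  apply Rdiv_lt_0_compat; [exact z_in|]. apply pow_lt, Cmod_gt_0, nz.
Qed.

Lemma is_derive_opp_inv (z : C) : z <> RtoC 0 -> is_derive (fun w => - / w)%C z (/ (z * z))%C.
Proof.
  intros nz. apply (is_derive_C_ext (fun w => RtoC (-1) * / w)%C); [intros w; ring|].
  apply is_derive_C_val with (RtoC (-1) * - / (z * z))%C; [|ring].
  apply is_derive_C_scal, is_derive_C_inv, nz.
Qed.

Lemma holo_opp_inv : holo_on_H (fun z => - / z)%C.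
Proof. intros z z_in. eexists. apply is_derive_opp_inv, H_neq_0, z_in. Qed.

Lemma translation_invariant_Z (P : C -> Prop) : (forall z, 0 < Im z -> (P (z + RtoC 1)%C <-> P z)) ->
  forall (k : Z) (z : C), 0 < Im z -> (P (z + RtoC (IZR k))%C <-> P z).
Proof.
  intros invariant k. apply (Z.bi_induction (fun k => forall z, 0 < Im z -> (P (z + RtoC (IZR k))%C <-> P z))).
  - intros n n' ->. reflexivity.
  - intros z _. rewrite Cplus_0_r. reflexivity.
  - intros n. unfold Z.succ. split; intros IH z z_in; rewrite <- (IH z z_in), plus_IZR, RtoC_plus, Cplus_assoc;
      [|symmetry]; apply invariant; rewrite Im_translate; exact z_in.
Qed.

Lemma translate_to_strip (z : C) : exists k : Z, - / 2 <= Re (z + RtoC (IZR k)) <= / 2.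
Proof.
  exists (- up (Re z - / 2))%Z. destruct (archimed (Re z - / 2)). rewrite re_plus, opp_IZR. simpl. lra.
Qed.

Lemma Im_opp_inv_ge (z : C) : 0 < Im z <= 3 / 4 -> - / 2 <= Re z <= / 2 -> 16 / 13 * Im z <= Im (- / z).
Proof.
  intros z_in strip. rewrite Im_opp_inv by (apply H_neq_0; lra).
  replace (Cmod z ^ 2) with (Cmod z * Cmod z) by ring. rewrite Cmod_sqr.
  assert (small : 0 < Re z * Re z + Im z * Im z <= 13 / 16) by nra.
  apply Rmult_le_reg_r with (Re z * Re z + Im z * Im z); [lra|].
  replace (Im z / _ * _) with (Im z) by (field; lra). nra.
Qed.

(* Below the line [Im z = 3/4], a translation into the strip [|Re z| <= 1/2] followed by the
   inversion multiplies the height by at least [16/13]. *)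
Lemma upper_half_ind (P : C -> Prop) :
  (forall z, 0 < Im z -> (P (z + RtoC 1)%C <-> P z)) -> (forall z, 0 < Im z -> P (- / z)%C -> P z) ->
  (forall z, 3 / 4 <= Im z -> P z) -> forall z, 0 < Im z -> P z.
Proof.
  intros translation inversion high.
  assert (level : forall n z, 3 / 4 * (13 / 16) ^ n <= Im z -> P z).
  { induction n as [|n IH]; intros z z_ge; [apply high; simpl in z_ge; lra|].
    assert (pow_pos : 0 < (13 / 16) ^ n) by (apply pow_lt; lra). simpl in z_ge.
    destruct (translate_to_strip z) as [k strip].
    rewrite <- (translation_invariant_Z P translation k) by lra.
    assert (height := Im_translate z (IZR k)). set (w := (z + RtoC (IZR k))%C) in *.
    destruct (Rle_lt_dec (3 / 4) (Im w)); [apply high; auto|].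
    apply inversion; [lra|]. apply IH. apply Rle_trans with (16 / 13 * Im w); [lra|].
    apply Im_opp_inv_ge; [lra|exact strip]. }
  intros z z_in. destruct (pow_lt_1_zero (13 / 16) ltac:(rewrite Rabs_pos_eq; lra) (Im z) z_in) as [n small].
  specialize (small n (le_n n)). assert (pow_pos : 0 < (13 / 16) ^ n) by (apply pow_lt; lra).
  rewrite Rabs_pos_eq in small by lra. apply (level n). lra.
Qed.

Lemma upper_half_neq_0 (f : C -> C) (a : C) (r : C -> C) : a <> RtoC 0 ->
  (forall z, 0 < Im z -> f (z + RtoC 1)%C = (a * f z)%C) -> (forall z, 0 < Im z -> f (- / z)%C = (r z * f z)%C) ->
  (forall z, 3 / 4 <= Im z -> f z <> RtoC 0) -> forall z, 0 < Im z -> f z <> RtoC 0.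
Proof.
  intros a_nz translation inversion high. apply upper_half_ind; [| |exact high].
  - intros z z_in. rewrite translation by exact z_in. split; intros nz; [|apply Cmult_neq_0; auto].
    intros vanish. apply nz. rewrite vanish. ring.
  - intros z z_in nz vanish. apply nz. rewrite inversion, vanish by exact z_in. ring.
Qed.

(** * Modular transformation of the theta constants *)

(* For [s = -1/z], the function [exp (2 pi i s w^2) jacobi s (2 s w)] has the periods of
   [jacobi (z/4)], hence is a multiple of it on the real line. *)
Definition theta_multiplier (z : C) : C :=
  fourier (fun x => Ce (- / z * (RtoC x * RtoC x)) * jacobi (- / z) (RtoC 2 * - / z * RtoC x))%C 0.

Lemma jacobi_inversion (z : C) (x : R) : 0 < Im z ->
  (Ce (- / z * (RtoC x * RtoC x)) * jacobi (- / z) (RtoC 2 * - / z * RtoC x))%C =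
  (theta_multiplier z * jacobi (RtoC (/ 4) * z) (RtoC x))%C.
Proof.
  intros z_in. assert (s_in := Im_opp_inv_pos z z_in). set (s := (- / z)%C) in *.
  assert (sz : (s * z)%C = RtoC (-1)) by (unfold s; field; apply H_neq_0, z_in).
  assert (quarter_in : 0 < Im (RtoC (/ 4) * z)) by (rewrite im_scal_l; lra).
  set (F := fun w => (Ce (s * (w * w)) * jacobi s (RtoC 2 * s * w))%C).
  apply (theta_like_unique (RtoC (/ 4) * z) quarter_in F).
  - intros w. apply ex_derive_C_mult.
    + apply (ex_derive_C_comp Ce); [eexists; apply is_derive_Ce|].
      eexists. apply is_derive_C_scal, is_derive_C_mult; apply is_derive_C_id.
    + apply (ex_derive_C_comp (jacobi s)); [apply ex_derive_jacobi, s_in|].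
      eexists. apply is_derive_C_scal, is_derive_C_id.
  - intros w. unfold F. replace (RtoC 2 * s * (w + RtoC 1))%C with (RtoC 2 * s * w + RtoC 2 * s)%C by ring.
    rewrite jacobi_add_2_tau, Cmult_assoc, <- Ce_plus by exact s_in. f_equal. f_equal. ring.
  - intros w. unfold F. set (q := (RtoC (/ 4) * z)%C).
    assert (sq : (RtoC 4 * (s * q))%C = RtoC (-1)).
    { transitivity (RtoC (4 * / 4) * (s * z))%C; [unfold q; rewrite RtoC_mult; ring|].
      rewrite Rinv_r, sz by lra. ring. }
    replace (RtoC 2 * s * (w + RtoC 2 * q))%C with (RtoC 2 * s * w + RtoC 4 * (s * q))%C by ring.
    rewrite sq, (jacobi_add_Z s s_in _ (-1)), (Cmult_assoc (Ce (- w - q))), <- Ce_plus. f_equal. f_equal.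
    transitivity (s * (w * w) + RtoC 4 * (s * q) * w + RtoC 4 * (s * q) * q)%C; [ring|]. rewrite sq.
    apply injective_projections; simpl; ring.
Qed.

Lemma theta_opp_inv (z : C) : 0 < Im z -> theta (- / z) = (theta_multiplier z * (theta z + theta_half z))%C.
Proof.
  intros z_in. assert (inversion := jacobi_inversion z 0 z_in).
  rewrite jacobi_quarter, !Cmult_0_r, !Ce_0, jacobi_0 in inversion; auto using Im_opp_inv_pos.
  - rewrite !Cmult_1_l in inversion. exact inversion.
  - rewrite Rmult_0_r. apply Ce_0.
Qed.

Lemma theta_half_opp_inv (z : C) : 0 < Im z ->
  theta_half (- / z) = (theta_multiplier z * (theta z - theta_half z))%C.
Proof.
  intros z_in. assert (inversion := jacobi_inversion z (/ 2) z_in).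
  rewrite jacobi_quarter, Ce_half in inversion; [|exact z_in|rewrite Rinv_r by lra; apply Ce_1].
  rewrite <- jacobi_diag by (apply Im_opp_inv_pos, z_in).
  replace (theta z - theta_half z)%C with (theta z + RtoC (-1) * theta_half z)%C by ring. rewrite <- inversion.
  generalize (- / z)%C. intros s. f_equal; f_equal; apply injective_projections; simpl; field.
Qed.

(* The degree six invariant [x y (x^4 - y^4)] of the octahedral group. *)
Definition theta_disc (z : C) : C := (theta z * theta_half z * (theta z ^ 4 - theta_half z ^ 4))%C.

Lemma theta_disc_translate (z : C) : 0 < Im z -> theta_disc (z + RtoC 1) = (Ci * theta_disc z)%C.
Proof.
  intros z_in. unfold theta_disc. rewrite theta_translate, theta_half_translate, Cpow_mult_l, Ci_pow4 by exact z_in.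
  ring.
Qed.

Lemma theta_disc_opp_inv (z : C) : 0 < Im z -> theta_disc (- / z) = (RtoC 8 * theta_multiplier z ^ 6 * theta_disc z)%C.
Proof. intros z_in. unfold theta_disc. rewrite theta_opp_inv, theta_half_opp_inv by exact z_in. ring. Qed.

Lemma holo_theta_disc : holo_on_H theta_disc.
Proof.
  apply (holo_on_H_ext (fun z => theta z * theta_half z * (RtoC 1 * theta z ^ 4 + RtoC (-1) * theta_half z ^ 4))%C).
  { intros z _. unfold theta_disc. ring. }
  intros z z_in. assert (diff := holo_theta z z_in). assert (diff_half := holo_theta_half z z_in).
  apply ex_derive_C_mult; [apply ex_derive_C_mult|apply ex_derive_C_lin; apply ex_derive_C_pow]; auto.
Qed.

(** * Wronskians *)

Definition wronskian (g h : C -> C) (z : C) : C := (g z * C_derive h z - h z * C_derive g z)%C.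

Lemma wronskian_of_derive (g h : C -> C) (z a b : C) : is_derive g z a -> is_derive h z b ->
  wronskian g h z = (g z * b - h z * a)%C.
Proof.
  intros ga hb. unfold wronskian. rewrite (is_C_derive_unique g z a ga), (is_C_derive_unique h z b hb). reflexivity.
Qed.

Lemma wronskian_ext_H (g h g' h' : C -> C) (z : C) : 0 < Im z -> holo_on_H g -> holo_on_H h ->
  (forall w, 0 < Im w -> g w = g' w) -> (forall w, 0 < Im w -> h w = h' w) -> wronskian g h z = wronskian g' h' z.
Proof.
  intros z_in g_holo h_holo g_eq h_eq. unfold wronskian.
  rewrite (C_derive_ext_H g g'), (C_derive_ext_H h h'), g_eq, h_eq; auto.
Qed.

Lemma wronskian_lin_mult (g h r : C -> C) (a b c d z : C) : ex_derive g z -> ex_derive h z -> ex_derive r z ->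
  wronskian (fun w => r w * (a * g w + b * h w))%C (fun w => r w * (c * g w + d * h w))%C z =
  (r z * r z * (a * d - b * c) * wronskian g h z)%C.
Proof.
  intros g_diff h_diff r_diff.
  erewrite wronskian_of_derive;
    [|apply is_derive_C_mult; [|apply is_derive_C_lin]; apply is_derive_C_derive; eassumption..].
  unfold wronskian. ring.
Qed.

Lemma wronskian_comp (g h u : C -> C) (z l : C) : ex_derive g (u z) -> ex_derive h (u z) -> is_derive u z l ->
  wronskian (fun w => g (u w)) (fun w => h (u w)) z = (l * wronskian g h (u z))%C.
Proof.
  intros g_diff h_diff u_der.
  erewrite wronskian_of_derive;
    [|eapply is_derive_C_comp; [apply is_derive_C_derive; eassumption|exact u_der]..].
  unfold wronskian. ring.
Qed.

Section WronskianTransformation.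

Variables g h : C -> C.
Hypotheses (g_holo : holo_on_H g) (h_holo : holo_on_H h).

Lemma wronskian_translate (a : C) (z : C) : 0 < Im z ->
  (forall w, 0 < Im w -> g (w + RtoC 1)%C = g w) -> (forall w, 0 < Im w -> h (w + RtoC 1)%C = (a * h w)%C) ->
  wronskian g h (z + RtoC 1) = (a * wronskian g h z)%C.
Proof.
  intros z_in g_law h_law. assert (up_in : 0 < Im (z + RtoC 1)) by (rewrite Im_translate; exact z_in).
  assert (shift : is_derive (fun w => w + RtoC 1)%C z (RtoC 1)).
  { apply (is_derive_C_ext (fun w => RtoC 1 * w + RtoC 1)%C); [intros w; ring|apply is_derive_C_affine]. }
  assert (moved := wronskian_comp g h _ z _ (g_holo _ up_in) (h_holo _ up_in) shift).
  rewrite Cmult_1_l in moved. rewrite <- moved.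
  replace (a * wronskian g h z)%C with (RtoC 1 * RtoC 1 * (RtoC 1 * a - RtoC 0 * RtoC 0) * wronskian g h z)%C by ring.
  rewrite <- (wronskian_lin_mult g h (fun _ => RtoC 1));
    [|apply g_holo, z_in|apply h_holo, z_in|apply ex_derive_C_const].
  apply wronskian_ext_H; auto using holo_on_H_translate.
  - intros w w_in. rewrite g_law by exact w_in. ring.
  - intros w w_in. rewrite h_law by exact w_in. ring.
Qed.

Lemma wronskian_opp_inv (r : C -> C) (a b c d z : C) : 0 < Im z -> holo_on_H r ->
  (forall w, 0 < Im w -> g (- / w)%C = (r w * (a * g w + b * h w))%C) ->
  (forall w, 0 < Im w -> h (- / w)%C = (r w * (c * g w + d * h w))%C) ->
  wronskian g h (- / z) = (z * z * (r z * r z) * (a * d - b * c) * wronskian g h z)%C.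
Proof.
  intros z_in r_holo g_law h_law. assert (inv_in := Im_opp_inv_pos z z_in). assert (nz := H_neq_0 z z_in).
  assert (moved := wronskian_comp g h _ z _ (g_holo _ inv_in) (h_holo _ inv_in) (is_derive_opp_inv z nz)).
  transitivity (z * z * (/ (z * z) * wronskian g h (- / z)))%C; [field; exact nz|].
  assert (inv_holo : forall f, holo_on_H f -> holo_on_H (fun w => f (- / w)%C))
    by (intros f f_holo; apply holo_on_H_comp; auto using Im_opp_inv_pos, holo_opp_inv).
  rewrite <- moved, (wronskian_ext_H _ _ _ _ z z_in (inv_holo g g_holo) (inv_holo h h_holo) g_law h_law).
  rewrite wronskian_lin_mult by auto. ring.
Qed.

Lemma holo_wronskian : holo_on_H (C_derive g) -> holo_on_H (C_derive h) -> holo_on_H (wronskian g h).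
Proof.
  intros g'_holo h'_holo.
  apply (holo_on_H_ext (fun z => RtoC 1 * (g z * C_derive h z) + RtoC (-1) * (h z * C_derive g z))%C).
  - intros z _. unfold wronskian. ring.
  - apply holo_on_H_lin; apply holo_on_H_mult; auto.
Qed.

End WronskianTransformation.

(** * Bounds above the line Im z = 3/4 *)

Lemma succ_sqr_mult_pow_le_1 (x : R) (k : nat) : 0 <= x <= / 4 -> INR (S k) * INR (S k) * x ^ k <= 1.
Proof.
  intros x_in. induction k as [|k IH]; [simpl; lra|].
  assert (pow_nonneg : 0 <= x ^ k) by (apply pow_le; lra). assert (k_nonneg := pos_INR k).
  rewrite !S_INR in *. set (n := INR k) in *. rewrite <- tech_pow_Rmult. set (p := x ^ k) in *.
  apply Rle_trans with ((n + 1) * (n + 1) * p); [|exact IH].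
  replace ((n + 1 + 1) * (n + 1 + 1) * (x * p)) with ((n + 2) * (n + 2) * x * p) by ring.
  apply Rmult_le_compat_r; [exact pow_nonneg|].
  apply Rle_trans with ((n + 2) * (n + 2) * / 4); [apply Rmult_le_compat_l; nra|nra].
Qed.

Lemma theta_derive_dominated (y : R) (k : nat) : 0 <= y -> exp (- (2 * PI * y)) <= / 4 ->
  Cmod (eseries_derive_coef theta_coef (fun k => INR k * INR k) (S k)) *
    exp (- (2 * PI * (INR (S k) * INR (S k) - INR 0 * INR 0) * y)) <=
  4 * PI * exp (- (2 * PI * y)) * exp (- (2 * PI * y)) ^ k.
Proof.
  intros y_nonneg x_le. assert (x_pos := exp_pos (- (2 * PI * y))). assert (pi_pos := PI_RGT_0).
  assert (coef_le := succ_sqr_mult_pow_le_1 _ k (conj (Rlt_le _ _ x_pos) x_le)).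
  assert (pow_nonneg := pow_le _ k (Rlt_le _ _ x_pos)).
  assert (exp_le_x : exp (- (2 * PI * (INR (S k) * INR (S k) - INR 0 * INR 0) * y))
                     <= exp (- (2 * PI * y)) ^ (k + (1 + k))).
  { apply exp_le_pow; [exact y_nonneg|]. assert (k_nonneg := pos_INR k). rewrite !plus_INR, !S_INR. simpl. nra. }
  unfold eseries_derive_coef. rewrite Cmod_mult, Cmod_derive_factor. simpl theta_coef.
  rewrite Cmod_R, !Rabs_pos_eq by (try apply Rle_0_sqr; lra).
  set (x := exp (- (2 * PI * y))) in *. set (n2 := INR (S k) * INR (S k)) in *.
  assert (n2_nonneg : 0 <= n2) by apply Rle_0_sqr.
  apply Rle_trans with (4 * PI * n2 * (x ^ k * (x * x ^ k))).
  - replace (2 * PI * n2 * 2) with (4 * PI * n2) by ring. apply Rmult_le_compat_l; [nra|].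
    rewrite !pow_add, pow_1 in exp_le_x. exact exp_le_x.
  - replace (4 * PI * n2 * (x ^ k * (x * x ^ k))) with (4 * PI * x * x ^ k * (n2 * x ^ k)) by ring.
    assert (nonneg : 0 <= 4 * PI * x * x ^ k) by (apply Rmult_le_pos; [apply Rmult_le_pos|]; lra). nra.
Qed.

Lemma theta_half_derive_dominated (y : R) (k : nat) : 0 <= y -> exp (- (2 * PI * y)) <= / 4 ->
  Cmod (eseries_derive_coef (fun _ => RtoC 2) (fun k => (INR k + / 2) * (INR k + / 2)) (S k)) *
    exp (- (2 * PI * ((INR (S k) + / 2) * (INR (S k) + / 2) - (INR 0 + / 2) * (INR 0 + / 2)) * y)) <=
  9 * PI * exp (- (2 * PI * y)) ^ 2 * exp (- (2 * PI * y)) ^ k.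
Proof.
  intros y_nonneg x_le. assert (x_pos := exp_pos (- (2 * PI * y))). assert (pi_pos := PI_RGT_0).
  assert (coef_le := succ_sqr_mult_pow_le_1 _ k (conj (Rlt_le _ _ x_pos) x_le)).
  assert (pow_nonneg := pow_le _ k (Rlt_le _ _ x_pos)). assert (k_nonneg := pos_INR k).
  assert (exp_le_x : exp (- (2 * PI * ((INR (S k) + / 2) * (INR (S k) + / 2) - (INR 0 + / 2) * (INR 0 + / 2)) * y))
                     <= exp (- (2 * PI * y)) ^ (k + (2 + k))).
  { apply exp_le_pow; [exact y_nonneg|]. rewrite !plus_INR, !S_INR. simpl. nra. }
  unfold eseries_derive_coef. rewrite Cmod_mult, Cmod_derive_factor.
  rewrite Cmod_R, !Rabs_pos_eq by (try apply Rle_0_sqr; lra).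
  set (x := exp (- (2 * PI * y))) in *. set (n2 := INR (S k) * INR (S k)) in *.
  set (h2 := (INR (S k) + / 2) * (INR (S k) + / 2)) in *. assert (h2_nonneg : 0 <= h2) by apply Rle_0_sqr.
  assert (h2_le : h2 <= 9 / 4 * n2) by (unfold h2, n2; rewrite S_INR; nra).
  apply Rle_trans with (4 * PI * h2 * (x ^ k * (x ^ 2 * x ^ k))).
  - replace (2 * PI * h2 * 2) with (4 * PI * h2) by ring. apply Rmult_le_compat_l; [nra|].
    rewrite !pow_add in exp_le_x. exact exp_le_x.
  - apply Rle_trans with (9 * PI * n2 * (x ^ k * (x ^ 2 * x ^ k))).
    + assert (x2_nonneg : 0 <= x ^ 2) by (apply pow_le; lra).
      apply Rmult_le_compat_r; [apply Rmult_le_pos; [|apply Rmult_le_pos]; lra|nra].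
    + replace (9 * PI * n2 * (x ^ k * (x ^ 2 * x ^ k))) with (9 * PI * x ^ 2 * x ^ k * (n2 * x ^ k)) by ring.
      assert (x2_nonneg : 0 <= x ^ 2) by (apply pow_le; lra).
      assert (nonneg : 0 <= 9 * PI * x ^ 2 * x ^ k) by (apply Rmult_le_pos; [apply Rmult_le_pos|]; lra). nra.
Qed.

Lemma nome_le (y : R) : 3 / 4 <= y -> exp (- (2 * PI * y)) <= / 38.
Proof.
  intros y_ge. assert (pi_ge := PI2_3_2). apply Rle_trans with (exp (- (/ 2 * INR 9))).
  { apply exp_le. simpl. nra. }
  rewrite exp_Ropp, exp_mult_INR. apply Rinv_le_contravar; [lra|].
  assert (linear := exp_ineq1_le (/ 2)). apply Rle_trans with ((/ 2 + 1) ^ 9); [simpl; lra|]. apply pow_incr. lra.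
Qed.

Lemma nome_tail_le (x : R) : 0 <= x <= / 38 -> x / (1 - x) <= / 37 /\ x ^ 2 / (1 - x) <= / 1406.
Proof.
  intros x_in. split; apply Rmult_le_reg_r with (1 - x); try lra; unfold Rdiv; rewrite Rmult_assoc, Rinv_l by lra; nra.
Qed.

Definition nome_quarter (z : C) : R := exp (- (2 * PI * / 4 * Im z)).

Section HighBounds.

Variable z : C.
Hypothesis high : 3 / 4 <= Im z.

Let y_nonneg : 0 <= Im z.
Proof. lra. Qed.

Let x_lt_1 : 0 <= exp (- (2 * PI * Im z)) < 1.
Proof. apply nome_lt_1. lra. Qed.

Let x_le : 0 <= exp (- (2 * PI * Im z)) <= / 38.
Proof. split; [apply x_lt_1|apply nome_le, high]. Qed.

Lemma Cmod_theta_sub_1_le : Cmod (theta z - RtoC 1) <= 2 / 37.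
Proof.
  rewrite (proj2 theta_series) by lra. destruct (nome_tail_le _ x_le) as [tail _].
  assert (bound := Cmod_eseries_sub_lead_le theta_coef (fun k => INR k * INR k) _ _ _ x_lt_1
                     (fun k => theta_dominated (Im z) k y_nonneg) z eq_refl).
  simpl in bound. rewrite Rmult_0_l, Cmult_0_l, Ce_0, Cmult_1_r, Rmult_0_r, Rmult_0_l, Ropp_0, exp_0 in bound.
  set (x := exp _) in *. replace (2 * x / (1 - x) * 1) with (2 * (x / (1 - x))) in bound by (unfold Rdiv; ring). lra.
Qed.

Lemma Cmod_theta_derive_le : Cmod (C_derive theta z) <= 4 * PI / 37.
Proof.
  rewrite (proj2 (eseries_on_H_derive _ _ _ theta_series)) by lra. destruct (nome_tail_le _ x_le) as [tail _].
  assert (bound := Cmod_eseries_sub_lead_le (eseries_derive_coef theta_coef (fun k => INR k * INR k))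
                     (fun k => INR k * INR k) _ _ _ x_lt_1
                     (fun k => theta_derive_dominated (Im z) k y_nonneg ltac:(lra)) z eq_refl).
  unfold eseries_derive_coef at 2 in bound. simpl in bound.
  rewrite !Rmult_0_l, Rmult_0_r, !Rmult_0_l, Ropp_0, exp_0 in bound.
  replace (RtoC (2 * PI) * Ci * RtoC 0 * RtoC 1 * Ce (RtoC 0 * z))%C with (RtoC 0) in bound by ring.
  set (x := exp _) in *.
  replace (4 * PI * x / (1 - x) * 1) with (4 * PI * (x / (1 - x))) in bound by (unfold Rdiv; ring).
  unfold Cminus in bound. rewrite Copp_0, Cplus_0_r in bound. assert (pi_pos := PI_RGT_0). nra.
Qed.

Lemma Cmod_theta_half_sub_le : Cmod (theta_half z - RtoC 2 * Ce (RtoC (/ 4) * z)) <= / 703 * nome_quarter z.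
Proof.
  destruct (nome_tail_le _ x_le) as [_ tail].
  assert (bound := Cmod_eseries_sub_lead_le (fun _ => RtoC 2) (fun k => (INR k + / 2) * (INR k + / 2)) _ _ _ x_lt_1
                     (fun k => theta_half_dominated (Im z) k y_nonneg) z eq_refl).
  cbv beta in bound.
  replace ((INR 0 + / 2) * (INR 0 + / 2)) with (/ 4) in bound by (simpl; field). eapply Rle_trans; [exact bound|].
  apply Rmult_le_compat_r; [left; apply exp_pos|]. unfold Rdiv in *. lra.
Qed.

Lemma Cmod_theta_half_derive_sub_le :
  Cmod (C_derive theta_half z - RtoC PI * Ci * Ce (RtoC (/ 4) * z)) <= 9 * PI / 1406 * nome_quarter z.
Proof.
  rewrite (proj2 (eseries_on_H_derive _ _ _ theta_half_series)) by lra. destruct (nome_tail_le _ x_le) as [_ tail].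
  assert (bound := Cmod_eseries_sub_lead_le
    (eseries_derive_coef (fun _ => RtoC 2) (fun k => (INR k + / 2) * (INR k + / 2)))
    (fun k => (INR k + / 2) * (INR k + / 2)) _ _ _ x_lt_1
    (fun k => theta_half_derive_dominated (Im z) k y_nonneg ltac:(lra)) z eq_refl).
  unfold eseries_derive_coef at 2 in bound. cbv beta in bound.
  replace ((INR 0 + / 2) * (INR 0 + / 2)) with (/ 4) in bound by (simpl; field).
  replace (RtoC (2 * PI) * Ci * RtoC (/ 4) * RtoC 2)%C with (RtoC PI * Ci)%C in bound
    by (apply injective_projections; simpl; field).
  eapply Rle_trans; [exact bound|]. apply Rmult_le_compat_r; [left; apply exp_pos|].
  assert (pi_pos := PI_RGT_0). set (x := exp _) in *.
  replace (9 * PI * x ^ 2 / (1 - x)) with (9 * PI * (x ^ 2 / (1 - x))) by (unfold Rdiv; ring). nra.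
Qed.

Lemma nome_quarter_pos : 0 < nome_quarter z.
Proof. apply exp_pos. Qed.

Lemma Cmod_Ce_quarter : Cmod (Ce (RtoC (/ 4) * z)) = nome_quarter z.
Proof. apply Cmod_Ce_mult. Qed.

Lemma nome_quarter_pow4_le : nome_quarter z ^ 4 <= / 38.
Proof.
  unfold nome_quarter. rewrite <- exp_mult_INR. eapply Rle_trans; [|apply x_le].
  right. f_equal. simpl. field.
Qed.

Lemma Cmod_theta_bounds : 35 / 37 <= Cmod (theta z) <= 39 / 37.
Proof.
  assert (close := Cmod_theta_sub_1_le).
  assert (upper := Cmod_triangle_inv (theta z) (RtoC 1)).
  assert (lower := Cmod_triangle_inv (RtoC 1) (theta z)).
  rewrite Cmod_1, (Cmod_minus_sym (RtoC 1)) in *. lra.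
Qed.

Lemma Cmod_theta_half_bounds : 199 / 100 * nome_quarter z <= Cmod (theta_half z) <= 201 / 100 * nome_quarter z.
Proof.
  assert (close := Cmod_theta_half_sub_le). assert (r_pos := nome_quarter_pos).
  set (lead := (RtoC 2 * Ce (RtoC (/ 4) * z))%C) in *.
  assert (lead_mod : Cmod lead = 2 * nome_quarter z)
    by (unfold lead; rewrite Cmod_mult, Cmod_R, Rabs_pos_eq, Cmod_Ce_quarter by lra; reflexivity).
  assert (upper := Cmod_triangle_inv (theta_half z) lead).
  assert (lower := Cmod_triangle_inv lead (theta_half z)).
  rewrite (Cmod_minus_sym lead) in lower. lra.
Qed.

Lemma Cmod_theta_half_derive_ge : 99 / 100 * PI * nome_quarter z <= Cmod (C_derive theta_half z).
Proof.
  assert (close := Cmod_theta_half_derive_sub_le). assert (r_pos := nome_quarter_pos). assert (pi_pos := PI_RGT_0).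
  set (lead := (RtoC PI * Ci * Ce (RtoC (/ 4) * z))%C) in *.
  assert (lead_mod : Cmod lead = PI * nome_quarter z)
    by (unfold lead; rewrite !Cmod_mult, Cmod_Ci, Cmod_R, Rabs_pos_eq, Cmod_Ce_quarter by lra; ring).
  assert (lower := Cmod_triangle_inv lead (C_derive theta_half z)).
  rewrite (Cmod_minus_sym lead) in lower. nra.
Qed.

Lemma Cmod_theta_disc_bounds :
  / 2 * nome_quarter z <= Cmod (theta_disc z) <= 5 * nome_quarter z.
Proof.
  destruct Cmod_theta_bounds as [int_ge int_le]. destruct Cmod_theta_half_bounds as [half_ge half_le].
  assert (r_pos := nome_quarter_pos). assert (r4_le := nome_quarter_pow4_le).
  set (r := nome_quarter z) in *. unfold theta_disc. rewrite !Cmod_mult.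
  assert (lower := Cmod_triangle_inv (theta z ^ 4) (theta_half z ^ 4)).
  assert (upper := Cmod_triangle_minus (theta z ^ 4) (theta_half z ^ 4)). rewrite !Cmod_pow in lower, upper.
  set (x := Cmod (theta z)) in *. set (w := Cmod (theta_half z)) in *.
  set (d := Cmod (theta z ^ 4 - theta_half z ^ 4)) in *.
  assert (x4_ge : (35 / 37) ^ 4 <= x ^ 4) by (apply pow_incr; lra).
  assert (x4_le : x ^ 4 <= (39 / 37) ^ 4) by (apply pow_incr; lra).
  assert (w4_le : w ^ 4 <= (201 / 100 * r) ^ 4) by (apply pow_incr; lra). rewrite Rpow_mult_distr in w4_le.
  assert (xw_ge : 35 / 37 * (199 / 100 * r) <= x * w) by (apply Rmult_le_compat; lra).
  assert (xw_le : x * w <= 39 / 37 * (201 / 100 * r)) by (apply Rmult_le_compat; lra).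
  assert (d_ge : 1 / 3 <= d) by lra. assert (d_le : d <= 2) by lra. nra.
Qed.

Lemma Cmod_theta_wronskian_ge : nome_quarter z <= Cmod (wronskian theta theta_half z).
Proof.
  destruct Cmod_theta_bounds as [int_ge int_le]. destruct Cmod_theta_half_bounds as [half_ge half_le].
  assert (derive_le := Cmod_theta_derive_le). assert (half_derive_ge := Cmod_theta_half_derive_ge).
  assert (r_pos := nome_quarter_pos). assert (pi_ge := PI2_3_2). set (r := nome_quarter z) in *.
  assert (lower := Cmod_triangle_inv (theta z * C_derive theta_half z) (theta_half z * C_derive theta z)).
  rewrite !Cmod_mult in lower. unfold wronskian.
  assert (main : 35 / 37 * (99 / 100 * PI * r) <= Cmod (theta z) * Cmod (C_derive theta_half z))
    by (apply Rmult_le_compat; nra).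
  assert (error : Cmod (theta_half z) * Cmod (C_derive theta z) <= 201 / 100 * r * (4 * PI / 37))
    by (apply Rmult_le_compat; try apply Cmod_ge_0; lra).
  nra.
Qed.

End HighBounds.

Lemma theta_disc_neq_0 (z : C) : 0 < Im z -> theta_disc z <> RtoC 0.
Proof.
  revert z. apply (upper_half_neq_0 theta_disc Ci (fun z => RtoC 8 * theta_multiplier z ^ 6)%C).
  - exact Ci_nz.
  - exact theta_disc_translate.
  - exact theta_disc_opp_inv.
  - intros z high vanish. assert (bound := proj1 (Cmod_theta_disc_bounds z high)).
    rewrite vanish, Cmod_0 in bound. assert (r_pos := nome_quarter_pos z). lra.
Qed.

Lemma theta_neq_0 (z : C) : 0 < Im z -> theta z <> RtoC 0.
Proof. intros z_in vanish. apply (theta_disc_neq_0 z z_in). unfold theta_disc. rewrite vanish. ring. Qed.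

Lemma theta_quarter (z : C) : 0 < Im z -> theta (RtoC (/ 4) * z) = (theta z + theta_half z)%C.
Proof.
  intros z_in. rewrite <- jacobi_0 by (rewrite im_scal_l; lra).
  rewrite jacobi_quarter, Ce_0 by (try (rewrite Rmult_0_r; apply Ce_0); exact z_in). ring.
Qed.

Lemma theta_multiplier_eq (z : C) : 0 < Im z -> theta_multiplier z = (theta (- / z) / theta (RtoC (/ 4) * z))%C.
Proof.
  intros z_in. rewrite theta_opp_inv, <- theta_quarter by exact z_in. field.
  apply theta_neq_0. rewrite im_scal_l. lra.
Qed.

Lemma theta_multiplier_neq_0 (z : C) : 0 < Im z -> theta_multiplier z <> RtoC 0.
Proof.
  intros z_in vanish. apply (theta_neq_0 (- / z) (Im_opp_inv_pos z z_in)).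
  rewrite theta_opp_inv, vanish by exact z_in. ring.
Qed.

Lemma holo_theta_multiplier : holo_on_H theta_multiplier.
Proof.
  apply (holo_on_H_ext (fun z => theta (- / z) * / theta (RtoC (/ 4) * z))%C).
  { intros z z_in. symmetry. apply theta_multiplier_eq, z_in. }
  apply holo_on_H_mult.
  - apply (holo_on_H_comp theta); [exact Im_opp_inv_pos|exact holo_theta|exact holo_opp_inv].
  - intros z z_in. assert (quarter_in : 0 < Im (RtoC (/ 4) * z)) by (rewrite im_scal_l; lra).
    apply (ex_derive_C_inv (fun w => theta (RtoC (/ 4) * w)%C)); [|apply theta_neq_0, quarter_in].
    apply (ex_derive_C_comp theta); [apply holo_theta, quarter_in|].
    eexists. apply is_derive_C_scal, is_derive_C_id.
Qed.

Definition theta_wronskian : C -> C := wronskian theta theta_half.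

Lemma theta_wronskian_translate (z : C) : 0 < Im z -> theta_wronskian (z + RtoC 1) = (Ci * theta_wronskian z)%C.
Proof.
  intros z_in.
  apply (wronskian_translate theta theta_half holo_theta holo_theta_half);
    auto using theta_translate, theta_half_translate.
Qed.

Lemma theta_wronskian_opp_inv (z : C) : 0 < Im z ->
  theta_wronskian (- / z) = (RtoC (-2) * (z * z) * theta_multiplier z ^ 2 * theta_wronskian z)%C.
Proof.
  intros z_in. unfold theta_wronskian.
  rewrite (wronskian_opp_inv theta theta_half holo_theta holo_theta_half theta_multiplier
             (RtoC 1) (RtoC 1) (RtoC 1) (RtoC (-1)) z z_in holo_theta_multiplier).
  - replace (RtoC 1 * RtoC (-1) - RtoC 1 * RtoC 1)%C with (RtoC (-2))
      by (apply injective_projections; simpl; ring). ring.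
  - intros w w_in. rewrite theta_opp_inv by exact w_in. ring.
  - intros w w_in. rewrite theta_half_opp_inv by exact w_in. ring.
Qed.

Lemma theta_wronskian_neq_0 (z : C) : 0 < Im z -> theta_wronskian z <> RtoC 0.
Proof.
  revert z.
  apply (upper_half_neq_0 theta_wronskian Ci (fun z => RtoC (-2) * (z * z) * theta_multiplier z ^ 2)%C).
  - exact Ci_nz.
  - exact theta_wronskian_translate.
  - exact theta_wronskian_opp_inv.
  - intros z high vanish. assert (bound := Cmod_theta_wronskian_ge z high).
    unfold theta_wronskian in vanish. rewrite vanish, Cmod_0 in bound.
    assert (r_pos := nome_quarter_pos z). lra.
Qed.

Lemma holo_theta_wronskian : holo_on_H theta_wronskian.
Proof.
  apply holo_wronskian.
  - exact holo_theta.
  - exact holo_theta_half.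
  - exact (holo_eseries_on_H _ _ _ (eseries_on_H_derive _ _ _ theta_series)).
  - exact (holo_eseries_on_H _ _ _ (eseries_on_H_derive _ _ _ theta_half_series)).
Qed.

(** * Integer powers *)

Lemma Czpow_1 (n : Z) : Czpow (RtoC 1) n = RtoC 1.
Proof. destruct n; simpl; [reflexivity|apply Cpow_1_l|rewrite Cpow_1_l; field]. Qed.

Lemma Czpow_mult (a b : C) (n : Z) : a <> RtoC 0 -> b <> RtoC 0 -> Czpow (a * b) n = (Czpow a n * Czpow b n)%C.
Proof.
  intros a_nz b_nz. destruct n; simpl; [ring|apply Cpow_mult_l|].
  rewrite Cpow_mult_l. field. split; apply Cpow_nz; auto.
Qed.

Lemma Czpow_succ (a : C) (n : Z) : a <> RtoC 0 -> Czpow a (n + 1) = (Czpow a n * a)%C.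
Proof.
  intros nz. destruct n as [|p|p].
  - simpl. ring.
  - replace (Z.pos p + 1)%Z with (Z.pos (Pos.succ p)) by lia. simpl Czpow. rewrite Pos2Nat.inj_succ. simpl. ring.
  - destruct (Pos.succ_pred_or p) as [-> | <-]; [simpl; field; exact nz|].
    set (q := Pos.pred p). replace (Z.neg (Pos.succ q) + 1)%Z with (Z.neg q) by lia.
    simpl Czpow. rewrite Pos2Nat.inj_succ. simpl. field. split; [apply Cpow_nz|]; exact nz.
Qed.

Lemma Cmod_Czpow (a : C) (n : Z) : a <> RtoC 0 -> Cmod (Czpow a n) = powerRZ (Cmod a) n.
Proof.
  intros a_nz. destruct n; simpl; [apply Cmod_1|apply Cmod_pow|].
  rewrite Cmod_inv, Cmod_pow by (apply Cpow_nz, a_nz). reflexivity.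
Qed.

Lemma Czpow_neq_0 (a : C) (n : Z) : a <> RtoC 0 -> Czpow a n <> RtoC 0.
Proof.
  intros a_nz. apply Cmod_gt_0. rewrite Cmod_Czpow by exact a_nz. apply powerRZ_lt, Cmod_gt_0, a_nz.
Qed.

Lemma ex_derive_Czpow (f : C -> C) (z : C) (n : Z) : ex_derive f z -> f z <> RtoC 0 ->
  ex_derive (fun w => Czpow (f w) n) z.
Proof.
  intros diff nz. destruct n; simpl; [apply ex_derive_C_const|apply ex_derive_C_pow, diff|].
  apply (ex_derive_C_inv (fun w => f w ^ Pos.to_nat p)%C); [apply ex_derive_C_pow, diff|apply Cpow_nz, nz].
Qed.

Lemma powerRZ_exp (x : R) (n : Z) : powerRZ (exp x) n = exp (IZR n * x).
Proof.
  destruct n as [|p|p]; simpl powerRZ.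
  - rewrite Rmult_0_l, exp_0. reflexivity.
  - rewrite <- exp_mult_INR, INR_IPR, Rmult_comm. reflexivity.
  - rewrite <- exp_mult_INR, INR_IPR, <- exp_Ropp. f_equal. unfold IZR. ring.
Qed.

Lemma powerRZ_sandwich (a b : R) (n : Z) : 0 < a -> 0 < b -> exists K, 0 < K /\
  forall x r, 0 < r -> a * r <= x <= b * r -> powerRZ x n <= K * powerRZ r n.
Proof.
  intros a_pos b_pos. destruct n as [|p|p]; simpl.
  - exists 1. split; [lra|]. intros. lra.
  - exists (b ^ Pos.to_nat p). split; [apply pow_lt, b_pos|]. intros x r r_pos x_in.
    rewrite <- Rpow_mult_distr. apply pow_incr. nra.
  - exists (/ a ^ Pos.to_nat p). split; [apply Rinv_0_lt_compat, pow_lt, a_pos|]. intros x r r_pos x_in.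
    rewrite <- Rinv_mult, <- Rpow_mult_distr. assert (ar_pos : 0 < a * r) by nra.
    apply Rinv_le_contravar; [apply pow_lt, ar_pos|]. apply pow_incr. lra.
Qed.

(** * Vanishing of level one functions of weight zero *)

Section WeightZero.

Variable phi : C -> C.
Hypotheses (phi_holo : holo_on_H phi) (phi_per : periodic_on_H phi).
Hypothesis phi_inversion : forall z, 0 < Im z -> Cmod (phi (- / z)%C) = Cmod (phi z).

Lemma bounded_of_high (B : R) : (forall z, 3 / 4 <= Im z -> Cmod (phi z) <= B) ->
  forall z, 0 < Im z -> Cmod (phi z) <= B.
Proof.
  intros high. apply upper_half_ind; [| |exact high].
  - intros z z_in. rewrite phi_per by exact z_in. reflexivity.
  - intros z z_in. rewrite phi_inversion by exact z_in. auto.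
Qed.

Lemma Cmod_fcoef_le_of_bounded (B : R) (n : Z) : (1 <= n)%Z -> (forall z, 0 < Im z -> Cmod (phi z) <= B) ->
  Cmod (fcoef phi n) <= 3 * B.
Proof.
  intros n_ge bound. apply IZR_le in n_ge. assert (pi_pos := PI_RGT_0).
  assert (B_nonneg : 0 <= B) by (eapply Rle_trans; [apply Cmod_ge_0|apply (bound (0, 1)); simpl; lra]).
  set (y := / (2 * PI * IZR n)). assert (y_pos : 0 < y) by (apply Rinv_0_lt_compat; nra).
  eapply Rle_trans; [apply (Cmod_fcoef_le phi phi_holo phi_per n y B y_pos); intros; apply bound, y_pos|].
  replace (2 * PI * IZR n * y) with 1 by (unfold y; field; split; nra).
  assert (e_le := exp_le_3). nra.
Qed.

(* A bound [B] on the upper half plane bounds the coefficients by [3 B], hence [phi] by [B / 2] high up. *)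
Lemma halve_bound (B : R) : vanishes_below phi 1 -> (forall z, 0 < Im z -> Cmod (phi z) <= B) ->
  forall z, 0 < Im z -> Cmod (phi z) <= B / 2.
Proof.
  intros vanish bound. apply bounded_of_high. intros z high.
  assert (B_nonneg : 0 <= B) by (eapply Rle_trans; [apply Cmod_ge_0|apply (bound (0, 1)); simpl; lra]).
  destruct (is_eseries_on_H_fcoef phi 1 phi_holo phi_per vanish) as [conv agree]. rewrite agree by lra.
  assert (x_in := nome_lt_1 (Im z) ltac:(lra)). assert (x_le := nome_le (Im z) high).
  set (x := exp (- (2 * PI * Im z))) in *.
  apply Rle_trans with (Series (fun k => 3 * B * x * x ^ k)).
  - apply (Cmod_is_series_le _ _ _ (is_series_eseries _ _ z (conv (Im z) ltac:(lra)))).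
    + intros k. rewrite Cmod_mult, Cmod_Ce_mult. replace (3 * B * x * x ^ k) with (3 * B * x ^ S k) by (simpl; ring).
      apply Rmult_le_compat; [apply Cmod_ge_0|left; apply exp_pos| |].
      * apply Cmod_fcoef_le_of_bounded; [lia|exact bound].
      * apply exp_le_pow; [lra|]. rewrite INR_IZR_INZ. apply IZR_le. lia.
    + apply ex_series_R_scal, ex_series_geom. rewrite Rabs_pos_eq; lra.
  - rewrite Series_scal_l, Series_geom by (rewrite Rabs_pos_eq; lra).
    destruct (nome_tail_le x ltac:(lra)) as [tail _]. unfold Rdiv in tail.
    replace (3 * B * x * / (1 - x)) with (3 * B * (x * / (1 - x))) by ring. nra.
Qed.

Lemma weight_zero_vanishes (K : R) : (forall z, 3 / 4 <= Im z -> Cmod (phi z) <= K * exp (- (2 * PI * Im z))) ->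
  forall z, 0 < Im z -> phi z = RtoC 0.
Proof.
  intros decay. assert (pi_pos := PI_RGT_0).
  assert (vanish : vanishes_below phi 1).
  { intros n n_lt. apply (fcoef_0_of_growth phi phi_holo phi_per K (- (2 * PI))).
    - intros z z_in. replace (- (2 * PI) * Im z) with (- (2 * PI * Im z)) by ring. apply decay. lra.
    - assert (n_le : IZR n <= 0) by (apply IZR_le; lia). nra. }
  assert (K_nonneg : 0 <= K).
  { assert (at_i := Rle_trans _ _ _ (Cmod_ge_0 _) (decay (0, 1) ltac:(simpl; lra))).
    assert (e_pos := exp_pos (- (2 * PI * Im (0, 1)))). apply Rnot_lt_le. intros neg. nra. }
  assert (bound : forall n z, 0 < Im z -> Cmod (phi z) <= K / 2 ^ n).
  { induction n as [|n IH].
    - rewrite pow_O, Rdiv_1_r. apply bounded_of_high. intros z high. eapply Rle_trans; [apply decay, high|].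
      assert (x_in := nome_lt_1 (Im z) ltac:(lra)). nra.
    - replace (K / 2 ^ S n) with (K / 2 ^ n / 2) by (simpl; field; apply pow_nonzero; lra). apply halve_bound; auto. }
  intros z z_in. apply Cmod_small_eq_0. intros eps eps_pos.
  destruct (pow_half_lt K eps eps_pos) as [n small]. left. eapply Rle_lt_trans; [apply (bound n z z_in)|exact small].
Qed.

End WeightZero.

(** * Pairs of level one *)

Lemma one_plus_Ci_neq_0 : (RtoC 1 + Ci)%C <> RtoC 0.
Proof. intros absurd. apply (f_equal Im) in absurd. simpl in absurd. lra. Qed.

(* [exp (pi i / 4)] times the square root of [z / i]: its powers are the automorphy factors under
   [z -> -1/z]. *)
Definition theta_root (z : C) : C := (theta_multiplier z * (RtoC 1 + Ci))%C.

Lemma theta_root_neq_0 (z : C) : 0 < Im z -> theta_root z <> RtoC 0.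
Proof. intros z_in. apply Cmult_neq_0; [apply theta_multiplier_neq_0, z_in|exact one_plus_Ci_neq_0]. Qed.

Lemma Cmod_theta_root_sqr (z : C) : Cmod (theta_root z) ^ 2 = 2 * Cmod (theta_multiplier z) ^ 2.
Proof.
  unfold theta_root. rewrite Cmod_mult, Rpow_mult_distr.
  replace (Cmod (RtoC 1 + Ci) ^ 2) with (Cmod (RtoC 1 + Ci) * Cmod (RtoC 1 + Ci)) by ring.
  rewrite Cmod_sqr. simpl. ring.
Qed.

Lemma holo_theta_root_Czpow (n : Z) : holo_on_H (fun z => Czpow (theta_root z) n).
Proof.
  intros z z_in. apply ex_derive_Czpow; [|apply theta_root_neq_0, z_in].
  apply ex_derive_C_mult; [apply holo_theta_multiplier, z_in|apply ex_derive_C_const].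
Qed.

Lemma Cmod_theta_wronskian_opp_inv (z : C) : 0 < Im z ->
  Cmod (theta_wronskian (- / z)) = Cmod z ^ 2 * Cmod (theta_root z) ^ 2 * Cmod (theta_wronskian z).
Proof.
  intros z_in.
  rewrite theta_wronskian_opp_inv, !Cmod_mult, Cmod_pow, Cmod_R, Rabs_left, Cmod_theta_root_sqr by (auto; lra).
  ring.
Qed.

Lemma Cmod_theta_disc_opp_inv (z : C) : 0 < Im z ->
  Cmod (theta_disc (- / z)) = Cmod (theta_root z) ^ 6 * Cmod (theta_disc z).
Proof.
  intros z_in. rewrite theta_disc_opp_inv, !Cmod_mult, Cmod_pow, Cmod_R, Rabs_pos_eq by (auto; lra).
  replace (Cmod (theta_root z) ^ 6) with ((Cmod (theta_root z) ^ 2) ^ 3) by ring.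
  rewrite Cmod_theta_root_sqr. ring.
Qed.

Lemma powerRZ_pow_exp (x : R) (m : nat) (n : Z) : powerRZ (exp x ^ m) n = exp (IZR n * (x * INR m)).
Proof. rewrite <- exp_mult_INR. apply powerRZ_exp. Qed.

Lemma weight_factors_cancel (T : R) (t : Z) : 0 < T ->
  (powerRZ T (2 * t + 1) ^ 2 / T ^ 2) ^ 12 * powerRZ (T ^ 48) (- t) = 1.
Proof.
  intros T_pos. rewrite <- (exp_ln T T_pos). set (x := ln T).
  rewrite powerRZ_exp, powerRZ_pow_exp, <- !exp_mult_INR. unfold Rdiv.
  rewrite <- exp_Ropp, <- exp_plus, <- exp_mult_INR, <- exp_plus, <- exp_0. f_equal.
  rewrite plus_IZR, mult_IZR, opp_IZR. simpl. ring.
Qed.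

Section LevelOnePair.

Variables (t : Z) (h0 h1 : C -> C) (a kappa : C).
Hypotheses (h0_translate : forall z, 0 < Im z -> h0 (z + RtoC 1)%C = h0 z)
  (h1_translate : forall z, 0 < Im z -> h1 (z + RtoC 1)%C = (a * h1 z)%C) (a_root : (a ^ 12)%C = RtoC 1).
Hypotheses
  (h0_opp_inv : forall z, 0 < Im z -> h0 (- / z)%C = (Czpow (theta_root z) (2 * t + 1) * (kappa * (h0 z + h1 z)))%C)
  (h1_opp_inv : forall z, 0 < Im z -> h1 (- / z)%C = (Czpow (theta_root z) (2 * t + 1) * (kappa * (h0 z - h1 z)))%C)
  (kappa_sqr : 2 * Cmod kappa ^ 2 = 1).

Variables (c0 c1 : nat -> C) (lam0 lam1 : nat -> R) (gap : R).
Hypotheses (h0_series : is_eseries_on_H h0 c0 lam0) (h1_series : is_eseries_on_H h1 c1 lam1) (gap_pos : 0 < gap).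
Hypotheses (lam0_gap : forall k, lam0 O + gap <= lam0 (S k)) (lam1_gap : forall k, lam1 O + gap <= lam1 (S k)).
Hypothesis order_large : 2 * IZR t + 4 <= 12 * (lam0 O + lam1 O).

Let h0_holo : holo_on_H h0 := holo_eseries_on_H _ _ _ h0_series.
Let h1_holo : holo_on_H h1 := holo_eseries_on_H _ _ _ h1_series.

Definition wronskian_quotient (z : C) : C :=
  ((wronskian h0 h1 z * / theta_wronskian z) ^ 12 * Czpow (theta_disc z ^ 8) (- t))%C.

Lemma holo_wronskian_quotient : holo_on_H wronskian_quotient.
Proof.
  intros z z_in. apply ex_derive_C_mult.
  - apply ex_derive_C_pow, ex_derive_C_mult.
    + apply holo_wronskian; [exact h0_holo|exact h1_holo| | |exact z_in].
      * exact (holo_eseries_on_H _ _ _ (eseries_on_H_derive _ _ _ h0_series)).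
      * exact (holo_eseries_on_H _ _ _ (eseries_on_H_derive _ _ _ h1_series)).
    + apply ex_derive_C_inv; [apply holo_theta_wronskian, z_in|apply theta_wronskian_neq_0, z_in].
  - apply ex_derive_Czpow; [apply ex_derive_C_pow, holo_theta_disc, z_in|apply Cpow_nz, theta_disc_neq_0, z_in].
Qed.

Lemma periodic_wronskian_quotient : periodic_on_H wronskian_quotient.
Proof.
  intros z z_in. unfold wronskian_quotient.
  rewrite (wronskian_translate h0 h1 h0_holo h1_holo a), theta_wronskian_translate, theta_disc_translate by auto.
  replace (a * wronskian h0 h1 z * / (Ci * theta_wronskian z))%C
    with (a * / Ci * (wronskian h0 h1 z * / theta_wronskian z))%C
    by (field; split; [apply theta_wronskian_neq_0, z_in|exact Ci_nz]).
  rewrite Ci_inv, !Cpow_mult_l, a_root. replace ((- Ci) ^ 12)%C with (Ci ^ 4 * Ci ^ 4 * Ci ^ 4)%C by ring.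
  replace (Ci ^ 8)%C with (Ci ^ 4 * Ci ^ 4)%C by ring. rewrite Ci_pow4, !Cmult_1_l. reflexivity.
Qed.

Lemma Cmod_wronskian_opp_inv (z : C) : 0 < Im z -> Cmod (wronskian h0 h1 (- / z)) =
  Cmod z ^ 2 * powerRZ (Cmod (theta_root z)) (2 * t + 1) ^ 2 * Cmod (wronskian h0 h1 z).
Proof.
  intros z_in. rewrite (wronskian_opp_inv h0 h1 h0_holo h1_holo (fun z => Czpow (theta_root z) (2 * t + 1))
    kappa kappa kappa (- kappa) z z_in (holo_theta_root_Czpow (2 * t + 1))).
  - replace (kappa * - kappa - kappa * kappa)%C with (RtoC (-2) * (kappa * kappa))%C by ring.
    rewrite !Cmod_mult, Cmod_R, Rabs_left, Cmod_Czpow by (auto using theta_root_neq_0; lra).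
    replace (- -2 * (Cmod kappa * Cmod kappa)) with (2 * Cmod kappa ^ 2) by ring. rewrite kappa_sqr. ring.
  - intros w w_in. rewrite h0_opp_inv by exact w_in. ring.
  - intros w w_in. rewrite h1_opp_inv by exact w_in. ring.
Qed.

Lemma Cmod_wronskian_quotient (z : C) : 0 < Im z -> Cmod (wronskian_quotient z) =
  (Cmod (wronskian h0 h1 z) / Cmod (theta_wronskian z)) ^ 12 * powerRZ (Cmod (theta_disc z) ^ 8) (- t).
Proof.
  intros z_in. unfold wronskian_quotient.
  rewrite Cmod_mult, Cmod_Czpow, !Cmod_pow, Cmod_mult, Cmod_inv; [reflexivity| |].
  - apply theta_wronskian_neq_0, z_in.
  - apply Cpow_nz, theta_disc_neq_0, z_in.
Qed.

Lemma Cmod_wronskian_quotient_opp_inv (z : C) : 0 < Im z ->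
  Cmod (wronskian_quotient (- / z)%C) = Cmod (wronskian_quotient z).
Proof.
  intros z_in. rewrite !Cmod_wronskian_quotient by auto using Im_opp_inv_pos.
  rewrite Cmod_wronskian_opp_inv, Cmod_theta_wronskian_opp_inv, Cmod_theta_disc_opp_inv by exact z_in.
  assert (z_pos := proj1 (Cmod_gt_0 _) (H_neq_0 z z_in)).
  assert (root_pos := proj1 (Cmod_gt_0 _) (theta_root_neq_0 z z_in)).
  assert (wronskian_pos := proj1 (Cmod_gt_0 _) (theta_wronskian_neq_0 z z_in)).
  assert (cancel := weight_factors_cancel _ t root_pos).
  set (T := Cmod (theta_root z)) in *. set (d := Cmod (theta_disc z)). set (w := Cmod (wronskian h0 h1 z)).
  set (v := Cmod (theta_wronskian z)) in *. set (p := powerRZ T (2 * t + 1)) in *.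
  replace ((T ^ 6 * d) ^ 8) with (T ^ 48 * d ^ 8) by ring. rewrite powerRZ_mult.
  replace (Cmod z ^ 2 * p ^ 2 * w / (Cmod z ^ 2 * T ^ 2 * v)) with (p ^ 2 / T ^ 2 * (w / v)) by (field; lra).
  rewrite Rpow_mult_distr.
  transitivity ((p ^ 2 / T ^ 2) ^ 12 * powerRZ (T ^ 48) (- t) * ((w / v) ^ 12 * powerRZ (d ^ 8) (- t))); [ring|].
  rewrite cancel. ring.
Qed.

Lemma Cmod_wronskian_decay : exists K, forall z, 3 / 4 <= Im z ->
  Cmod (wronskian h0 h1 z) <= K * exp (- (2 * PI * (lam0 O + lam1 O) * Im z)).
Proof.
  assert (decay : forall h c lam, is_eseries_on_H h c lam -> (forall k, lam O + gap <= lam (S k)) ->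
    exists K, forall z, 3 / 4 <= Im z -> Cmod (h z) <= K * exp (- (2 * PI * lam O * Im z)))
    by (intros h c lam series lam_gap; apply (Cmod_eseries_decay h c lam gap series gap_pos lam_gap); lra).
  destruct (decay _ _ _ h0_series lam0_gap) as [K0 h0_le].
  destruct (decay _ _ _ h1_series lam1_gap) as [K1 h1_le].
  destruct (decay _ _ _ (eseries_on_H_derive _ _ _ h0_series) lam0_gap) as [K0' h0'_le].
  destruct (decay _ _ _ (eseries_on_H_derive _ _ _ h1_series) lam1_gap) as [K1' h1'_le].
  exists (K0 * K1' + K1 * K0'). intros z high. unfold wronskian.
  replace (exp (- (2 * PI * (lam0 O + lam1 O) * Im z)))
    with (exp (- (2 * PI * lam0 O * Im z)) * exp (- (2 * PI * lam1 O * Im z))) by (rewrite <- exp_plus; f_equal; ring).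
  specialize (h0_le z high). specialize (h1_le z high). specialize (h0'_le z high). specialize (h1'_le z high).
  set (E0 := exp (- (2 * PI * lam0 O * Im z))) in *. set (E1 := exp (- (2 * PI * lam1 O * Im z))) in *.
  eapply Rle_trans; [apply Cmod_triangle_minus|]. rewrite !Cmod_mult.
  replace ((K0 * K1' + K1 * K0') * (E0 * E1)) with (K0 * E0 * (K1' * E1) + K1 * E1 * (K0' * E0)) by ring.
  apply Rplus_le_compat; apply Rmult_le_compat; try apply Cmod_ge_0; auto.
Qed.

Lemma wronskian_quotient_decay : exists K, forall z, 3 / 4 <= Im z ->
  Cmod (wronskian_quotient z) <= K * exp (- (2 * PI * Im z)).
Proof.
  destruct Cmod_wronskian_decay as [K W_le].
  destruct (powerRZ_sandwich ((/ 2) ^ 8) (5 ^ 8) (- t)) as [L [L_pos disc_le]]; [apply pow_lt; lra..|].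
  exists (K ^ 12 * L). intros z high. rewrite Cmod_wronskian_quotient by lra. specialize (W_le z high).
  assert (v_ge := Cmod_theta_wronskian_ge z high). fold theta_wronskian in v_ge.
  assert (disc_bounds := Cmod_theta_disc_bounds z high). assert (r_pos := nome_quarter_pos z).
  assert (disc_pos := proj1 (Cmod_gt_0 _) (theta_disc_neq_0 z ltac:(lra))).
  assert (W_nonneg := Cmod_ge_0 (wronskian h0 h1 z)).
  set (w := Cmod (wronskian h0 h1 z)) in *. set (v := Cmod (theta_wronskian z)) in *.
  set (d := Cmod (theta_disc z)) in *. set (r := nome_quarter z) in *.
  set (E := exp (- (2 * PI * (lam0 O + lam1 O) * Im z))) in *.
  assert (quotient_le : w / v <= K * (E / r)).
  { apply Rle_trans with (w / r).
    - apply Rmult_le_compat_l; [exact W_nonneg|]. apply Rinv_le_contravar; auto.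
    - unfold Rdiv. rewrite <- Rmult_assoc. apply Rmult_le_compat_r; [left; apply Rinv_0_lt_compat, r_pos|exact W_le]. }
  specialize (disc_le (d ^ 8) (r ^ 8) (pow_lt _ _ r_pos)).
  rewrite <- !Rpow_mult_distr in disc_le. specialize (disc_le ltac:(split; apply pow_incr; lra)).
  apply Rle_trans with ((K * (E / r)) ^ 12 * (L * powerRZ (r ^ 8) (- t))).
  - apply Rmult_le_compat; [|apply powerRZ_le, pow_lt, disc_pos| |exact disc_le].
    + apply pow_le, Rmult_le_pos; [exact W_nonneg|]. left. apply Rinv_0_lt_compat. lra.
    + apply pow_incr. split; [|exact quotient_le]. apply Rmult_le_pos; [exact W_nonneg|].
      left. apply Rinv_0_lt_compat. lra.
  - rewrite Rpow_mult_distr.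
    replace (K ^ 12 * (E / r) ^ 12 * (L * powerRZ (r ^ 8) (- t)))
      with (K ^ 12 * L * ((E / r) ^ 12 * powerRZ (r ^ 8) (- t))) by ring.
    apply Rmult_le_compat_l.
    { apply Rmult_le_pos; [|lra]. replace (K ^ 12) with ((K ^ 6) ^ 2) by ring. apply pow2_ge_0. }
    unfold E, r, nome_quarter. rewrite powerRZ_pow_exp. unfold Rdiv.
    rewrite <- exp_Ropp, <- exp_plus, <- exp_mult_INR, <- exp_plus. apply exp_le.
    rewrite opp_IZR. simpl. assert (pi_pos := PI_RGT_0).
    assert (nonneg : 0 <= 2 * PI * Im z * (12 * (lam0 O + lam1 O) - (2 * IZR t + 4))); [|lra].
    apply Rmult_le_pos; [apply Rmult_le_pos|]; lra.
Qed.

Lemma wronskian_vanishes (z : C) : 0 < Im z -> wronskian h0 h1 z = RtoC 0.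
Proof.
  intros z_in. destruct wronskian_quotient_decay as [K decay].
  assert (vanish := weight_zero_vanishes wronskian_quotient holo_wronskian_quotient periodic_wronskian_quotient
                      Cmod_wronskian_quotient_opp_inv K decay z z_in).
  apply NNPP. intros nz. revert vanish. apply Cmult_neq_0.
  - apply Cpow_nz, Cmult_neq_0; [exact nz|]. apply Cinv_neq_0, theta_wronskian_neq_0, z_in.
  - apply Czpow_neq_0, Cpow_nz, theta_disc_neq_0, z_in.
Qed.

(* The Wronskian starts with [2 pi i (lam1 0 - lam0 0) c0 c1] times the leading exponential. *)
Lemma leading_coefficient_vanishes : lam0 O <> lam1 O -> c0 O = RtoC 0 \/ c1 O = RtoC 0.
Proof.
  intros lam_ne. set (E0 := fun y => RtoC (exp (2 * PI * lam0 O * y))).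
  set (E1 := fun y => RtoC (exp (2 * PI * lam1 O * y))).
  assert (lead := fun h c lam series lam_gap => leading_coefficient_lim h c lam gap series gap_pos lam_gap).
  assert (h0_lim := lead _ _ _ h0_series lam0_gap). assert (h1_lim := lead _ _ _ h1_series lam1_gap).
  assert (h0'_lim := lead _ _ _ (eseries_on_H_derive _ _ _ h0_series) lam0_gap).
  assert (h1'_lim := lead _ _ _ (eseries_on_H_derive _ _ _ h1_series) lam1_gap).
  assert (lim := filterlim_C_minus (Rbar_locally p_infty) _ _ _ _
    (filterlim_C_mult (Rbar_locally p_infty) _ _ _ _ h0_lim h1'_lim)
    (filterlim_C_mult (Rbar_locally p_infty) _ _ _ _ h1_lim h0'_lim)).
  assert (limit_0 : (c0 O * eseries_derive_coef c1 lam1 O - c1 O * eseries_derive_coef c0 lam0 O)%C = RtoC 0).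
  { apply (filterlim_C_unique (Rbar_locally p_infty) _ _ _ lim).
    apply (filterlim_ext_loc (fun _ => RtoC 0)); [|apply filterlim_const].
    exists 0. intros y y_pos. assert (vanish := wronskian_vanishes (0, y) y_pos). unfold wronskian in vanish.
    fold (E0 y) (E1 y). transitivity (RtoC 0 * (E0 y * E1 y))%C; [ring|]. rewrite <- vanish. ring. }
  apply NNPP. intros both_nz. apply not_or_and in both_nz. destruct both_nz as [c0_nz c1_nz].
  revert limit_0. replace (_ - _)%C with (RtoC (2 * PI * (lam1 O - lam0 O)) * Ci * (c0 O * c1 O))%C.
  - repeat apply Cmult_neq_0; auto using Ci_nz. intros absurd. apply RtoC_inj in absurd. assert (pi_pos := PI_RGT_0).
    apply Rmult_integral in absurd. destruct absurd; lra.
  - unfold eseries_derive_coef. rewrite RtoC_mult, RtoC_minus. ring.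
Qed.

End LevelOnePair.

(** * Plus forms *)

Definition plus_form (t : Z) (f : C -> C) : Prop := holo_on_H f /\ transforms_like_theta t f /\ plus_space t f.

Lemma in_Mshriek_plus_form (t : Z) (f : C -> C) : in_Mshriek t f -> plus_form t f.
Proof. intros [holo [law [_ plus]]]. repeat split; auto. Qed.

Lemma plus_form_periodic (t : Z) (f : C -> C) : plus_form t f -> periodic_on_H f.
Proof.
  intros [_ [law _]] z z_in.
  specialize (law 1%Z 1%Z 0%Z 1%Z ltac:(split; [reflexivity|exists 0%Z; reflexivity]) z z_in).
  replace (mobius 1 1 0 1 z) with (z + RtoC 1)%C in law by (unfold mobius; rewrite Cmult_0_l, Cplus_0_l; field).
  rewrite theta_translate in law by exact z_in.
  replace (theta z / theta z)%C with (RtoC 1) in law by (field; apply theta_neq_0, z_in).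
  rewrite law, Czpow_1. ring.
Qed.

(* The plus condition in weight t + 1/2 allows the exponents congruent to 0 and to [plus_sign t] modulo 4. *)
Definition plus_sign (t : Z) : Z := if Z.even t then 1%Z else (-1)%Z.

Definition plus_unit (t : Z) : C := (RtoC (IZR (plus_sign t)) * Ci)%C.

Lemma plus_sign_cases (t : Z) : plus_sign t = 1%Z \/ plus_sign t = (-1)%Z.
Proof. unfold plus_sign. destruct (Z.even t); auto. Qed.

Lemma plus_unit_sqr (t : Z) : (plus_unit t * plus_unit t)%C = RtoC (-1).
Proof. unfold plus_unit. destruct (plus_sign_cases t) as [-> | ->]; apply injective_projections; simpl; ring. Qed.

Lemma plus_okb_iff (t n : Z) : plus_okb t n = true <-> (n mod 4 = 0)%Z \/ ((n - plus_sign t) mod 4 = 0)%Z.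
Proof.
  unfold plus_okb, plus_sign. rewrite Bool.orb_true_iff, !Z.eqb_eq. destruct (Z.even t); Z.div_mod_to_equations; lia.
Qed.

Lemma fcoef_plus_space_0 (t : Z) (f : C -> C) (n : Z) : plus_space t f ->
  (n mod 4 <> 0)%Z -> ((n - plus_sign t) mod 4 <> 0)%Z -> fcoef f n = RtoC 0.
Proof.
  intros plus not_0 not_sign. apply plus, Bool.not_true_iff_false. rewrite plus_okb_iff. tauto.
Qed.

Lemma Ce_quarter_mod4 (n m : Z) : ((n - m) mod 4 = 0)%Z -> Ce (RtoC (IZR n * / 4)) = Ce (RtoC (IZR m * / 4)).
Proof.
  intros congruent. replace n with (m + 4 * ((n - m) / 4))%Z by (Z.div_mod_to_equations; lia).
  rewrite plus_IZR, mult_IZR. set (k := ((n - m) / 4)%Z).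
  replace ((IZR m + 4 * IZR k) * / 4) with (IZR m * / 4 + IZR k) by field.
  rewrite RtoC_plus, Ce_plus, Ce_Z. ring.
Qed.

Lemma Ce_quarter_mod4_0 (n : Z) : (n mod 4 = 0)%Z -> Ce (RtoC (IZR n * / 4)) = RtoC 1.
Proof.
  intros n_mod. rewrite (Ce_quarter_mod4 n 0), Rmult_0_l by (rewrite Z.sub_0_r; exact n_mod). apply Ce_0.
Qed.

Lemma Ce_quarter_plus_sign (t n : Z) : ((n - plus_sign t) mod 4 = 0)%Z -> Ce (RtoC (IZR n * / 4)) = plus_unit t.
Proof.
  intros n_mod. rewrite (Ce_quarter_mod4 n (plus_sign t) n_mod). unfold plus_unit.
  destruct (plus_sign_cases t) as [-> | ->]; [rewrite Rmult_1_l, Ce_quarter; ring|].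
  assert (inverse := Ce_opp_r (RtoC (/ 4))). rewrite Ce_quarter in inverse.
  replace (RtoC (-1 * / 4)) with (- RtoC (/ 4))%C by (apply injective_projections; simpl; ring).
  apply (Cmult_reg_l Ci); [exact Ci_nz|]. rewrite inverse. apply injective_projections; simpl; ring.
Qed.

Lemma Ce_half_sqr (n : Z) : Ce (RtoC (IZR n * / 2)) = (Ce (RtoC (IZR n * / 4)) * Ce (RtoC (IZR n * / 4)))%C.
Proof. rewrite <- Ce_plus, <- RtoC_plus. do 2 f_equal. field. Qed.

Lemma eq_on_H_of_fcoef (f g : C -> C) : holo_on_H f -> holo_on_H g -> periodic_on_H f -> periodic_on_H g ->
  (forall n, fcoef f n = fcoef g n) -> forall z, 0 < Im z -> f z = g z.
Proof.
  intros f_holo g_holo f_per g_per coef z z_in. apply Ceq_minus.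
  transitivity (RtoC 1 * f z + RtoC (-1) * g z)%C; [ring|].
  apply (fcoef_all_0 (fun w => RtoC 1 * f w + RtoC (-1) * g w)%C); [| | |exact z_in].
  - apply holo_on_H_lin; auto.
  - apply periodic_on_H_lin; auto.
  - intros n. rewrite fcoef_lin, coef by auto. ring.
Qed.

(* For s = 1 and s = -1: twice the part of [f] supported on the even and on the odd exponents. *)
Definition parity_part (s : C) (f : C -> C) (z : C) : C := (RtoC 1 * f z + s * f (z + RtoC (/ 2)))%C.

Definition even_part : (C -> C) -> C -> C := parity_part (RtoC 1).

Definition odd_part : (C -> C) -> C -> C := parity_part (RtoC (-1)).

Lemma holo_parity_part (s : C) (f : C -> C) : holo_on_H f -> holo_on_H (parity_part s f).
Proof. intros holo. apply (holo_on_H_lin f); [exact holo|apply holo_on_H_translate, holo]. Qed.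

Lemma periodic_parity_part (s : C) (f : C -> C) : periodic_on_H f -> periodic_on_H (parity_part s f).
Proof. intros per. apply (periodic_on_H_lin f); [exact per|apply periodic_on_H_translate, per]. Qed.

Lemma fcoef_parity_part (s : C) (f : C -> C) (n : Z) : holo_on_H f -> periodic_on_H f ->
  fcoef (parity_part s f) n = ((RtoC 1 + s * Ce (RtoC (IZR n * / 2))) * fcoef f n)%C.
Proof.
  intros holo per. unfold parity_part. rewrite fcoef_lin, fcoef_translate by auto using holo_on_H_translate. ring.
Qed.

Lemma theta_quarter_succ (z : C) : 0 < Im z -> theta (RtoC (/ 4) * (z + RtoC 1)) = (theta z + Ci * theta_half z)%C.
Proof.
  intros z_in. rewrite theta_quarter, theta_translate, theta_half_translate by (rewrite ?Im_translate; exact z_in).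
  reflexivity.
Qed.

Lemma theta_quarter_pred (z : C) : 0 < Im z -> theta (RtoC (/ 4) * (z + RtoC (-1))) = (theta z - Ci * theta_half z)%C.
Proof.
  intros z_in. assert (pred_in : 0 < Im (z + RtoC (-1))) by (rewrite Im_translate; exact z_in).
  assert (theta_law := theta_translate _ pred_in). assert (half_law := theta_half_translate _ pred_in).
  replace (z + RtoC (-1) + RtoC 1)%C with z in theta_law, half_law by ring.
  rewrite theta_quarter, theta_law, half_law, Cmult_assoc, Ci_sqr by exact pred_in. ring.
Qed.

Lemma theta_quarter_neq_0 (z : C) (r : R) : 0 < Im z -> theta (RtoC (/ 4) * (z + RtoC r)) <> RtoC 0.
Proof. intros z_in. apply theta_neq_0. rewrite im_scal_l, Im_translate. lra. Qed.

Lemma theta_quarter_ratio_succ (z : C) : 0 < Im z ->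
  (theta (RtoC (/ 4) * (- / z + RtoC 1)) / theta (RtoC (/ 4) * (z + RtoC (-1))))%C = theta_root z.
Proof.
  intros z_in. assert (nz := theta_quarter_neq_0 z (-1) z_in).
  assert (numerator : theta (RtoC (/ 4) * (- / z + RtoC 1)) = (theta_root z * theta (RtoC (/ 4) * (z + RtoC (-1))))%C).
  { rewrite theta_quarter_succ, theta_quarter_pred, theta_opp_inv, theta_half_opp_inv by auto using Im_opp_inv_pos.
    unfold theta_root. replace (RtoC 1 + Ci)%C with (Ci - Ci * Ci)%C at 1 by (rewrite Ci_sqr; ring).
    transitivity (theta_multiplier z * ((RtoC 1 + Ci) * theta z + (RtoC 1 - Ci) * theta_half z))%C; [ring|].
    transitivity (theta_multiplier z * ((Ci - Ci * Ci) * theta z - (Ci - Ci * Ci) * Ci * theta_half z))%C; [|ring].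
    rewrite Ci_sqr. replace ((Ci - RtoC (-1)) * Ci)%C with (Ci * Ci + Ci)%C by ring. rewrite Ci_sqr. ring. }
  rewrite numerator. field. exact nz.
Qed.

Lemma theta_quarter_ratio_pred (z : C) : 0 < Im z ->
  (theta (RtoC (/ 4) * (- / z + RtoC (-1))) / theta (RtoC (/ 4) * (z + RtoC 1)))%C = (- Ci * theta_root z)%C.
Proof.
  intros z_in. assert (nz := theta_quarter_neq_0 z 1 z_in).
  assert (numerator : theta (RtoC (/ 4) * (- / z + RtoC (-1))) =
                      (- Ci * theta_root z * theta (RtoC (/ 4) * (z + RtoC 1)))%C).
  { rewrite theta_quarter_succ, theta_quarter_pred, theta_opp_inv, theta_half_opp_inv by auto using Im_opp_inv_pos.
    unfold theta_root.
    transitivity (theta_multiplier z * ((RtoC 1 - Ci) * theta z + (RtoC 1 + Ci) * theta_half z))%C; [ring|].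
    transitivity (theta_multiplier z * ((- (Ci * Ci) - Ci) * theta z
                                        + (- (Ci * Ci) - (Ci * Ci) * Ci) * theta_half z))%C; [|ring].
    rewrite Ci_sqr. ring. }
  rewrite numerator. field. exact nz.
Qed.

Lemma Czpow_opp_Ci (t : Z) : Czpow (- Ci) (2 * t + 1) = (- plus_unit t)%C.
Proof.
  assert (nz : (- Ci)%C <> RtoC 0) by (intros absurd; apply (f_equal Im) in absurd; simpl in absurd; lra).
  revert t. apply Z.bi_induction.
  - intros t t' ->. reflexivity.
  - unfold plus_unit, plus_sign. simpl. ring.
  - intros t. replace (2 * Z.succ t + 1)%Z with (2 * t + 1 + 1 + 1)%Z by lia.
    rewrite (Czpow_succ _ (2 * t + 1 + 1)), (Czpow_succ _ (2 * t + 1)) by exact nz.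
    replace (plus_unit (Z.succ t)) with (- plus_unit t)%C.
    + replace (Czpow (- Ci) (2 * t + 1) * - Ci * - Ci)%C with (Ci * Ci * Czpow (- Ci) (2 * t + 1))%C by ring.
      rewrite Ci_sqr. split; intros law; [rewrite law; ring|].
      transitivity (RtoC (-1) * (RtoC (-1) * Czpow (- Ci) (2 * t + 1)))%C; [ring|]. rewrite law. ring.
    + unfold plus_unit, plus_sign. rewrite Z.even_succ, <- Z.negb_even.
      destruct (Z.even t); apply injective_projections; simpl; ring.
Qed.

Section PlusForm.

Variables (t : Z) (f : C -> C).
Hypothesis f_plus : plus_form t f.

Let a : C := plus_unit t.
Let kappa : C := (RtoC (/ 2) * (RtoC 1 - a))%C.
Let f_holo : holo_on_H f := proj1 f_plus.
Let f_per : periodic_on_H f := plus_form_periodic t f f_plus.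

Lemma fcoef_even_part (n : Z) : fcoef (even_part f) n = if (n mod 4 =? 0)%Z then (RtoC 2 * fcoef f n)%C else RtoC 0.
Proof.
  unfold even_part. rewrite fcoef_parity_part, Ce_half_sqr by auto.
  destruct (n mod 4 =? 0)%Z eqn:class; [apply Z.eqb_eq in class|apply Z.eqb_neq in class].
  - rewrite Ce_quarter_mod4_0 by exact class. ring.
  - destruct (Z.eq_dec ((n - plus_sign t) mod 4) 0) as [sign|not_sign].
    + rewrite (Ce_quarter_plus_sign t n sign), plus_unit_sqr. ring.
    + rewrite (fcoef_plus_space_0 t f n (proj2 (proj2 f_plus)) class not_sign). ring.
Qed.

Lemma fcoef_odd_part (n : Z) :
  fcoef (odd_part f) n = if ((n - plus_sign t) mod 4 =? 0)%Z then (RtoC 2 * fcoef f n)%C else RtoC 0.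
Proof.
  unfold odd_part. rewrite fcoef_parity_part, Ce_half_sqr by auto.
  destruct ((n - plus_sign t) mod 4 =? 0)%Z eqn:class; [apply Z.eqb_eq in class|apply Z.eqb_neq in class].
  - rewrite (Ce_quarter_plus_sign t n class), plus_unit_sqr. ring.
  - destruct (Z.eq_dec (n mod 4) 0) as [zero|not_zero].
    + rewrite Ce_quarter_mod4_0 by exact zero. ring.
    + rewrite (fcoef_plus_space_0 t f n (proj2 (proj2 f_plus)) not_zero class). ring.
Qed.

Lemma even_part_translate (z : C) : 0 < Im z -> even_part f (z + RtoC (/ 4)) = even_part f z.
Proof.
  assert (holo := holo_parity_part (RtoC 1) f f_holo). assert (per := periodic_parity_part (RtoC 1) f f_per).
  revert z. apply (eq_on_H_of_fcoef (fun z => even_part f (z + RtoC (/ 4)))%C (even_part f));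
    [apply holo_on_H_translate, holo|exact holo|apply periodic_on_H_translate, per|exact per|].
  intros n. rewrite (fcoef_translate (even_part f)), fcoef_even_part by auto.
  destruct (n mod 4 =? 0)%Z eqn:class; [|ring].
  rewrite Ce_quarter_mod4_0 by (apply Z.eqb_eq, class). ring.
Qed.

Lemma odd_part_translate (z : C) : 0 < Im z -> odd_part f (z + RtoC (/ 4)) = (a * odd_part f z)%C.
Proof.
  assert (holo := holo_parity_part (RtoC (-1)) f f_holo). assert (per := periodic_parity_part (RtoC (-1)) f f_per).
  intros z_in. transitivity (a * odd_part f z + RtoC 0 * odd_part f z)%C; [|ring]. revert z z_in.
  apply (eq_on_H_of_fcoef (fun z => odd_part f (z + RtoC (/ 4)))%C
    (fun z => a * odd_part f z + RtoC 0 * odd_part f z)%C);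
    [apply holo_on_H_translate, holo|apply holo_on_H_lin; exact holo|
     apply periodic_on_H_translate, per|apply periodic_on_H_lin; exact per|].
  intros n. rewrite (fcoef_translate (odd_part f)), (fcoef_lin (odd_part f) (odd_part f)), fcoef_odd_part by auto.
  destruct ((n - plus_sign t) mod 4 =? 0)%Z eqn:class; [|ring].
  rewrite (Ce_quarter_plus_sign t n) by (apply Z.eqb_eq, class). fold a. ring.
Qed.

Lemma plus_form_parts (z : C) : (RtoC 2 * f z)%C = (even_part f z + odd_part f z)%C.
Proof. unfold even_part, odd_part, parity_part. ring. Qed.

Definition level_one_even (z : C) : C := even_part f (RtoC (/ 4) * z).

Definition level_one_odd (z : C) : C := odd_part f (RtoC (/ 4) * z).

Lemma quarter_in_H (z : C) : 0 < Im z -> 0 < Im (RtoC (/ 4) * z).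
Proof. rewrite im_scal_l. lra. Qed.

Lemma level_one_even_translate (z : C) : 0 < Im z -> level_one_even (z + RtoC 1) = level_one_even z.
Proof.
  intros z_in. unfold level_one_even.
  rewrite <- (even_part_translate (RtoC (/ 4) * z)) by (apply quarter_in_H, z_in). f_equal. ring.
Qed.

Lemma level_one_odd_translate (z : C) : 0 < Im z -> level_one_odd (z + RtoC 1) = (a * level_one_odd z)%C.
Proof.
  intros z_in. unfold level_one_odd.
  rewrite <- (odd_part_translate (RtoC (/ 4) * z)) by (apply quarter_in_H, z_in). f_equal. ring.
Qed.

Lemma plus_form_quarter_succ (z : C) : 0 < Im z ->
  (RtoC 2 * f (RtoC (/ 4) * (z + RtoC 1)))%C = (level_one_even z + a * level_one_odd z)%C.
Proof.
  intros z_in. rewrite plus_form_parts, <- (level_one_odd_translate z), <- (level_one_even_translate z) by exact z_in.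
  reflexivity.
Qed.

Lemma plus_form_quarter_pred (z : C) : 0 < Im z ->
  (RtoC 2 * f (RtoC (/ 4) * (z + RtoC (-1))))%C = (level_one_even z - a * level_one_odd z)%C.
Proof.
  intros z_in. assert (pred_in : 0 < Im (z + RtoC (-1))) by (rewrite Im_translate; exact z_in).
  assert (even_law := level_one_even_translate _ pred_in). assert (odd_law := level_one_odd_translate _ pred_in).
  replace (z + RtoC (-1) + RtoC 1)%C with z in even_law, odd_law by ring.
  rewrite plus_form_parts, even_law, odd_law, Cmult_assoc. unfold a. rewrite plus_unit_sqr.
  unfold level_one_even, level_one_odd. ring.
Qed.

Lemma plus_form_opp_inv_succ (z : C) : 0 < Im z ->
  f (RtoC (/ 4) * (- / z + RtoC 1))%C = (Czpow (theta_root z) (2 * t + 1) * f (RtoC (/ 4) * (z + RtoC (-1))))%C.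
Proof.
  intros z_in. set (w := (RtoC (/ 4) * (z + RtoC (-1)))%C).
  assert (w_in : 0 < Im w) by (apply quarter_in_H; rewrite Im_translate; exact z_in).
  assert (law := proj1 (proj2 f_plus) 1%Z 0%Z 4%Z 1%Z ltac:(split; [reflexivity|exists 1%Z; reflexivity]) w w_in).
  replace (mobius 1 0 4 1 w) with (RtoC (/ 4) * (- / z + RtoC 1))%C in law.
  - unfold w in law at 1. rewrite theta_quarter_ratio_succ in law by exact z_in. exact law.
  - unfold mobius. replace (RtoC 4 * w + RtoC 1)%C with z by (unfold w; rewrite RtoC_inv by lra; field).
    unfold w. field. apply H_neq_0, z_in.
Qed.

Lemma plus_form_opp_inv_pred (z : C) : 0 < Im z ->
  f (RtoC (/ 4) * (- / z + RtoC (-1)))%C =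
  (- a * Czpow (theta_root z) (2 * t + 1) * f (RtoC (/ 4) * (z + RtoC 1)))%C.
Proof.
  intros z_in. set (w := (RtoC (/ 4) * (z + RtoC 1))%C).
  assert (w_in : 0 < Im w) by (apply quarter_in_H; rewrite Im_translate; exact z_in).
  assert (law := proj1 (proj2 f_plus) 1%Z 0%Z (-4)%Z 1%Z ltac:(split; [reflexivity|exists (-1)%Z; reflexivity]) w w_in).
  replace (mobius 1 0 (-4) 1 w) with (RtoC (/ 4) * (- / z + RtoC (-1)))%C in law.
  - unfold w in law at 1. rewrite theta_quarter_ratio_pred in law by exact z_in.
    rewrite Czpow_mult, Czpow_opp_Ci in law; [exact law| |].
    + intros absurd. apply (f_equal Im) in absurd. simpl in absurd. lra.
    + apply theta_root_neq_0, z_in.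
  - unfold mobius. replace (RtoC (-4) * w + RtoC 1)%C with (- z)%C by (unfold w; rewrite RtoC_inv by lra; field).
    unfold w. field. apply H_neq_0, z_in.
Qed.

Lemma level_one_even_opp_inv (z : C) : 0 < Im z -> level_one_even (- / z) =
  (Czpow (theta_root z) (2 * t + 1) * (kappa * (level_one_even z + level_one_odd z)))%C.
Proof.
  intros z_in. assert (succ := plus_form_quarter_succ z z_in). assert (pred := plus_form_quarter_pred z z_in).
  assert (inv_succ := plus_form_quarter_succ _ (Im_opp_inv_pos z z_in)).
  assert (inv_pred := plus_form_quarter_pred _ (Im_opp_inv_pos z z_in)).
  rewrite plus_form_opp_inv_succ in inv_succ by exact z_in. rewrite plus_form_opp_inv_pred in inv_pred by exact z_in.
  assert (square := plus_unit_sqr t). fold a in square. unfold kappa. set (R := Czpow _ _) in *.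
  set (u := f (RtoC (/ 4) * (z + RtoC 1))) in *. set (v := f (RtoC (/ 4) * (z + RtoC (-1)))) in *.
  transitivity (RtoC (/ 2) * ((level_one_even (- / z) + a * level_one_odd (- / z))
                              + (level_one_even (- / z) - a * level_one_odd (- / z))))%C.
  - apply injective_projections; simpl; field.
  - rewrite <- inv_succ, <- inv_pred.
    transitivity (RtoC (/ 2) * (R * (RtoC 2 * v) - a * R * (RtoC 2 * u)))%C; [ring|]. rewrite succ, pred.
    transitivity (RtoC (/ 2) * R * ((RtoC 1 - a) * level_one_even z + (- a - a * a) * level_one_odd z))%C; [ring|].
    rewrite square. replace (- a - RtoC (-1))%C with (RtoC 1 - a)%C by ring. ring.
Qed.

Lemma level_one_odd_opp_inv (z : C) : 0 < Im z -> level_one_odd (- / z) =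
  (Czpow (theta_root z) (2 * t + 1) * (kappa * (level_one_even z - level_one_odd z)))%C.
Proof.
  intros z_in. assert (succ := plus_form_quarter_succ z z_in).
  assert (inv_succ := plus_form_quarter_succ _ (Im_opp_inv_pos z z_in)).
  assert (even_law := level_one_even_opp_inv z z_in). assert (pred := plus_form_quarter_pred z z_in).
  rewrite plus_form_opp_inv_succ in inv_succ by exact z_in.
  assert (square := plus_unit_sqr t). fold a in square. unfold kappa in *. set (R := Czpow _ _) in *.
  set (v := f (RtoC (/ 4) * (z + RtoC (-1)))) in *.
  transitivity (- a * (RtoC 2 * (R * v) - level_one_even (- / z)))%C.
  - rewrite inv_succ. transitivity (- (a * a) * level_one_odd (- / z))%C; [rewrite square|]; ring.
  - transitivity (- a * (R * (RtoC 2 * v) - level_one_even (- / z)))%C; [ring|]. rewrite even_law, pred.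
    set (half := RtoC (/ 2)). assert (half_sum : (half + half)%C = RtoC 1)
      by (unfold half; rewrite <- RtoC_plus; f_equal; lra).
    set (E := level_one_even z). set (O := level_one_odd z).
    transitivity (- a * (R * ((half + half) * (E - a * O)) - R * (half * (RtoC 1 - a) * (E + O))))%C;
      [rewrite half_sum; ring|].
    transitivity (R * (half * (- a - a * a) * (E - O)))%C; [ring|rewrite square; ring].
Qed.

Lemma kappa_sqr : 2 * Cmod kappa ^ 2 = 1.
Proof.
  unfold kappa. rewrite Cmod_mult, Rpow_mult_distr, Cmod_R, Rabs_pos_eq by lra.
  replace (Cmod (RtoC 1 - a) ^ 2) with (Cmod (RtoC 1 - a) * Cmod (RtoC 1 - a)) by ring. rewrite Cmod_sqr.
  unfold a, plus_unit. destruct (plus_sign_cases t) as [-> | ->]; simpl; field.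
Qed.

Lemma plus_form_zero_of_part :
  (forall z, 0 < Im z -> even_part f z = RtoC 0) \/ (forall z, 0 < Im z -> odd_part f z = RtoC 0) ->
  forall z, 0 < Im z -> f z = RtoC 0.
Proof.
  assert (factor_nz : forall z, 0 < Im z -> (Czpow (theta_root z) (2 * t + 1) * kappa)%C <> RtoC 0).
  { intros z z_in. apply Cmult_neq_0; [apply Czpow_neq_0, theta_root_neq_0, z_in|].
    apply Cmod_gt_0. assert (sqr := kappa_sqr). assert (nonneg := Cmod_ge_0 kappa). nra. }
  intros parts.
  assert (levels : forall z, 0 < Im z -> level_one_even z = RtoC 0 /\ level_one_odd z = RtoC 0).
  { intros z z_in. assert (inv_in := quarter_in_H _ (Im_opp_inv_pos z z_in)). assert (nz := factor_nz z z_in).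
    assert (quarter_in := quarter_in_H z z_in). destruct parts as [even_0|odd_0].
    - split; [apply even_0, quarter_in|]. apply (Cmult_reg_l _ _ _ nz).
      assert (law := level_one_even_opp_inv z z_in). unfold level_one_even in law.
      rewrite !even_0 in law by assumption. rewrite Cmult_0_r, law. ring.
    - split; [|apply odd_0, quarter_in]. apply (Cmult_reg_l _ _ _ nz).
      assert (law := level_one_odd_opp_inv z z_in). unfold level_one_odd in law.
      rewrite !odd_0 in law by assumption. rewrite Cmult_0_r, law. ring. }
  intros z z_in. destruct (levels (RtoC 4 * z)%C) as [even_0 odd_0]; [rewrite im_scal_l; lra|].
  unfold level_one_even, level_one_odd in *.
  replace (RtoC (/ 4) * (RtoC 4 * z))%C with z in * by (rewrite RtoC_inv by lra; field).
  assert (sum := plus_form_parts z). rewrite even_0, odd_0 in sum.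
  transitivity (RtoC 2 * f z / RtoC 2)%C; [field|]. rewrite sum. field.
Qed.

Lemma level_one_series (s : C) (n : Z) : vanishes_below (parity_part s f) n ->
  is_eseries_on_H (fun z => parity_part s f (RtoC (/ 4) * z)%C)
    (fun k => fcoef (parity_part s f) (n + Z.of_nat k)) (fun k => / 4 * IZR (n + Z.of_nat k)).
Proof.
  intros vanish. apply (is_eseries_on_H_scale (parity_part s f)); [lra|].
  apply is_eseries_on_H_fcoef; auto using holo_parity_part, periodic_parity_part.
Qed.

Lemma leading_parts_vanish (n0 n1 : Z) : vanishes_below (even_part f) n0 -> vanishes_below (odd_part f) n1 ->
  n0 <> n1 -> (2 * t + 3 < 3 * (n0 + n1))%Z -> fcoef (even_part f) n0 = RtoC 0 \/ fcoef (odd_part f) n1 = RtoC 0.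
Proof.
  intros even_vanish odd_vanish distinct order_large.
  assert (even_series := level_one_series _ n0 even_vanish). assert (odd_series := level_one_series _ n1 odd_vanish).
  assert (gap : forall n k, / 4 * IZR (n + Z.of_nat 0) + / 4 <= / 4 * IZR (n + Z.of_nat (S k))).
  { intros n k. rewrite !plus_IZR, <- !INR_IZR_INZ, S_INR. simpl. assert (k_nonneg := pos_INR k). lra. }
  assert (unit_pow : (a ^ 12)%C = RtoC 1).
  { replace (a ^ 12)%C with ((a * a) ^ 6)%C by ring. unfold a. rewrite plus_unit_sqr, <- RtoC_pow. f_equal. ring. }
  rewrite <- (Z.add_0_r n0), <- (Z.add_0_r n1).
  apply (leading_coefficient_vanishes t level_one_even level_one_odd a kappa
    level_one_even_translate
    level_one_odd_translate unit_pow level_one_even_opp_inv level_one_odd_opp_inv kappa_sqr _ _ _ _ (/ 4)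
    even_series odd_series ltac:(lra) (gap n0) (gap n1)).
  - rewrite !Z.add_0_r. apply Zlt_le_succ, IZR_le in order_large.
    unfold Z.succ in order_large. rewrite !plus_IZR, !mult_IZR, plus_IZR in order_large. lra.
  - rewrite !Z.add_0_r. intros equal. apply distinct, eq_IZR. lra.
Qed.

End PlusForm.

Lemma Z_least (P : Z -> Prop) (b : Z) : (forall n, P n -> (b <= n)%Z) -> (exists n, P n) ->
  exists n, P n /\ forall k, (k < n)%Z -> ~ P k.
Proof.
  intros bounded [n Pn].
  destruct (dec_inh_nat_subset_has_unique_least_element (fun k => P (b + Z.of_nat k)%Z)) as [k [[Pk least] _]].
  - intros k. apply classic.
  - exists (Z.to_nat (n - b)). specialize (bounded n Pn). replace (b + _)%Z with n by lia. exact Pn.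
  - exists (b + Z.of_nat k)%Z. split; [exact Pk|]. intros m m_lt Pm. specialize (bounded m Pm).
    assert (k_le : (k <= Z.to_nat (m - b))%nat) by (apply least; replace (b + _)%Z with m by lia; exact Pm). lia.
Qed.

Lemma exists_leading_coefficient (g : C -> C) (n1 : Z) : holo_on_H g -> periodic_on_H g -> vanishes_below g n1 ->
  (forall z, 0 < Im z -> g z = RtoC 0) \/
  exists n, (n1 <= n)%Z /\ vanishes_below g n /\ fcoef g n <> RtoC 0.
Proof.
  intros holo per vanish. destruct (classic (exists n, fcoef g n <> RtoC 0)) as [nonzero|zero]; [right|left].
  - destruct (Z_least (fun n => fcoef g n <> RtoC 0) n1) with (2 := nonzero) as [n [nz least]].
    + intros n nz. apply Z.nlt_ge. intros n_lt. apply nz, vanish, n_lt.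
    + exists n. split; [|split; [|exact nz]].
      * apply Z.nlt_ge. intros n_lt. apply nz, vanish, n_lt.
      * intros k k_lt. apply NNPP. exact (least k k_lt).
  - apply (fcoef_all_0 g holo per). intros n. apply NNPP. intros nz. apply zero. exists n. exact nz.
Qed.

Theorem plus_form_zero (t : Z) (f : C -> C) (n0 n1 : Z) : plus_form t f ->
  (forall n, (n mod 4 = 0)%Z -> (n < n0)%Z -> fcoef f n = RtoC 0) ->
  (forall n, ((n - plus_sign t) mod 4 = 0)%Z -> (n < n1)%Z -> fcoef f n = RtoC 0) ->
  (2 * t + 3 < 3 * (n0 + n1))%Z -> forall n, fcoef f n = RtoC 0.
Proof.
  intros f_plus even_vanish odd_vanish order_large n.
  assert (holo := proj1 f_plus). assert (per := plus_form_periodic t f f_plus).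
  assert (even_coef := fcoef_even_part t f f_plus). assert (odd_coef := fcoef_odd_part t f f_plus).
  apply fcoef_0_of_eq_0, (plus_form_zero_of_part t f f_plus).
  destruct (exists_leading_coefficient (even_part f) n0) as [zero|[m0 [m0_ge [even_below even_nz]]]]; auto.
  { apply holo_parity_part, holo. } { apply periodic_parity_part, per. }
  { intros k k_lt. rewrite even_coef. destruct (k mod 4 =? 0)%Z eqn:class; [|reflexivity].
    rewrite even_vanish; [ring|apply Z.eqb_eq, class|exact k_lt]. }
  destruct (exists_leading_coefficient (odd_part f) n1) as [zero|[m1 [m1_ge [odd_below odd_nz]]]]; auto.
  { apply holo_parity_part, holo. } { apply periodic_parity_part, per. }
  { intros k k_lt. rewrite odd_coef. destruct ((k - plus_sign t) mod 4 =? 0)%Z eqn:class; [|reflexivity].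
    rewrite odd_vanish; [ring|apply Z.eqb_eq, class|exact k_lt]. }
  exfalso. destruct (leading_parts_vanish t f f_plus m0 m1 even_below odd_below) as [vanish|vanish]; auto; [|lia].
  intros <-. rewrite even_coef in even_nz. rewrite odd_coef in odd_nz.
  destruct (m0 mod 4 =? 0)%Z eqn:even_class; [apply Z.eqb_eq in even_class|auto].
  destruct ((m0 - plus_sign t) mod 4 =? 0)%Z eqn:odd_class; [apply Z.eqb_eq in odd_class|auto].
  destruct (plus_sign_cases t) as [sign|sign]; rewrite sign in odd_class; Z.div_mod_to_equations; lia.
Qed.

(** * Homogeneous linear systems *)

Lemma sum_n_lin (c d : C) (u v : nat -> C) (N : nat) :
  sum_n (fun k => c * u k + d * v k)%C N = (c * sum_n u N + d * sum_n v N)%C.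
Proof.
  induction N as [|N IH]; [rewrite !sum_O; reflexivity|]. rewrite !sum_Sn, IH.
  set (s := sum_n u N). set (s' := sum_n v N).
  change (c * s + d * s' + (c * u (S N) + d * v (S N)) = c * (s + u (S N)) + d * (s' + v (S N)))%C. ring.
Qed.

Lemma sum_n_eq_0 (u : nat -> C) (N : nat) : (forall k, (k <= N)%nat -> u k = RtoC 0) -> sum_n u N = RtoC 0.
Proof.
  intros zero. induction N as [|N IH]; [rewrite sum_O; auto|]. rewrite sum_Sn, IH, zero by auto. apply Cplus_0_l.
Qed.

Definition skip (p j : nat) : nat := if (j <? p)%nat then j else S j.

Lemma skip_lt (p j : nat) : (j < p)%nat -> skip p j = j.
Proof. intros j_lt. unfold skip. rewrite (proj2 (Nat.ltb_lt j p) j_lt). reflexivity. Qed.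

Lemma skip_ge (p j : nat) : (p <= j)%nat -> skip p j = S j.
Proof. intros j_ge. unfold skip. rewrite (proj2 (Nat.ltb_ge j p) j_ge). reflexivity. Qed.

Lemma skip_le (p j N : nat) : (j <= N)%nat -> (skip p j <= S N)%nat.
Proof. unfold skip. destruct (j <? p)%nat; lia. Qed.

Lemma sum_n_skip (u : nat -> C) (p N : nat) : (p <= S N)%nat ->
  sum_n u (S N) = (u p + sum_n (fun j => u (skip p j)) N)%C.
Proof.
  revert u p. induction N as [|N IH]; intros u p p_le; rewrite sum_Sn.
  - rewrite !sum_O. destruct p as [|p]; [reflexivity|]. replace p with O by lia. apply Cplus_comm.
  - destruct (Nat.eq_dec p (S (S N))) as [->|ne].
    + rewrite (sum_n_ext_loc (fun j => u (skip (S (S N)) j)) u) by (intros j j_le; f_equal; apply skip_lt; lia).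
      apply Cplus_comm.
    + rewrite (IH u p), sum_Sn, (skip_ge p (S N)) by lia. symmetry. apply Cplus_assoc.
Qed.

Definition insert_at (p : nat) (x : C) (d : nat -> C) (k : nat) : C :=
  if (k <? p)%nat then d k else if (k =? p)%nat then x else d (pred k).

Lemma insert_at_eq (p : nat) (x : C) (d : nat -> C) : insert_at p x d p = x.
Proof. unfold insert_at. rewrite Nat.ltb_irrefl, Nat.eqb_refl. reflexivity. Qed.

Lemma insert_at_skip (p : nat) (x : C) (d : nat -> C) (j : nat) : insert_at p x d (skip p j) = d j.
Proof.
  unfold insert_at. destruct (Nat.lt_ge_cases j p) as [j_lt|j_ge].
  - rewrite skip_lt, (proj2 (Nat.ltb_lt j p)) by exact j_lt. reflexivity.
  - rewrite skip_ge by exact j_ge. rewrite (proj2 (Nat.ltb_ge (S j) p)), (proj2 (Nat.eqb_neq (S j) p)) by lia.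
    reflexivity.
Qed.

Lemma sum_n_insert_at (u d : nat -> C) (p : nat) (x : C) (N : nat) : (p <= S N)%nat ->
  sum_n (fun j => u j * insert_at p x d j)%C (S N) = (u p * x + sum_n (fun j => u (skip p j) * d j) N)%C.
Proof.
  intros p_le. rewrite (sum_n_skip _ p) by exact p_le. rewrite insert_at_eq. f_equal.
  apply sum_n_ext. intros j. rewrite insert_at_skip. reflexivity.
Qed.

Lemma exists_pivot (u : nat -> C) (N : nat) :
  exists p, (p <= N)%nat /\ (u p <> RtoC 0 \/ forall j, (j <= N)%nat -> u j = RtoC 0).
Proof.
  destruct (classic (exists p, (p <= N)%nat /\ u p <> RtoC 0)) as [[p [p_le nz]]|none]; [exists p; auto|].
  exists O. split; [lia|]. right. intros j j_le. apply NNPP. intros nz. apply none. exists j. auto.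
Qed.

(* Gaussian elimination with the last equation. When that equation has no pivot it is vacuous, and the
   junk value of the division by zero does not matter. *)
Theorem underdetermined_system (n : nat) (A : nat -> nat -> C) :
  exists c : nat -> C, (exists j, (j <= n)%nat /\ c j <> RtoC 0) /\
    forall i, (i < n)%nat -> sum_n (fun j => A i j * c j)%C n = RtoC 0.
Proof.
  revert A. induction n as [|n IH]; intros A.
  { exists (fun _ => RtoC 1). split; [exists O; split; [lia|exact C1_nz]|]. intros i i_lt. lia. }
  destruct (exists_pivot (A n) (S n)) as [p [p_le pivot]].
  set (ratio := fun j => (A n (skip p j) / A n p)%C).
  destruct (IH (fun i j => A i (skip p j) - A i p * ratio j)%C) as [d [[j0 [j0_le d_nz]] solution]].
  set (x := (- sum_n (fun j => ratio j * d j) n)%C).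
  exists (insert_at p x d). split.
  { exists (skip p j0). rewrite insert_at_skip. split; [apply skip_le, j0_le|exact d_nz]. }
  intros i i_lt. rewrite sum_n_insert_at by exact p_le.
  assert (row : (A i p * x + sum_n (fun j => A i (skip p j) * d j) n)%C = RtoC 0); [|exact row].
  destruct (Nat.eq_dec i n) as [->|ne].
  - destruct pivot as [nz|zero].
    + assert (term : forall j, (A n (skip p j) * d j = A n p * (ratio j * d j) + RtoC 0 * d j)%C)
        by (intros j; unfold ratio; field; exact nz).
      rewrite (sum_n_ext _ _ n term), sum_n_lin. unfold x. ring.
    + assert (row_0 : forall j, (j <= n)%nat -> (A n (skip p j) * d j)%C = RtoC 0)
        by (intros j j_le; rewrite zero by (apply skip_le, j_le); ring).
      rewrite (sum_n_eq_0 _ n row_0), zero by exact p_le. ring.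
  - assert (term : forall j, ((A i (skip p j) - A i p * ratio j) * d j
                              = RtoC 1 * (A i (skip p j) * d j) + - A i p * (ratio j * d j))%C) by (intros j; ring).
    specialize (solution i ltac:(lia)). rewrite (sum_n_ext _ _ n term), sum_n_lin in solution.
    rewrite <- solution. unfold x. ring.
Qed.

(** * Linear combinations of canonical basis elements *)

Lemma plus_form_lin (t : Z) (f g : C -> C) (c d : C) : plus_form t f -> plus_form t g ->
  plus_form t (fun z => c * f z + d * g z)%C.
Proof.
  intros [f_holo [f_law f_plus]] [g_holo [g_law g_plus]]. split; [|split].
  - apply holo_on_H_lin; auto.
  - intros p q r s gamma z z_in. rewrite (f_law p q r s gamma z z_in), (g_law p q r s gamma z z_in). ring.
  - intros n n_out. rewrite fcoef_lin, f_plus, g_plus by auto. ring.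
Qed.

Lemma exists_plus_form_sum (t : Z) (F : nat -> C -> C) (c : nat -> C) (N : nat) :
  (forall j, (j <= N)%nat -> plus_form t (F j)) ->
  exists h, plus_form t h /\ forall n, fcoef h n = sum_n (fun j => c j * fcoef (F j) n)%C N.
Proof.
  intros F_plus. induction N as [|N IH].
  - exists (fun z => c O * F O z + RtoC 0 * F O z)%C. assert (F0_plus := F_plus O (le_n O)).
    split; [apply plus_form_lin; auto|].
    intros n. rewrite sum_O, fcoef_lin by apply F0_plus. ring.
  - destruct IH as [h [h_plus h_coef]]; [auto|]. assert (FN_plus := F_plus (S N) (le_n (S N))).
    exists (fun z => RtoC 1 * h z + c (S N) * F (S N) z)%C. split; [apply plus_form_lin; auto|].
    intros n. rewrite fcoef_lin by (apply h_plus || apply FN_plus). rewrite h_coef, sum_Sn, Cmult_1_l. reflexivity.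
Qed.

Lemma sum_n_single (u : nat -> C) (N j : nat) : (j <= N)%nat ->
  (forall k, (k <= N)%nat -> k <> j -> u k = RtoC 0) -> sum_n u N = u j.
Proof.
  intros j_le zero. destruct N as [|N]; [rewrite sum_O; f_equal; lia|].
  rewrite (sum_n_skip u j N j_le), sum_n_eq_0; [apply Cplus_0_r|].
  intros k k_le. apply zero; [apply skip_le, k_le|]. unfold skip. destruct (Nat.ltb_spec k j); lia.
Qed.

Section CanonicalCombination.

Variables (t : Z) (N : nat) (index : nat -> Z) (F : nat -> C -> C) (c : nat -> C) (h : C -> C).
Hypothesis F_canonical : forall j, (j <= N)%nat -> canonical t (index j) (F j).
Hypothesis index_inj : forall j k, index j = index k -> j = k.
Hypothesis index_ge : forall j, (- Nk t <= index j)%Z.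
Hypothesis h_coef : forall n, fcoef h n = sum_n (fun j => c j * fcoef (F j) n)%C N.

Lemma fcoef_combination_index (j : nat) : (j <= N)%nat -> fcoef h (- index j) = c j.
Proof.
  intros j_le. rewrite h_coef, (sum_n_single _ N j j_le).
  - destruct (F_canonical j j_le) as [_ [lead _]]. rewrite lead. apply Cmult_1_r.
  - intros k k_le ne. destruct (F_canonical k k_le) as [_ [_ gap]]. rewrite gap; [apply Cmult_0_r| |].
    + specialize (index_ge j). lia.
    + intros equal. apply ne, index_inj. lia.
Qed.

Lemma fcoef_combination_gap (n : Z) : (n <= Nk t)%Z -> (forall j, (j <= N)%nat -> n <> (- index j)%Z) ->
  fcoef h n = RtoC 0.
Proof.
  intros n_le not_index. rewrite h_coef. apply sum_n_eq_0. intros j j_le.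
  destruct (F_canonical j j_le) as [_ [_ gap]]. rewrite gap by auto. apply Cmult_0_r.
Qed.

End CanonicalCombination.

(** * Arithmetic of the indices *)

Definition least_congruent (b r : Z) : Z := (b + (r - b) mod 4)%Z.

Lemma least_congruent_spec (b r : Z) :
  (b <= least_congruent b r < b + 4)%Z /\ ((least_congruent b r - r) mod 4 = 0)%Z.
Proof. unfold least_congruent. split; Z.div_mod_to_equations; lia. Qed.

Definition first_exponent (t m : Z) : Z := least_congruent (Nk t + 1) m.

(* The indices in this class are minus the exponents of the class that does not contain m. *)
Definition index_residue (t m : Z) : Z := if (m mod 4 =? 0)%Z then (- plus_sign t)%Z else 0%Z.

Definition first_index (t m : Z) : Z := least_congruent (- Nk t) (index_residue t m).

Lemma plus_form_zero_classes (t m : Z) (f : C -> C) (n0 n1 : Z) : plus_form t f -> plus_okb t m = true ->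
  (forall n, ((n - m) mod 4 = 0)%Z -> (n < n0)%Z -> fcoef f n = RtoC 0) ->
  (forall n, ((n + index_residue t m) mod 4 = 0)%Z -> (n < n1)%Z -> fcoef f n = RtoC 0) ->
  (2 * t + 3 < 3 * (n0 + n1))%Z -> forall n, fcoef f n = RtoC 0.
Proof.
  intros f_plus m_plus same_class other_class order_large. apply plus_okb_iff in m_plus.
  unfold index_residue in other_class.
  destruct (m mod 4 =? 0)%Z eqn:m_class; [apply Z.eqb_eq in m_class|apply Z.eqb_neq in m_class].
  - apply (plus_form_zero t f n0 n1 f_plus); [|exact other_class|exact order_large].
    intros n n_class. apply same_class. Z.div_mod_to_equations. lia.
  - destruct m_plus as [absurd|m_sign]; [contradiction|].
    apply (plus_form_zero t f n1 n0 f_plus); [| |lia].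
    + intros n n_class. apply other_class. rewrite Z.add_0_r. exact n_class.
    + intros n n_class. apply same_class. Z.div_mod_to_equations. lia.
Qed.

Lemma Nk_shift (t a : Z) : Nk (t + 12 * a) = (Nk t + 4 * a)%Z.
Proof.
  assert (kp_shift : kp_half (t + 12 * a) = kp_half t).
  { unfold kp_half. replace (t + 12 * a)%Z with (t + 2 * a * 6)%Z by ring. rewrite Z_mod_plus_full. reflexivity. }
  assert (ell_shift : ell (t + 12 * a) = (ell t + 2 * a)%Z).
  { unfold ell. rewrite kp_shift. replace (t + 12 * a - kp_half t)%Z with (t - kp_half t + 2 * a * 6)%Z by ring.
    apply Z_div_plus_full. lia. }
  unfold Nk. rewrite ell_shift, Z.even_add_mul_2.
  replace (t + 12 * a)%Z with (t + 2 * (6 * a))%Z by ring. rewrite Z.even_add_mul_2.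
  destruct (Z.even (ell t)); ring.
Qed.

Lemma plus_sign_shift (t a : Z) : plus_sign (t + 12 * a) = plus_sign t.
Proof.
  unfold plus_sign. replace (t + 12 * a)%Z with (t + 2 * (6 * a))%Z by ring. rewrite Z.even_add_mul_2. reflexivity.
Qed.

Lemma weight_gap (t m : Z) : plus_okb t m = true ->
  (2 * t + 3 < 3 * (first_exponent t m - first_index t m + 4))%Z.
Proof.
  rewrite plus_okb_iff. unfold first_exponent, first_index, least_congruent, index_residue.
  assert (split : exists r a, (0 <= r < 12 /\ t = r + 12 * a)%Z).
  { exists (t mod 12)%Z, (t / 12)%Z. Z.div_mod_to_equations. lia. }
  destruct split as [r [a [r_in ->]]]. rewrite Nk_shift, plus_sign_shift. intros m_plus.
  assert (r_cases : In r (0 :: 1 :: 2 :: 3 :: 4 :: 5 :: 6 :: 7 :: 8 :: 9 :: 10 :: 11 :: nil)%Z) by (simpl; lia).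
  simpl in r_cases. clear r_in.
  destruct (m mod 4 =? 0)%Z eqn:m_class; [apply Z.eqb_eq in m_class|apply Z.eqb_neq in m_class];
    repeat (destruct r_cases as [<-|r_cases];
      [vm_compute (Nk _); vm_compute (plus_sign _) in *; Z.div_mod_to_equations; lia|]);
    contradiction.
Qed.

Definition qualifying_index (t m : Z) (j : nat) : Z := (first_index t m + 4 * Z.of_nat j)%Z.

Lemma qualb_qualifying_index (t m : Z) (j : nat) : plus_okb t m = true -> qualb t m (qualifying_index t m j) = true.
Proof.
  rewrite plus_okb_iff. intros m_plus. unfold qualb, admissibleb.
  rewrite !Bool.andb_true_iff, Z.leb_le, Bool.negb_true_iff, Z.eqb_neq, plus_okb_iff.
  destruct (least_congruent_spec (- Nk t) (index_residue t m)) as [range class].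
  unfold qualifying_index, first_index. set (x := least_congruent _ _) in *. unfold index_residue in class.
  assert (sign_pred : plus_sign (t - 1) = (- plus_sign t)%Z).
  { unfold plus_sign. rewrite Z.even_sub. destruct (Z.even t); reflexivity. }
  rewrite sign_pred. assert (sign_cases := plus_sign_cases t).
  destruct (m mod 4 =? 0)%Z eqn:m_class; [apply Z.eqb_eq in m_class|apply Z.eqb_neq in m_class];
    (split; [split; [lia|]|]); Z.div_mod_to_equations; lia.
Qed.

Lemma exponent_classes_differ (t m : Z) : plus_okb t m = true -> ((m + index_residue t m) mod 4 <> 0)%Z.
Proof.
  rewrite plus_okb_iff. unfold index_residue.
  destruct (m mod 4 =? 0)%Z eqn:m_class; [apply Z.eqb_eq in m_class|apply Z.eqb_neq in m_class];
    destruct (plus_sign_cases t) as [-> | ->]; Z.div_mod_to_equations; lia.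
Qed.

Theorem vanishing_impossible (t m : Z) (f : Z -> C -> C) (N : nat) : plus_okb t m = true ->
  (forall i, admissibleb t i = true -> canonical t i (f i)) -> m = (first_exponent t m + 4 * Z.of_nat N)%Z ->
  ~ (forall j, (j <= N)%nat -> fcoef (f (qualifying_index t m j)) m = RtoC 0).
Proof.
  intros m_plus f_canonical m_eq all_vanish. set (index := qualifying_index t m). set (n1 := first_exponent t m) in *.
  assert (F_canonical : forall j, (j <= N)%nat -> canonical t (index j) (f (index j))).
  { intros j _. apply f_canonical. exact (proj1 (andb_prop _ _ (qualb_qualifying_index t m j m_plus))). }
  destruct (underdetermined_system N (fun l j => fcoef (f (index j)) (n1 + 4 * Z.of_nat l)%Z))
    as [c [[j0 [j0_le c_nz]] solution]].
  destruct (exists_plus_form_sum t (fun j => f (index j)) c N) as [h [h_plus h_coef]].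
  { intros j j_le. apply in_Mshriek_plus_form, F_canonical, j_le. }
  destruct (least_congruent_spec (Nk t + 1) m) as [n1_range n1_class].
  fold (first_exponent t m) in *. fold n1 in n1_range, n1_class.
  destruct (least_congruent_spec (- Nk t) (index_residue t m)) as [index_range index_class].
  fold (first_index t m) in *.
  assert (index_ge : forall j, (- Nk t <= index j)%Z) by (intros j; unfold index, qualifying_index; lia).
  assert (index_inj : forall j k, index j = index k -> j = k) by (intros j k; unfold index, qualifying_index; lia).
  assert (gap := fcoef_combination_gap t N index (fun j => f (index j)) c h F_canonical h_coef).
  apply c_nz.
  rewrite <- (fcoef_combination_index t N index (fun j => f (index j)) c h
                F_canonical index_inj index_ge h_coef j0 j0_le).
  apply (plus_form_zero_classes t m h (n1 + 4 * Z.of_nat (S N)) (- index N) h_plus m_plus).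
  - intros n n_class n_lt. destruct (Z_le_gt_dec n (Nk t)) as [n_le|n_gt].
    + apply gap; [exact n_le|]. intros j _ n_eq. apply (exponent_classes_differ t m m_plus).
      unfold index, qualifying_index in n_eq. Z.div_mod_to_equations. lia.
    + set (l := Z.to_nat ((n - n1) / 4)).
      assert (n_eq : n = (n1 + 4 * Z.of_nat l)%Z) by (unfold l; Z.div_mod_to_equations; lia).
      rewrite h_coef. destruct (Nat.eq_dec l N) as [l_eq|l_ne].
      * apply sum_n_eq_0. intros j j_le. rewrite n_eq, l_eq, <- m_eq, all_vanish by exact j_le. apply Cmult_0_r.
      * rewrite n_eq, <- (solution l) by lia. apply sum_n_ext. intros j. apply Cmult_comm.
  - intros n n_class n_lt. apply gap; intros; unfold index, qualifying_index in *; lia.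
  - unfold index, qualifying_index. assert (weight := weight_gap t m m_plus). fold n1 in weight. lia.
Qed.

Lemma length_filter_windows (p : nat -> bool) (width bound : nat) : (0 < width)%nat ->
  (forall s, (length (filter p (seq s width)) <= bound)%nat) ->
  forall L s, (length (filter p (seq s L)) <= bound * (L / width + 1))%nat.
Proof.
  intros width_pos window.
  assert (blocks : forall q s, (length (filter p (seq s (q * width))) <= q * bound)%nat).
  { induction q as [|q IH]; intros s; [simpl; lia|]. simpl. rewrite seq_app, filter_app, length_app.
    specialize (window s). specialize (IH (s + width)%nat). lia. }
  intros L s. specialize (blocks (L / width + 1)%nat s).
  assert (covered : ((L / width + 1) * width = L + ((L / width + 1) * width - L))%nat).
  { assert (division := Nat.div_mod_eq L width). assert (remainder := Nat.mod_upper_bound L width). nia. }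
  rewrite covered, seq_app, filter_app, length_app in blocks. lia.
Qed.

Lemma plus_okb_add_2 (t x : Z) : plus_okb t x = true -> plus_okb t (x + 2) = false.
Proof.
  intros x_plus. apply Bool.not_true_iff_false. revert x_plus. rewrite !plus_okb_iff.
  destruct (plus_sign_cases t) as [-> | ->]; Z.div_mod_to_equations; lia.
Qed.

Lemma rank_le (t m i : Z) : (- Nk t <= i)%Z -> (Z.of_nat (rank t m i) <= 2 * ((i + Nk t) / 4 + 1))%Z.
Proof.
  intros i_ge. unfold rank. set (p := fun k : nat => qualb t m (- Nk t + Z.of_nat k)%Z).
  assert (p_add_2 : forall k, p k = true -> p (S (S k)) = false).
  { intros k. unfold p, qualb, admissibleb. rewrite !Bool.andb_true_iff. intros [[_ k_plus] _].
    apply plus_okb_add_2 in k_plus.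
    replace (- Nk t + Z.of_nat (S (S k)))%Z with (- Nk t + Z.of_nat k + 2)%Z by lia.
    rewrite k_plus, Bool.andb_false_r. reflexivity. }
  assert (window : forall s, (length (filter p (seq s 4)) <= 2)%nat).
  { intros s. assert (p_s := p_add_2 s). assert (p_s1 := p_add_2 (S s)). simpl.
    destruct (p s), (p (S s)); rewrite ?p_s, ?p_s1 by reflexivity; simpl;
      destruct (p (S (S s))), (p (S (S (S s)))); simpl; lia. }
  assert (count := length_filter_windows p 4 2 ltac:(lia) window (Z.to_nat (i + Nk t)) 0).
  apply Nat2Z.inj_le in count.
  rewrite Nat2Z.inj_mul, Nat2Z.inj_add, Nat2Z.inj_div, Z2Nat.id in count by lia. exact count.
Qed.

Lemma Nk_bounds (t : Z) : (t - 10 <= 3 * Nk t <= t + 3)%Z.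
Proof.
  assert (kp_cases : (0 <= kp_half t <= 7 /\ (t - kp_half t) mod 6 = 0)%Z).
  { unfold kp_half. destruct (t mod 6)%Z as [|[p|p|]|p] eqn:residue; Z.div_mod_to_equations; lia. }
  unfold Nk, ell. set (k := kp_half t) in *.
  destruct (Z.even ((t - k) / 6)), (Z.even t); Z.div_mod_to_equations; lia.
Qed.

Lemma rank_qualifying_index_le (t m : Z) (j N : nat) : m = (first_exponent t m + 4 * Z.of_nat N)%Z -> (j <= N)%nat ->
  (2 * Z.of_nat (rank t m (qualifying_index t m j)) <= m - Nk t + 6)%Z.
Proof.
  intros m_eq j_le. destruct (least_congruent_spec (Nk t + 1) m) as [exponent_range _].
  destruct (least_congruent_spec (- Nk t) (index_residue t m)) as [index_range _].
  fold (first_exponent t m) in exponent_range. fold (first_index t m) in index_range.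
  assert (count := rank_le t m (qualifying_index t m j) ltac:(unfold qualifying_index; lia)).
  unfold qualifying_index in *. Z.div_mod_to_equations. lia.
Qed.

Lemma exists_first_exponent_steps (t m : Z) : (Nk t + 4 <= m)%Z ->
  exists N : nat, m = (first_exponent t m + 4 * Z.of_nat N)%Z.
Proof.
  intros m_ge. destruct (least_congruent_spec (Nk t + 1) m) as [range class]. fold (first_exponent t m) in *.
  exists (Z.to_nat ((m - first_exponent t m) / 4)). Z.div_mod_to_equations. lia.
Qed.

Lemma plus_okb_of_residue (s m : Z) :
  (m mod 4 = 0)%Z \/ (m mod 4 = if Z.even (s - 1) then 1 else 3)%Z -> plus_okb (1 - s) m = true.
Proof.
  rewrite plus_okb_iff. unfold plus_sign. replace (1 - s)%Z with (- (s - 1))%Z by ring. rewrite Z.even_opp.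
  destruct (Z.even (s - 1)); Z.div_mod_to_equations; lia.
Qed.

Lemma Cconst_le (m b : Z) : Cconst m b <= 7 / 4.
Proof. unfold Cconst. destruct (Z.even m); [destruct (Z.even b)|destruct (existsb _ _)]; lra. Qed.

Theorem theorem1p4 :
  exists A B : R, 0 < A /\ A <= 9 /\ 0 < B /\ B <= 109 /\
  forall s a b : Z, s = (12 * a + b)%Z -> In b b_range ->
  forall m : Z, A * IZR (Z.abs a) + B <= IZR m ->
    ((m mod 4 = 0)%Z \/ (m mod 4 = if Z.even (s - 1) then 1 else 3)%Z) ->
  forall f : Z -> C -> C,
    (forall i : Z, admissibleb (1 - s) i = true -> canonical (1 - s) i (f i)) ->
  forall M : Z,
    3 * IZR a + 3 * IZR m / 4 + IZR b / 2 - Cconst m b < IZR M ->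
    ~ (forall i : Z, qualb (1 - s) m i = true ->
         (Z.of_nat (rank (1 - s) m i) < M)%Z ->
         fcoef (f i) m = RtoC 0).
Proof.
  exists 9, 109. repeat (split; [lra|]).
  intros s a b s_eq b_in m m_large m_class f f_canonical M M_large all_vanish.
  assert (b_bounds : (6 <= b <= 19)%Z) by (unfold b_range in b_in; simpl in b_in; lia).
  assert (m_ge : (9 * Z.abs a + 109 <= m)%Z) by (apply le_IZR; rewrite plus_IZR, mult_IZR; exact m_large).
  assert (M_gt : (12 * a + 3 * m + 2 * b - 7 < 4 * M)%Z).
  { apply lt_IZR. rewrite minus_IZR, !plus_IZR, !mult_IZR. assert (C_le := Cconst_le m b). lra. }
  assert (m_plus := plus_okb_of_residue s m m_class). assert (Nk_in := Nk_bounds (1 - s)).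
  destruct (exists_first_exponent_steps (1 - s) m ltac:(lia)) as [N m_eq].
  apply (vanishing_impossible (1 - s) m f N m_plus f_canonical m_eq). intros j j_le. apply all_vanish.
  - apply qualb_qualifying_index, m_plus.
  - assert (count := rank_qualifying_index_le (1 - s) m j N m_eq j_le). lia.
Qed.
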